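(* Let $\mathbb{K}$ be a definably complete expansion of an ordered field. The following are equivalent: (1) $\mathbb{K}$ is i-minimal; (2) for every $n\in\mathbb{N}$, if $X$ is a definable subset of $\mathbb{K}^n$ with empty interior, then $X$ is nowhere dense; (3) for every definable set $X$, $\mathrm{bd}(X)$ has empty interior; (4) for every definable $X\subseteq\mathbb{K}$, $\dim X=\dim\overline{X}$; (5) for every definable $X$, $\dim X=\dim\overline{X}$; (6) if $U\subseteq\mathbb{K}^n$ is definable and open, and $f:U\to\mathbb{K}$ is definable, then $\mathcal{D}(f)$ is nowhere dense; (7) for every $n,m\in\mathbb{N}$, if $A\subseteq\mathbb{K}^{n+m}$ is definable, then $\mathfrak{B}_n(A)$ is nowhere dense; (8) for every $n,m\in\mathbb{N}$, if $A\subseteq\mathbb{K}^{n+m}$ is definable, then the set $\{x\in\mathbb{K}^n:(\partial A)_x\ne\partial(A_x)\}$ is nowhere dense; (9) for every definable $X\subseteq\mathbb{K}$, either $X$ has interior, or it is meager; (10) every definable set either has interior, or it is meager; (11) for all definable $A,B\subseteq\mathbb{K}$, $\dim(A\cup B)=\max\{\dim A,\dim B\}$; (12) for all $n$ and all definable $A,B\subseteq\mathbb{K}^n$, $\dim(A\cup B)=\max\{\dim A,\dim B\}$; (13) for all $n$ and all definable $A\subseteq\mathbb{K}^n$, if $\dim A=d$, then $\{x\in\mathbb{K}^d:\dim A_x>0\}$ is nowhere dense; (14) for all $d,k,m,n\in\mathbb{N}$ with $k\le n$ and $d\le m$, and every definable $A\subseteq\mathbb{K}^{n+m}$ with $\dim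 A\le d+k$, the set $C:=\{x\in\mathbb{K}^n:\dim A_x\ge d\}$ satisfies $\dim(C)\le k$; (15) any at most pseudo-enumerable union of subsets of $\mathbb{K}$ with empty interior has empty interior; (16) for every $d\le n\in\mathbb{N}$, any at most pseudo-enumerable union of subsets of $\mathbb{K}^n$ of dimension less than or equal to $d$ has dimension less than or equal to $d$. Moreover, if $\mathbb{K}$ is i-minimal, then: (I) every meager set is nowhere dense; (II) for every $d\le n\in\mathbb{N}$, any increasing definable union of subsets of $\mathbb{K}^n$ of dimension less than or equal to $d$ has dimension less than or equal to $d$; (III) if $U\subseteq\mathbb{K}$ is open and definable, and $f:U\to\mathbb{K}$ is definable, then there exists $D\subseteq\mathbb{K}$ definable, closed and with empty interior, such that, for every definably connected component $I$ of $U\setminus D$, $f\restriction I$ is continuous, and either constant or strictly monotone; (IV) every definable set is almost open.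
   Context: ''Definable'' means definable with parameters in $\mathbb{K}$. $\mathbb{K}$ is definably complete if every definable subset of $\mathbb{K}$ has a supremum in $\mathbb{K}\cup\{\pm\infty\}$. $\mathbb{K}$ is i-minimal if every definable $X\subseteq\mathbb{K}$ with empty interior is nowhere dense. Topology: order topology on $\mathbb{K}$, product topology on $\mathbb{K}^n$. $\overline{X}$ (or $\mathrm{cl}(X)$) is the closure, $\partial X=\overline{X}\setminus X$, and $\mathrm{bd}(X)$ is $\overline{X}$ minus the interior of $X$. For nonempty definable $X\subseteq\mathbb{K}^n$, $\dim X$ is the largest $d$ such that the projection of $X$ onto some $d$-dimensional coordinate space has nonempty interior; $\dim\emptyset=-\infty$. $\mathbb{K}^0$ is a point. For $A\subseteq\mathbb{K}^{n+m}$ and $x\in\mathbb{K}^n$, $A_x=\{y\in\mathbb{K}^m:(x,y)\in A\}$, and $\mathfrak{B}_n(A)=\{x\in\mathbb{K}^n:\mathrm{cl}(A)_x\setminus\mathrm{cl}(A_x)\ne\emptyset\}$. $\mathcal{D}(f)$ is the set of discontinuity points of $f$. A definable $X\subseteq\mathbb{K}^n$ is meager if there is a definable increasing family $(C_t:t\in\mathbb{K})$ of nowhere dense subsets of $\mathbb{K}^n$ with $X\subseteq\bigcup_tC_t$. A definable $X\subseteq\mathbb{K}^n$ is almost open if there is a definable open $U\subseteq\mathbb{K}^n$ such that the symmetric difference $X\,\Delta\,U$ is meager. A definable set is at most pseudo-enumerable if it is the image of a definable function whose domain is a definable discrete subset of some $\mathbb{K}^m$. An at most pseudo-enumerable union is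 the union of a definable family $(X_t:t\in N)$ whose index set $N$ is at most pseudo-enumerable. An increasing definable union is the union of a definable family $(X_t:t\in\mathbb{K})$ with $X_s\subseteq X_t$ for $s\le t$. *)

(* Defs.v *)
(* The ordered field K is an arbitrary [realFieldType]; its
   library topology is the order topology ([real_order_nbhsE]), and 'rV[K]_n
   with its entrywise (product) topology plays the role of K^n. *)
From HB Require Import structures.
From mathcomp Require Import all_boot all_order all_algebra.
From mathcomp Require Import all_classical all_reals all_analysis.

Set Implicit Arguments.
Unset Strict Implicit.
Unset Printing Implicit Defensive.

Import Order.TTheory GRing.Theory Num.Theory.
Import numFieldNormedType.Exports.

Local Open Scope classical_set_scope.
Local Open Scope ring_scope.

(* The non-logical symbols added to those of ordered fields, together with
   their interpretations in K. *)
Record expansion (K : realFieldType) := Expansion {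
  fsym : Type;
  farity : fsym -> nat;
  finterp : forall s : fsym, 'rV[K]_(farity s) -> K;
  rsym : Type;
  rarity : rsym -> nat;
  rinterp : forall s : rsym, set 'rV[K]_(rarity s) }.

Section Syntax.
Variables (K : realFieldType) (M : expansion K).

(* Terms and formulas in n free variables; the parameters from K are included
   as constants. *)
Inductive fo_term (n : nat) : Type :=
| TVar of 'I_n
| TConst of K
| TAdd of fo_term n & fo_term n
| TOpp of fo_term n
| TMul of fo_term n & fo_term n
| TFun (s : fsym M) of ('I_(farity s) -> fo_term n).

(* [FEx] binds the variable 0 and shifts the other ones. *)
Inductive fo_formula : nat -> Type :=
| FEq n of fo_term n & fo_term n : fo_formula n
| FLt n of fo_term n & fo_term n : fo_formula n
| FRel n (s : rsym M) of ('I_(rarity s) -> fo_term n) : fo_formula n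
| FNot n of fo_formula n : fo_formula n
| FAnd n of fo_formula n & fo_formula n : fo_formula n
| FEx n of fo_formula n.+1 : fo_formula n.

Fixpoint eval_term n (x : 'rV[K]_n) (t : fo_term n) : K :=
  match t with
  | TVar i => x ord0 i
  | TConst a => a
  | TAdd t1 t2 => eval_term x t1 + eval_term x t2
  | TOpp t1 => - eval_term x t1
  | TMul t1 t2 => eval_term x t1 * eval_term x t2
  | TFun s args => finterp (\row_i eval_term x (args i))
  end.

Fixpoint sat_formula n (phi : fo_formula n) : set 'rV[K]_n :=
  match phi in fo_formula n return set 'rV[K]_n with
  | FEq _ t1 t2 => fun x => eval_term x t1 = eval_term x t2
  | FLt _ t1 t2 => fun x => eval_term x t1 < eval_term x t2
  | FRel _ s args => fun x => rinterp (\row_i eval_term x (args i))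
  | FNot _ phi1 => fun x => ~ sat_formula phi1 x
  | FAnd _ phi1 phi2 => fun x => sat_formula phi1 x /\ sat_formula phi2 x
  | FEx _ phi1 => fun x => exists a : K, sat_formula phi1 (row_mx a%:M x)
  end.

Definition definable n (X : set 'rV[K]_n) : Prop :=
  exists phi : fo_formula n, X = [set x | sat_formula phi x].

End Syntax.

(* The identification of the subsets of K with those of K^1. *)
Definition setK1 (K : realFieldType) (X : set K) : set 'rV[K]_1 :=
  [set v | X (v ord0 ord0)].

Definition nowhere_dense (T : topologicalType) (X : set T) : Prop :=
  (closure X)° = set0.

Definition frontier (T : topologicalType) (X : set T) : set T :=
  closure X `\` X.

Definition boundary (T : topologicalType) (X : set T) : set T :=
  closure X `\` X°.

Definition discrete (T : topologicalType) (X : set T) : Prop :=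
  forall x, X x -> isolated X x.

Section Sets.
Variable K : realFieldType.

Definition fiber n m (A : set 'rV[K]_(n + m)) (x : 'rV[K]_n) : set 'rV[K]_m :=
  [set y | A (row_mx x y)].

(* The set $\mathfrak{B}_n(A)$. *)
Definition bad_fibers n m (A : set 'rV[K]_(n + m)) : set 'rV[K]_n :=
  [set x | fiber (closure A) x `\` closure (fiber A x) !=set0].

Definition coord_proj n (I : {set 'I_n}) (x : 'rV[K]_n) : 'rV[K]_#|I| :=
  colsub (fun j : 'I_#|I| => enum_val j) x.

(* If X is not empty then I = set0 qualifies, K^0 being a point; no I qualifies
   if X is empty, and then the maximum is -oo. *)
Definition topdim n (X : set 'rV[K]_n) : \bar int :=
  \big[maxe/-oo%E]_(I : {set 'I_n} | `[< (coord_proj I @` X)° !=set0 >])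
    (#|I|%:Z)%:E.

(* $\mathcal{D}(f)$ for f : U -> K^m; the values of f outside U are not used. *)
Definition discont (S T : topologicalType) (U : set S) (f : S -> T) : set S :=
  [set x | U x /\ ~ (f @ within U (nbhs x) --> f x)].

Definition strictly_monotone_on (I : set K) (f : K -> K) : Prop :=
  (forall x y, I x -> I y -> x < y -> f x < f y) \/
  (forall x y, I x -> I y -> x < y -> f y < f x).

End Sets.

Section Definability.
Variables (K : realFieldType) (M : expansion K).

Definition definably_complete : Prop :=
  forall X : set K, definable M (setK1 X) ->
    exists s : \bar K, supremums (EFin @` X) s.

Definition i_minimal : Prop :=
  forall X : set K, definable M (setK1 X) -> X° = set0 -> nowhere_dense X.

(* A function f : D -> K^p is definable if its graph is. *)
Definition definable_fun n p (D : set 'rV[K]_n) (f : 'rV[K]_n -> 'rV[K]_p) :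
    Prop :=
  definable M [set z : 'rV[K]_(n + p) |
    D (lsubmx z) /\ rsubmx z = f (lsubmx z)].

Definition definable_family p n (N : set 'rV[K]_p)
    (X : 'rV[K]_p -> set 'rV[K]_n) : Prop :=
  definable M [set z : 'rV[K]_(p + n) | N (lsubmx z) /\ X (lsubmx z) (rsubmx z)].

Definition increasing_definable_family n (X : K -> set 'rV[K]_n) : Prop :=
  definable_family setT (fun t : 'rV[K]_1 => X (t ord0 ord0)) /\
  forall s t : K, s <= t -> X s `<=` X t.

Definition meager n (X : set 'rV[K]_n) : Prop :=
  definable M X /\
  exists C : K -> set 'rV[K]_n,
    [/\ increasing_definable_family C,
        forall t, nowhere_dense (C t)
      & X `<=` \bigcup_(t in [set: K]) C t].

Definition almost_open n (X : set 'rV[K]_n) : Prop :=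
  exists U : set 'rV[K]_n,
    [/\ definable M U, open U & meager (X `+` U)].

Definition at_most_pseudo_enumerable p (N : set 'rV[K]_p) : Prop :=
  exists (m : nat) (D : set 'rV[K]_m) (f : 'rV[K]_m -> 'rV[K]_p),
    [/\ definable M D, discrete D, definable_fun D f & N = f @` D].

(* The definable counterpart of [connected]. *)
Definition definably_connected n (X : set 'rV[K]_n) : Prop :=
  definable M X /\
  forall B, definable M B -> B !=set0 ->
    (exists2 C, open C & B = X `&` C) ->
    (exists2 C, closed C & B = X `&` C) -> B = X.

(* The components of X are its maximal nonempty definably connected subsets. *)
Definition definably_connected_component n (X C : set 'rV[K]_n) : Prop :=
  [/\ C !=set0, C `<=` X, definably_connected C
    & forall B, definably_connected B -> C `<=` B -> B `<=` X -> B = C].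

End Definability.

(* Main.v *)
(* The key point is a Baire category theorem for the definably complete K: an
   interval is not the union of an increasing definable family (C_t) of closed
   nowhere dense sets. If it were, the lengths of the gaps of some C_t, or else
   the times at which the points enter the C_t, would give an unbounded closed
   discrete definable N, along which definable induction is possible. Following
   N, one replaces a gap of C_n by a gap of the next C_n' inside it, according
   to a definable rule. No coding of finite sequences is needed: a point of the
   current gap determines the earlier gaps around it, hence the whole history.
   The rule always gets rid of the older endpoint, so that a point common to the
   closures of all these gaps lies in no C_t.

   If K is i-minimal, then by induction on n the definable subsets of K^n with
   empty interior are nowhere dense, and K^n is Baire. The tool is a selection
   lemma: if for all x in an open set there are d > 0 and y with S(x, y, d), S
   being monotone in d, then on a smaller open set d can be taken constant (by
   Baire) and y within d of a constant c, because a bounded definable function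
   has small oscillation on some open set. Hence a set whose fibers over an open
   set all have interior has interior, and the statements on discontinuities, on
   closures of fibers and on dimensions follow. A pseudo-enumerable union is an
   increasing union of unions over bounded and uniformly separated index sets,
   for which definable induction is available.

   Conversely, if X has empty interior but is dense in an interval J, then each
   condition fails for a set built from X and J \ X. *)
Require Import Defs.
From HB Require Import structures.
From mathcomp Require Import all_boot all_order all_algebra.
From mathcomp Require Import all_classical all_reals all_analysis.
From mathcomp Require Import lra.

Set Implicit Arguments.
Unset Strict Implicit.
Unset Printing Implicit Defensive.

Import Order.TTheory GRing.Theory Num.Theory.
Import numFieldNormedType.Exports.

Local Open Scope classical_set_scope.
Local Open Scope ring_scope.


(** * Definable sets and functions *)

Section Definability.
Variables (K : realFieldType) (M : expansion K).

(** The obstacle throughout is that [K] may be non-Archimedean and that only definable sets have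
    suprema: intervals cannot be chosen one after another, and a sequence of nested intervals may
    have no common point. Every construction must therefore be a single formula, and every induction
    over [K] is an instance of the existence of a supremum, applied to the points up to which a
    property holds. This is why definability is checked everywhere, and why topology is expressed by
    cubes.

    The endpoints of the gaps need care because gaps are open: a common point of their closures may
    be a permanent endpoint. A rule by age dislodges it, since a new endpoint is always younger than
    one that stays.

    In several variables, selection takes the place of compactness. A selected point is only known
    to lie within [d] of a constant, so properties are selected with room [2 * d].

    The conditions are not chained directly. Each yields i-minimality, which yields the next one, so
    counterexamples on the line or in the plane are enough. *)

Fixpoint rename_term p n (s : 'I_p -> 'I_n) (t : fo_term M p) : fo_term M n :=
  match t with
  | TVar i => TVar _ (s i)
  | TConst a => TConst _ _ a
  | TAdd t1 t2 => TAdd (rename_term s t1) (rename_term s t2)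
  | TOpp t1 => TOpp (rename_term s t1)
  | TMul t1 t2 => TMul (rename_term s t1) (rename_term s t2)
  | TFun f args => TFun (fun i => rename_term s (args i))
  end.

Lemma eval_rename p n (s : 'I_p -> 'I_n) (t : fo_term M p) x :
  eval_term x (rename_term s t) = eval_term (\row_j x ord0 (s j)) t.
Proof.
elim: t => //= [i|t1 -> t2 ->|t1 ->|t1 -> t2 ->|f args IH] //.
  by rewrite mxE.
by congr (finterp _); apply/rowP => j; rewrite !mxE.
Qed.

Definition lift_renaming p n (s : 'I_p -> 'I_n) : 'I_p.+1 -> 'I_n.+1 :=
  fun i => match @fintype.split 1 p i with
           | inl j => @lshift 1 n j
           | inr j => @rshift 1 n (s j)
           end.

Lemma definable_ext n (X Y : set 'rV[K]_n) :
  (forall x, X x <-> Y x) -> definable M X -> definable M Y.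
Proof. by move=> /predeqP ->. Qed.

(** The induction is over all renamings at once, since under a quantifier the renaming must be
    lifted so as to fix the bound variable. *)
Lemma definable_rename p n (s : 'I_p -> 'I_n) (X : set 'rV[K]_p) :
  definable M X -> definable M (fun x => X (\row_j x ord0 (s j))).
Proof.
suff main q (phi : fo_formula M q) m (r : 'I_q -> 'I_m) :
    definable M (fun x => sat_formula phi (\row_j x ord0 (r j))).
  by case=> phi ->; exact: main.
elim: q / phi m r => [q t1 t2|q t1 t2|q R args|q f IH|q f IHf g IHg|q f IH] m r.
- exists (FEq (rename_term r t1) (rename_term r t2)).
  by apply/seteqP; split => x /=; rewrite !eval_rename.
- exists (FLt (rename_term r t1) (rename_term r t2)).
  by apply/seteqP; split => x /=; rewrite !eval_rename.
- exists (FRel (fun i => rename_term r (args i))).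
  apply/predeqP => x /=.
  have -> : \row_i eval_term (\row_j x ord0 (r j)) (args i) =
            \row_i eval_term x (rename_term r (args i)).
    by apply/rowP => i; rewrite !mxE eval_rename.
  by [].
- have [g gE] := IH m r; exists (FNot g).
  by move/predeqP: gE => gE; apply/predeqP => x /=; rewrite gE.
- have [f' fE] := IHf m r; have [g' gE] := IHg m r; exists (FAnd f' g').
  move/predeqP: fE => fE; move/predeqP: gE => gE.
  by apply/predeqP => x /=; rewrite fE gE.
- have [g gE] := IH m.+1 (lift_renaming r); exists (FEx g).
  move/predeqP: gE => gE; apply/predeqP => x /=.
  have E a : (\row_j (row_mx a%:M x) ord0 (lift_renaming r j)) =
             row_mx a%:M (\row_j x ord0 (r j)) :> 'rV[K]_(1 + q).
    apply/rowP => j; rewrite [LHS]mxE [RHS]mxE /lift_renaming.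
    case: (@fintype.split 1 q j) => k; first by rewrite row_mxEl.
    by rewrite row_mxEr [RHS]mxE.
  by split=> -[a Ha]; exists a; [apply/gE; rewrite E|rewrite -E; apply/gE].
Qed.

Lemma definable_not n (X : set 'rV[K]_n) :
  definable M X -> definable M (fun x => ~ X x).
Proof. by case=> f ->; exists (FNot f). Qed.

Lemma definable_and n (X Y : set 'rV[K]_n) :
  definable M X -> definable M Y -> definable M (fun x => X x /\ Y x).
Proof. by case=> f -> [g ->]; exists (FAnd f g). Qed.

Lemma definable_or n (X Y : set 'rV[K]_n) :
  definable M X -> definable M Y -> definable M (fun x => X x \/ Y x).
Proof.
move=> /definable_not dX /definable_not dY.
have := definable_not (definable_and dX dY).
by apply: definable_ext => x; rewrite not_andE !notK.
Qed.

Lemma definable_imp n (X Y : set 'rV[K]_n) :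
  definable M X -> definable M Y -> definable M (fun x => X x -> Y x).
Proof.
move=> dX /definable_not dY; have := definable_not (definable_and dX dY).
by apply: definable_ext => x; rewrite -implypN notK.
Qed.

Lemma definable_Prop n (P : Prop) : definable M (fun _ : 'rV[K]_n => P).
Proof.
case: (pselect P) => HP.
  by exists (FEq (TConst M n 0) (TConst M n 0)); apply/predeqP => x /=.
exists (FLt (TConst M n 0) (TConst M n 0)).
by apply/predeqP => x /=; rewrite ltxx.
Qed.

Lemma definable_forall_fin n (T : finType) (P : 'rV[K]_n -> T -> Prop) :
  (forall t, definable M (fun x => P x t)) ->
  definable M (fun x => forall t, P x t).
Proof.
move=> dP; suff D (s : seq T) : definable M (fun x => forall t, t \in s -> P x t).
  by apply: definable_ext (D (enum T)) => x; split=> H t *; apply: H;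
    rewrite ?mem_enum.
elim: s => [|t s IH].
  by apply: definable_ext (definable_Prop n True) => x.
apply: definable_ext (definable_and (dP t) IH) => x; split.
  by case=> Pt H u; rewrite in_cons => /predU1P[->|/H].
move=> H; split=> [|u us]; first by apply: H; rewrite mem_head.
by apply: H; rewrite in_cons us orbT.
Qed.

Lemma definable_exists_fin n (T : finType) (P : 'rV[K]_n -> T -> Prop) :
  (forall t, definable M (fun x => P x t)) ->
  definable M (fun x => exists t, P x t).
Proof.
move=> dP; apply: definable_ext (definable_not (definable_forall_fin
  (fun t => definable_not (dP t)))) => x.
by rewrite -existsNE; split=> -[t Ht]; exists t; [apply: contrapT|move=> /(_ Ht)].
Qed.

Lemma definable_exists_head n (X : set 'rV[K]_(1 + n)) :
  definable M X -> definable M (fun x => exists a : K, X (row_mx a%:M x)).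
Proof. by case=> f ->; exists (FEx f). Qed.

(** A block is quantified one coordinate at a time: [s] reads the first coordinate of the block at
    position 0, the only one that [FEx] binds. *)
Lemma definable_exists_row n m (X : set 'rV[K]_(n + m)) :
  definable M X -> definable M (fun x => exists y : 'rV[K]_m, X (row_mx x y)).
Proof.
elim: m n X => [|m IH] n X dX.
  pose s (i : 'I_(n + 0)) : 'I_n := cast_ord (addn0 n) i.
  apply: definable_ext (definable_rename s dX) => x.
  have E y : (\row_j x ord0 (s j)) = row_mx x y :> 'rV[K]_(n + 0).
    apply/rowP => j; rewrite mxE; have [k -> |[]//] := split_ordP j.
    by rewrite row_mxEl; congr (x _ _); apply: val_inj.
  by split=> [|[y]]; [exists 0; rewrite -E|rewrite -(E y)].
pose s (i : 'I_(n + m.+1)) : 'I_(1 + (n + m)) :=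
  match fintype.split i with
  | inl j => rshift 1 (lshift m j)
  | inr j => match @fintype.split 1 m j with
             | inl _ => lshift (n + m) ord0
             | inr k => rshift 1 (rshift n k)
             end
  end.
have /IH := definable_exists_head (definable_rename s dX).
apply: definable_ext => x.
have E a y : (\row_j (row_mx a%:M (row_mx x y) : 'rV[K]_(1 + (n + m))) ord0 (s j)) =
           row_mx x (row_mx a%:M y : 'rV[K]_(1 + m)) :> 'rV[K]_(n + m.+1).
  apply/rowP => j; rewrite [LHS]mxE [RHS]mxE /s.
  case: (@fintype.split n m.+1 j) => k; first by rewrite row_mxEr row_mxEl.
  rewrite [RHS]mxE; case: (@fintype.split 1 m k) => l.
    by rewrite row_mxEl (ord1 l).
  by rewrite !row_mxEr.
split=> [[y [a]]|[y]]; first by rewrite E; exists (row_mx a%:M y).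
rewrite -[y](@hsubmxK _ 1 1 m).
rewrite [lsubmx _]mx11_scalar => H; exists (@rsubmx _ 1 1 m y).
by exists ((@lsubmx _ 1 1 m y) 0 0); rewrite E.
Qed.

Lemma definable_row_ex n m (P : 'rV[K]_n -> 'rV[K]_m -> Prop) :
  definable M (fun z : 'rV[K]_(n + m) => P (lsubmx z) (rsubmx z)) ->
  definable M (fun x => exists y, P x y).
Proof.
move/definable_exists_row; apply: definable_ext => x.
by split=> -[y]; [rewrite row_mxKl row_mxKr|]; exists y;
  rewrite ?row_mxKl ?row_mxKr.
Qed.

Lemma definable_row_all n m (P : 'rV[K]_n -> 'rV[K]_m -> Prop) :
  definable M (fun z : 'rV[K]_(n + m) => P (lsubmx z) (rsubmx z)) ->
  definable M (fun x => forall y, P x y).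
Proof.
move/definable_not.
move/(@definable_row_ex _ _ (fun x y => ~ P x y))/definable_not.
apply: definable_ext => x; split=> [/forallNP H y|H [y]]; last by apply.
exact: contrapT.
Qed.

Lemma definable_ex n (P : 'rV[K]_n -> K -> Prop) :
  definable M (fun z : 'rV[K]_(n + 1) => P (lsubmx z) (rsubmx z ord0 ord0)) ->
  definable M (fun x => exists a, P x a).
Proof.
move/(@definable_row_ex _ _ (fun x (y : 'rV_1) => P x (y ord0 ord0))).
apply: definable_ext => x; split=> -[a Ha]; first by exists (a ord0 ord0).
by exists a%:M; rewrite mxE.
Qed.

Lemma definable_all n (P : 'rV[K]_n -> K -> Prop) :
  definable M (fun z : 'rV[K]_(n + 1) => P (lsubmx z) (rsubmx z ord0 ord0)) ->
  definable M (fun x => forall a, P x a).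
Proof.
move/(@definable_row_all _ _ (fun x (y : 'rV_1) => P x (y ord0 ord0))).
apply: definable_ext => x; split=> H a; last exact: H.
by have := H a%:M; rewrite mxE.
Qed.

(** * Definable functions and their substitution into definable sets *)

Definition dfun n (t : 'rV[K]_n -> K) :=
  definable M (fun z : 'rV[K]_(n + 1) => rsubmx z ord0 ord0 = t (lsubmx z)).

Definition dmap n p (g : 'rV[K]_n -> 'rV[K]_p) :=
  forall j, dfun (fun x => g x ord0 j).

(** Functions are eliminated through their graphs: [g x] lies in [X] iff some [y] in [X] has the
    coordinates of [g x]. *)
Lemma definable_comp n p (X : set 'rV[K]_p) (g : 'rV[K]_n -> 'rV[K]_p) :
  definable M X -> dmap g -> definable M (fun x => X (g x)).
Proof.
move=> dX dg.
have : definable M (fun z : 'rV[K]_(n + p) =>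
    X (rsubmx z) /\ forall j, rsubmx z ord0 j = g (lsubmx z) ord0 j).
  apply: definable_and.
    apply: definable_ext (definable_rename (@rshift n p) dX) => z.
    by rewrite (_ : \row_j _ = rsubmx z)//; apply/rowP => j; rewrite !mxE.
  apply: definable_forall_fin => j.
  pose s (i : 'I_(n + 1)) : 'I_(n + p) :=
    match fintype.split i with inl k => lshift p k | inr _ => rshift n j end.
  apply: definable_ext (definable_rename s (dg j)) => z.
  rewrite (_ : lsubmx _ = lsubmx z); last first.
    by apply/rowP => k; rewrite !mxE /s (unsplitK (inl k)).
  by rewrite !mxE /s (unsplitK (inr _)).
move/definable_exists_row; apply: definable_ext => x; split.
  by case=> y; rewrite row_mxKl row_mxKr => -[Xy /rowP <-].
by move=> H; exists (g x); rewrite row_mxKl row_mxKr.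
Qed.

Lemma dfun_rename p n (s : 'I_p -> 'I_n) t :
  dfun t -> dfun (fun x => t (\row_j x ord0 (s j))).
Proof.
move=> dt; pose r (i : 'I_(p + 1)) : 'I_(n + 1) :=
  match fintype.split i with inl k => lshift 1 (s k) | inr k => rshift n k end.
apply: definable_ext (definable_rename r dt) => z.
rewrite (_ : lsubmx (\row_j _) = \row_j lsubmx z ord0 (s j)); last first.
  by apply/rowP => k; rewrite !mxE /r (unsplitK (inl k)).
by rewrite !mxE /r (unsplitK (inr _)).
Qed.

Lemma dfun_coord n (i : 'I_n) : dfun (fun x => x ord0 i).
Proof.
exists (FEq (TVar M (rshift n ord0)) (TVar M (lshift 1 i))).
by apply/predeqP => z /=; rewrite !mxE.
Qed.

Lemma dfun_cst n (c : K) : dfun (fun _ : 'rV[K]_n => c).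
Proof.
exists (FEq (TVar M (rshift n ord0)) (TConst M _ c)).
by apply/predeqP => z /=; rewrite !mxE.
Qed.

Lemma dfun_entry n p (g : 'rV[K]_n -> 'rV[K]_p) j :
  dmap g -> dfun (fun x => g x ord0 j).
Proof. exact. Qed.

Lemma dmap_id n : dmap (fun x : 'rV[K]_n => x).
Proof. exact: dfun_coord. Qed.

Lemma dmap_cst n p (c : 'rV[K]_p) : dmap (fun x : 'rV[K]_n => c).
Proof. move=> j; exact: dfun_cst. Qed.

Lemma dfun_comp n p (t : 'rV[K]_p -> K) (g : 'rV[K]_n -> 'rV[K]_p) :
  dfun t -> dmap g -> dfun (fun x => t (g x)).
Proof.
move=> dt dg.
have := @definable_comp (n + 1) _ _
  (fun z => row_mx (g (lsubmx z)) (rsubmx z)) dt.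
have D : dmap (fun z : 'rV[K]_(n + 1) => row_mx (g (lsubmx z)) (rsubmx z)).
  move=> j; rewrite /dfun; have [k ->|k ->] := split_ordP j.
    apply: definable_ext (dfun_rename (lshift 1) (dg k)) => z.
    rewrite row_mxEl (_ : \row_j _ = lsubmx (lsubmx z)) //.
    by apply/rowP => l; rewrite !mxE.
  apply: definable_ext (dfun_coord (rshift n k)) => z.
  by rewrite row_mxEr; rewrite [rsubmx (lsubmx z) _ _]mxE.
by move=> /(_ D); apply: definable_ext => z; rewrite row_mxKl row_mxKr.
Qed.

Lemma dmap_lsubmx n p q (g : 'rV[K]_n -> 'rV[K]_(p + q)) :
  dmap g -> dmap (fun x => lsubmx (g x)).
Proof.
move=> dg j; apply: definable_ext (dg (lshift q j)) => z.
by rewrite [lsubmx (g _) _ _]mxE.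
Qed.

Lemma dmap_rsubmx n p q (g : 'rV[K]_n -> 'rV[K]_(p + q)) :
  dmap g -> dmap (fun x => rsubmx (g x)).
Proof.
move=> dg j; apply: definable_ext (dg (rshift p j)) => z.
by rewrite [rsubmx (g _) _ _]mxE.
Qed.

Lemma dmap_row_mx n p q (g : 'rV[K]_n -> 'rV[K]_p) (h : 'rV[K]_n -> 'rV[K]_q) :
  dmap g -> dmap h -> dmap (fun x => row_mx (g x) (h x)).
Proof.
move=> dg dh j; have [k ->|k ->] := split_ordP j.
  by apply: definable_ext (dg k) => z; rewrite row_mxEl.
by apply: definable_ext (dh k) => z; rewrite row_mxEr.
Qed.

Lemma dmap_colsub n p q (s : 'I_p -> 'I_q) (g : 'rV[K]_n -> 'rV[K]_q) :
  dmap g -> dmap (fun x => colsub s (g x)).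
Proof.
by move=> dg j; apply: definable_ext (dg (s j)) => z; rewrite [colsub _ _ _ _]mxE.
Qed.

Lemma dmap_scalar n (t : 'rV[K]_n -> K) :
  dfun t -> dmap (fun x => (t x)%:M : 'rV[K]_1).
Proof.
move=> dt j; apply: definable_ext dt => z.
by rewrite [(_%:M) _ _]mxE (ord1 j) eqxx mulr1n.
Qed.

Lemma dfun_binary (op : K -> K -> K) n (a b : 'rV[K]_n -> K) :
  dfun (fun w : 'rV[K]_(1 + 1) => op (lsubmx w ord0 ord0) (rsubmx w ord0 ord0)) ->
  dfun a -> dfun b -> dfun (fun x => op (a x) (b x)).
Proof.
move=> dop da db.
have := dfun_comp dop (dmap_row_mx (dmap_scalar da) (dmap_scalar db)).
by apply: definable_ext => z; rewrite row_mxKl row_mxKr !mxE.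
Qed.

Lemma dfun_add n (a b : 'rV[K]_n -> K) :
  dfun a -> dfun b -> dfun (fun x => a x + b x).
Proof.
apply: dfun_binary; exists (FEq (TVar M (rshift (1 + 1) ord0))
  (TAdd (TVar M (lshift 1 (lshift 1 ord0))) (TVar M (lshift 1 (rshift 1 ord0))))).
by apply/predeqP => z /=; rewrite !mxE.
Qed.

Lemma dfun_mul n (a b : 'rV[K]_n -> K) :
  dfun a -> dfun b -> dfun (fun x => a x * b x).
Proof.
apply: dfun_binary; exists (FEq (TVar M (rshift (1 + 1) ord0))
  (TMul (TVar M (lshift 1 (lshift 1 ord0))) (TVar M (lshift 1 (rshift 1 ord0))))).
by apply/predeqP => z /=; rewrite !mxE.
Qed.

Lemma dfun_opp n (a : 'rV[K]_n -> K) : dfun a -> dfun (fun x => - a x).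
Proof.
move=> da; apply: definable_ext (dfun_mul (dfun_cst n (-1)) da) => z.
by rewrite mulN1r.
Qed.

Lemma definable_rel2 (P : K -> K -> Prop) n (a b : 'rV[K]_n -> K) :
  definable M (fun w : 'rV[K]_(1 + 1) => P (lsubmx w ord0 ord0) (rsubmx w ord0 ord0)) ->
  dfun a -> dfun b -> definable M (fun x => P (a x) (b x)).
Proof.
move=> dP da db.
have := definable_comp dP (dmap_row_mx (dmap_scalar da) (dmap_scalar db)).
by apply: definable_ext => z; rewrite row_mxKl row_mxKr !mxE.
Qed.

Lemma definable_rel_row m (P : K -> 'rV[K]_m -> Prop) n (a : 'rV[K]_n -> K) g :
  definable M (fun w : 'rV[K]_(1 + m) => P (lsubmx w ord0 ord0) (rsubmx w)) ->
  dfun a -> dmap g -> definable M (fun x => P (a x) (g x)).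
Proof.
move=> dP da dg.
have := definable_comp dP (dmap_row_mx (dmap_scalar da) dg).
by apply: definable_ext => z; rewrite row_mxKl row_mxKr !mxE.
Qed.

Lemma definable_row_rel m (P : 'rV[K]_m -> K -> Prop) n g (a : 'rV[K]_n -> K) :
  definable M (fun w : 'rV[K]_(m + 1) => P (lsubmx w) (rsubmx w ord0 ord0)) ->
  dmap g -> dfun a -> definable M (fun x => P (g x) (a x)).
Proof.
move=> dP dg da.
have := definable_comp dP (dmap_row_mx dg (dmap_scalar da)).
by apply: definable_ext => z; rewrite row_mxKl row_mxKr !mxE.
Qed.

Lemma definable_rows_rel m p (P : 'rV[K]_m -> 'rV[K]_p -> Prop) n g
    (h : 'rV[K]_n -> 'rV[K]_p) :
  definable M (fun w : 'rV[K]_(m + p) => P (lsubmx w) (rsubmx w)) ->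
  dmap g -> dmap h -> definable M (fun x => P (g x) (h x)).
Proof.
move=> dP dg dh.
have := definable_comp dP (dmap_row_mx dg dh).
by apply: definable_ext => z; rewrite row_mxKl row_mxKr.
Qed.

Lemma definable_rows_rel3 m p (P : 'rV[K]_m -> 'rV[K]_p -> K -> Prop) n g h
    (a : 'rV[K]_n -> K) :
  definable M (fun w : 'rV[K]_(m + p + 1) =>
    P (lsubmx (lsubmx w)) (rsubmx (lsubmx w)) (rsubmx w ord0 ord0)) ->
  dmap g -> dmap h -> dfun a -> definable M (fun x => P (g x) (h x) (a x)).
Proof.
move=> dP dg dh da.
have := definable_comp dP (dmap_row_mx (dmap_row_mx dg dh) (dmap_scalar da)).
by apply: definable_ext => z; rewrite !row_mxKl !row_mxKr !mxE.
Qed.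

Lemma definable_lt n (a b : 'rV[K]_n -> K) :
  dfun a -> dfun b -> definable M (fun x => a x < b x).
Proof.
apply: (@definable_rel2 (fun a b => a < b)).
exists (FLt (TVar M (lshift 1 ord0)) (TVar M (rshift 1 ord0))).
by apply/predeqP => z /=; rewrite !mxE.
Qed.

Lemma definable_le n (a b : 'rV[K]_n -> K) :
  dfun a -> dfun b -> definable M (fun x => a x <= b x).
Proof.
move=> da db; apply: definable_ext (definable_not (definable_lt db da)) => x.
by rewrite leNgt; split=> /negP.
Qed.

Lemma definable_eq n (a b : 'rV[K]_n -> K) :
  dfun a -> dfun b -> definable M (fun x => a x = b x).
Proof.
move=> da db.
apply: definable_ext (definable_and (definable_le da db) (definable_le db da)).
by move=> x; split=> [[? ?]|->]; [apply/le_anti/andP|].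
Qed.

Lemma definable_eq_row n p (g h : 'rV[K]_n -> 'rV[K]_p) :
  dmap g -> dmap h -> definable M (fun x => g x = h x).
Proof.
move=> dg dh.
apply: definable_ext (definable_forall_fin (fun j => definable_eq (dg j) (dh j))).
by move=> x; split=> /rowP.
Qed.

Lemma definable_andb n (a b : 'rV[K]_n -> bool) :
  definable M (fun x => a x) -> definable M (fun x => b x) ->
  definable M (fun x => a x && b x).
Proof.
move=> da db; apply: definable_ext (definable_and da db) => x.
by split=> /andP.
Qed.

Lemma dfun_norm n (a : 'rV[K]_n -> K) : dfun a -> dfun (fun x => `|a x|).
Proof.
move=> da.
have dl : dfun (fun z : 'rV[K]_(n + 1) => a (lsubmx z)).
  exact: (dfun_comp da (dmap_lsubmx (@dmap_id (n + 1)))).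
have dr := dmap_rsubmx (@dmap_id (n + 1)) ord0.
have d0 := @dfun_cst (n + 1) 0.
have D := definable_or
  (definable_and (definable_le d0 dl) (definable_eq dr dl))
  (definable_and (definable_lt dl d0) (definable_eq dr (dfun_opp dl))).
apply: definable_ext D => z.
by case: (ltP (a (lsubmx z)) 0) => h; [rewrite ltr0_norm//|rewrite ger0_norm//];
  split=> [[[]//|[]//]|]; [right|left].
Qed.

Lemma definable_comp1 (X : K -> Prop) n (a : 'rV[K]_n -> K) :
  definable M (setK1 X) -> dfun a -> definable M (fun x => X (a x)).
Proof.
move=> dX da; apply: definable_ext (definable_comp dX (dmap_scalar da)) => x.
by rewrite /setK1 /mkset mxE.
Qed.

Lemma dfun_comp1 (f : K -> K) n (a : 'rV[K]_n -> K) :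
  dfun (fun x : 'rV[K]_1 => f (x ord0 ord0)) -> dfun a ->
  dfun (fun x => f (a x)).
Proof.
move=> df da; apply: definable_ext (dfun_comp df (dmap_scalar da)) => z.
by rewrite [(_%:M) _ _]mxE.
Qed.

End Definability.

Arguments dfun {K} M {n} t.
Arguments dmap {K} M {n p} g.

(* Redefined with [::=] once closures, interiors and cubes are available. *)
Ltac definability_leaf := fail.

(* Proves [definable M X] by recursion on the formula defining X; the
   definability of its relation symbols is looked up in the context. *)
Ltac definability :=
  cbv beta delta [setU setI setD setC setT set0 bigcup];
  match goal with
  | H : ?G |- ?G => exact H
  | |- definable ?M (setK1 (mkset ?P)) =>
      change (definable M (fun x : 'rV_1 => P (x ord0 ord0))); definability
  | |- definable ?M (setK1 (fun x => @?P x)) =>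
      change (definable M (fun x : 'rV_1 => P (x ord0 ord0))); definability
  | |- definable ?M (mkset ?P) => change (definable M P); definability
  | |- definable ?M (fun _ => ?P) => exact (definable_Prop M _ P)
  | |- definable ?M (fun x => mkset (@?P x) (@?a x)) =>
      change (definable M (fun x => P x (a x))); definability
  | |- definable ?M (fun x => setK1 ?X (@?a x)) =>
      change (definable M (fun x => X ((a x) ord0 ord0))); definability
  | |- definable ?M (fun x => @?P x /\ @?Q x) =>
      apply (@definable_and _ M _ P Q); definability
  | |- definable ?M (fun x => @?P x \/ @?Q x) =>
      apply (@definable_or _ M _ P Q); definability
  | |- definable ?M (fun x => ~ @?P x) =>
      apply (@definable_not _ M _ P); definability
  | |- definable ?M (fun x => @?P x -> @?Q x) =>
      apply (@definable_imp _ M _ P Q); definability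
  | |- definable ?M (fun x => ex (fun y => @?P x y)) =>
      first [ apply (@definable_ex _ M _ P)
            | apply (@definable_row_ex _ M _ _ P)
            | apply (@definable_exists_fin _ M _ _ P); intro]; definability
  | |- definable ?M (fun x => forall y, @?P x y) =>
      first [ apply (@definable_all _ M _ P)
            | apply (@definable_row_all _ M _ _ P)
            | apply (@definable_forall_fin _ M _ _ P); intro]; definability
  | |- definable ?M (fun x => is_true (@?P x && @?Q x)) =>
      apply (@definable_andb _ M _ P Q); definability
  | |- definable ?M (fun x => is_true (@?P x < @?Q x)) =>
      apply (@definable_lt _ M _ P Q); definability
  | |- definable ?M (fun x => is_true (@?P x <= @?Q x)) =>
      apply (@definable_le _ M _ P Q); definability
  | |- definable ?M (fun x => @?P x = @?Q x) =>
      first [ apply (@definable_eq _ M _ P Q)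
            | apply (@definable_eq_row _ M _ _ P Q)]; definability
  | |- dmap ?M (fun x => x) => apply dmap_id
  | |- dmap ?M (fun x => ?c) => apply dmap_cst
  | |- dmap ?M (fun x => lsubmx (@?g x)) =>
      apply (@dmap_lsubmx _ M _ _ _ g); definability
  | |- dmap ?M (fun x => rsubmx (@?g x)) =>
      apply (@dmap_rsubmx _ M _ _ _ g); definability
  | |- dmap ?M (fun x => row_mx (@?g x) (@?h x)) =>
      apply (@dmap_row_mx _ M _ _ _ g h); definability
  | |- dmap ?M (fun x => mxsub id ?s (@?g x)) =>
      apply (@dmap_colsub _ M _ _ _ s g); definability
  | |- dmap ?M (fun x => coord_proj ?I (@?g x)) =>
      unfold coord_proj; definability
  | |- dmap ?M (fun x => scalar_mx (@?g x)) =>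
      apply (@dmap_scalar _ M _ g); definability
  | |- dfun ?M (fun x => ?c) => apply dfun_cst
  | |- dfun ?M (fun x => @fun_of_matrix _ _ _ (@?g x) _ ?j) =>
      apply (@dfun_entry _ M _ _ g j); definability
  | |- dfun ?M (fun x => @?a x + @?b x) =>
      apply (@dfun_add _ M _ a b); definability
  | |- dfun ?M (fun x => @?a x * @?b x) =>
      apply (@dfun_mul _ M _ a b); definability
  | |- dfun ?M (fun x => - (@?a x)) =>
      apply (@dfun_opp _ M _ a); definability
  | |- dfun ?M (fun x => `| @?a x |) =>
      apply (@dfun_norm _ M _ a); definability
  | H : dfun ?M (fun y => ?f (@fun_of_matrix _ _ _ y _ _))
      |- dfun ?M (fun x => ?f (@?a x)) =>
      apply (@dfun_comp1 _ M f _ a H); definability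
  | H : dfun ?M ?f |- dfun ?M (fun x => ?f (@?a x)) =>
      apply (@dfun_comp _ M _ _ f a H); definability
  | H : definable ?M (fun w => ?P (@fun_of_matrix _ _ _ (lsubmx w) _ _)
        (@fun_of_matrix _ _ _ (rsubmx w) _ _))
      |- definable ?M (fun x => ?P (@?a x) (@?b x)) =>
      apply (@definable_rel2 _ M P _ a b H); definability
  | H : definable ?M (fun w => ?P (@fun_of_matrix _ _ _ (lsubmx w) _ _)
        (@fun_of_matrix _ _ _ (rsubmx w) _ _))
      |- definable ?M (setK1 (?P ?t)) =>
      change (definable M (fun x : 'rV_1 => P t (x ord0 ord0))); definability
  | H : definable ?M (fun w => ?P (@fun_of_matrix _ _ _ (lsubmx w) _ _) (rsubmx w))
      |- definable ?M (fun x => ?P (@?a x) (@?b x)) =>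
      apply (@definable_rel_row _ M _ P _ a b H); definability
  | H : definable ?M (fun w => ?P (lsubmx w) (@fun_of_matrix _ _ _ (rsubmx w) _ _))
      |- definable ?M (fun x => ?P (@?a x) (@?b x)) =>
      apply (@definable_row_rel _ M _ P _ a b H); definability
  | H : definable ?M (fun w => ?P (lsubmx w) (rsubmx w))
      |- definable ?M (fun x => ?P (@?a x) (@?b x)) =>
      apply (@definable_rows_rel _ M _ _ P _ a b H); definability
  | H : definable ?M (fun w => ?P (lsubmx (lsubmx w)) (rsubmx (lsubmx w))
        (@fun_of_matrix _ _ _ (rsubmx w) _ _))
      |- definable ?M (fun x => ?P (@?a x) (@?b x) (@?c x)) =>
      apply (@definable_rows_rel3 _ M _ _ P _ a b c H); definability
  | H : definable ?M (fun w => ?P (@fun_of_matrix _ _ _ (lsubmx w) _ _) (rsubmx w))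
      |- definable ?M (?P ?t) => change (definable M (fun x => P t x)); definability
  | H : definable ?M (fun w => ?P (lsubmx w) (rsubmx w))
      |- definable ?M (?P ?t) => change (definable M (fun x => P t x)); definability
  | |- definable ?M (fun x => ?X (@?a x)) =>
      first [ apply (@definable_comp1 _ M X _ a); [solve [definability]|definability]
            | apply (@definable_comp _ M _ _ X a); [solve [definability]|definability] ]
  | |- _ => definability_leaf
  end.


(** * Cubes and the product topology *)

Section Cubes.
Variable K : realFieldType.

(** The open balls of the supremum norm. A finite quantifier over coordinates makes neighbourhoods,
    and hence closures and interiors, expressible by formulas. *)
Definition cube n (x : 'rV[K]_n) (e : K) : set 'rV[K]_n :=
  fun y => forall i, `|x ord0 i - y ord0 i| < e.

Lemma nbhs_cubeP n (x : 'rV[K]_n) (A : set 'rV[K]_n) :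
  nbhs x A <-> exists2 e, 0 < e & cube x e `<=` A.
Proof.
rewrite nbhs_ballP; split=> -[e /= e0 eA]; exists e => // y xy; apply: eA.
  by split=> // i j; rewrite (ord1 i); apply: xy.
by case: xy => _ xy i; apply: xy.
Qed.

Lemma cube_center n (x : 'rV[K]_n) e : 0 < e -> cube x e x.
Proof. by move=> e0 i; rewrite subrr normr0. Qed.

Lemma cube_sym n (x y : 'rV[K]_n) e : cube x e y -> cube y e x.
Proof. by move=> H i; rewrite distrC. Qed.

Lemma cube_trans n (x y z : 'rV[K]_n) d e f :
  cube x d y -> cube y e z -> d + e <= f -> cube x f z.
Proof.
move=> xy yz def i; apply: lt_le_trans def.
by apply: le_lt_trans (ler_distD (y ord0 i) _ _) _; apply: ltrD.
Qed.

Lemma cubeW n (x : 'rV[K]_n) d e : d <= e -> cube x d `<=` cube x e.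
Proof. by move=> de y xy i; apply: lt_le_trans de. Qed.

Lemma cube_open n (x y : 'rV[K]_n) e : cube x e y ->
  exists2 d, 0 < d & cube y d `<=` cube x e.
Proof.
move=> xy; suff [d d0 H] : exists2 d, 0 < d &
    forall i, `|x ord0 i - y ord0 i| + d <= e.
  exists d => // z yz i; apply: lt_le_trans (H i).
  by apply: le_lt_trans (ler_distD (y ord0 i) _ _) _; rewrite ltrD2l; apply: yz.
suff H (s : seq 'I_n) : exists2 d, 0 < d &
    forall i, i \in s -> `|x ord0 i - y ord0 i| + d <= e.
  by have [d d0 H'] := H (enum 'I_n); exists d => // i; apply: H'; rewrite mem_enum.
elim: s => [|i s [d d0 IH]]; first by exists 1.
exists (Num.min d (e - `|x ord0 i - y ord0 i|)).
  by rewrite lt_min d0 subr_gt0 xy.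
move=> j; rewrite in_cons => /predU1P[->|/IH].
  by rewrite addrC -lerBrDr ge_min lexx orbT.
by apply: le_trans; rewrite lerD2l ge_min lexx.
Qed.

Lemma interior_cubeP n (X : set 'rV[K]_n) x :
  X° x <-> exists2 e, 0 < e & cube x e `<=` X.
Proof. exact: nbhs_cubeP. Qed.

Lemma closure_cubeP n (X : set 'rV[K]_n) x :
  closure X x <-> forall e, 0 < e -> exists2 y, X y & cube x e y.
Proof.
split=> [cX e e0|H B /nbhs_cubeP[e e0 eB]].
  have /cX[y [Xy xy]] : nbhs x (cube x e) by apply/nbhs_cubeP; exists e.
  by exists y.
by have [y Xy xy] := H e e0; exists y; split => //; apply: eB.
Qed.

Lemma cube_row_mx n m (x x' : 'rV[K]_n) (y y' : 'rV[K]_m) e :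
  cube (row_mx x y) e (row_mx x' y') <-> cube x e x' /\ cube y e y'.
Proof.
split=> [H|[Hx Hy] i].
  split=> i; first by have := H (lshift m i); rewrite !row_mxEl.
  by have := H (rshift n i); rewrite !row_mxEr.
by have [k ->|k ->] := split_ordP i; rewrite ?row_mxEl ?row_mxEr.
Qed.

Lemma nbhs_KP (x : K) (A : set K) :
  nbhs x A <-> exists2 e, 0 < e & forall y, `|x - y| < e -> A y.
Proof. by rewrite nbhs_ballP; split=> -[e e0 eA]; exists e. Qed.

Lemma closure_KP (X : set K) x :
  closure X x <-> forall e, 0 < e -> exists2 y, X y & `|x - y| < e.
Proof.
split=> [cX e e0|H B /nbhs_KP[e e0 eB]].
  have /cX[y [Xy xy]] : nbhs x [set y | `|x - y| < e] by apply/nbhs_KP; exists e.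
  by exists y.
by have [y Xy xy] := H e e0; exists y; split => //; apply: eB.
Qed.

Lemma cube1 (x y : 'rV[K]_1) e :
  cube x e y <-> `|x ord0 ord0 - y ord0 ord0| < e.
Proof. by split=> [|H i]; [apply|rewrite (ord1 i)]. Qed.

Lemma interior_setK1 (X : set K) : (setK1 X)° = setK1 X°.
Proof.
apply/predeqP => x; rewrite interior_cubeP /setK1 /mkset /interior nbhs_KP.
split=> -[e e0 H]; exists e => // y xy; last by apply: H; apply/cube1.
by have := H y%:M; rewrite /setK1 /mkset mxE; apply; apply/cube1; rewrite mxE.
Qed.

Lemma closure_setK1 (X : set K) : closure (setK1 X) = setK1 (closure X).
Proof.
apply/predeqP => x; rewrite closure_cubeP /setK1 /mkset closure_KP.
split=> H e e0; have [y Xy xy] := H e e0.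
  by exists (y ord0 ord0) => //; apply/cube1.
by exists y%:M; rewrite /mkset ?mxE //; apply/cube1; rewrite mxE.
Qed.

Lemma setK1_scalar (X : set 'rV[K]_1) : setK1 (fun a => X a%:M) = X.
Proof. by apply/predeqP => x; rewrite /setK1 /mkset -mx11_scalar. Qed.

Lemma setK1_eq0 (X : set K) : setK1 X = set0 <-> X = set0.
Proof.
split=> [/predeqP H|->//]; apply/predeqP => x.
by have := H x%:M; rewrite /setK1 /mkset mxE.
Qed.

Lemma nowhere_dense_setK1 (X : set K) :
  nowhere_dense (setK1 X) <-> nowhere_dense X.
Proof. by rewrite /nowhere_dense closure_setK1 interior_setK1 setK1_eq0. Qed.

(** The closure disappears because a cube, being open, misses [X] iff it misses the closure of [X].
    What remains speaks of cubes only, so nowhere density is a definable condition on parameters. *)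
Lemma nowhere_denseP n (X : set 'rV[K]_n) : nowhere_dense X <->
  forall x e, 0 < e -> exists y d, [/\ 0 < d, cube y d `<=` cube x e &
    forall z, cube y d z -> ~ X z].
Proof.
split=> [nd x e e0|H].
  have [y xy ncy] : exists2 y, cube x e y & ~ closure X y.
    apply: contrapT => H; suff : (closure X)° x by rewrite nd.
    by apply/interior_cubeP; exists e => // y xy; apply: contrapT => ?; apply: H; exists y.
  move: ncy; rewrite closure_cubeP => /existsNP[d1 /not_implyP[d10 H1]].
  have [d2 d20 H2] := cube_open xy.
  exists y, (Num.min d1 d2); split.
  - by rewrite lt_min d10.
  - by apply: subset_trans H2; apply: cubeW; rewrite ge_min lexx orbT.
  - by move=> z yz Xz; apply: H1; exists z => //; apply: cubeW yz; rewrite ge_min lexx.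
apply/seteqP; split => // x /interior_cubeP[e e0 xe].
have [y [d [d0 yd H2]]] := H x e e0.
have /closure_cubeP/(_ d d0)[z Xz yz] := xe _ (yd _ (cube_center _ d0)).
exact: H2 yz Xz.
Qed.

Lemma nowhere_denseS n (X Y : set 'rV[K]_n) :
  X `<=` Y -> nowhere_dense Y -> nowhere_dense X.
Proof.
move=> XY; rewrite !nowhere_denseP => H x e /(H x)[y [d [d0 yd Yd]]].
by exists y, d; split => // z /Yd nY /XY.
Qed.

Lemma nowhere_denseU n (X Y : set 'rV[K]_n) :
  nowhere_dense X -> nowhere_dense Y -> nowhere_dense (X `|` Y).
Proof.
rewrite !nowhere_denseP => HX HY x e /(HX x)[y [d [d0 yd Xd]]].
have [z [f [f0 zf Yf]]] := HY y d d0; exists z, f; split => //.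
  exact: subset_trans yd.
by move=> t zt [Xt|Yt]; [apply: Xd (zf _ zt) Xt|apply: Yf zt Yt].
Qed.

Lemma interior_eq0P n (X : set 'rV[K]_n) : X° = set0 <->
  forall x e, 0 < e -> exists2 y, cube x e y & ~ X y.
Proof.
split=> [X0 x e e0|H].
  apply: contrapT => H; suff : X° x by rewrite X0.
  by apply/interior_cubeP; exists e => // y xy; apply: contrapT => ?; apply: H; exists y.
apply/seteqP; split => // x /interior_cubeP[e e0 xe].
by have [y xy []] := H x e e0; apply: xe.
Qed.

Lemma nowhere_dense_interior n (X : set 'rV[K]_n) : nowhere_dense X -> X° = set0.
Proof.
move=> H; apply/seteqP; split => // x Xx; rewrite -H.
by apply: interiorS Xx; apply: subset_closure.
Qed.

Lemma nowhere_dense_gap (X : set K) a b : nowhere_dense X -> a < b ->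
  exists c d, [/\ a <= c, c < d, d <= b & forall x, c < x < d -> ~ closure X x].
Proof.
move=> nd ab; apply: contrapT => H.
suff : (closure X)° ((a + b) / 2) by rewrite nd.
apply/nbhs_KP; exists ((b - a) / 2) => [|x]; first lra.
rewrite ltr_norml => xab; apply: contrapT => nCx.
have : open (~` closure X) by apply: closed_openC; apply: closed_closure.
rewrite openE => /(_ x nCx)/nbhs_KP[e e0 He].
apply: H; exists (Num.max a (x - e)), (Num.min b (x + e)); split.
- by rewrite le_max lexx.
- by rewrite gt_max !lt_min; lra.
- by rewrite ge_min lexx.
- move=> y; rewrite gt_max lt_min => /andP[/andP[ay xy] /andP[yb yx]].
  by apply: He; rewrite ltr_norml; lra.
Qed.

Lemma not_empty_interior n (X : set 'rV[K]_n) : X° <> set0 ->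
  exists x, exists2 e, 0 < e & cube x e `<=` X.
Proof. by move/eqP/set0P => [x /interior_cubeP]; exists x. Qed.

End Cubes.

(** * Definable completeness *)

Section Completeness.
Variables (K : realFieldType) (M : expansion K).

Lemma definable_cube n m (x y : 'rV[K]_n -> 'rV[K]_m) (e : 'rV[K]_n -> K) :
  dmap M x -> dmap M y -> dfun M e -> definable M (fun z => cube (x z) (e z) (y z)).
Proof. by move=> dx dy de; rewrite /cube; definability. Qed.

Lemma definable_closure n (X : set 'rV[K]_n) :
  definable M X -> definable M (closure X).
Proof.
move=> dX; suff : definable M (fun x => forall e, 0 < e -> exists y, X y /\ cube x e y).
  apply: definable_ext => x; rewrite closure_cubeP.
  by split=> H e /H => [[y []]|[y]]; exists y.
by rewrite /cube; definability.
Qed.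

Lemma definable_interior n (X : set 'rV[K]_n) :
  definable M X -> definable M X°.
Proof.
move=> dX; suff : definable M (fun x => exists e, 0 < e /\ forall y, cube x e y -> X y).
  apply: definable_ext => x; rewrite interior_cubeP.
  by split=> [[e []]|[e]]; exists e.
by rewrite /cube; definability.
Qed.

Lemma definable_closureK (X : set K) :
  definable M (setK1 X) -> definable M (setK1 (closure X)).
Proof. by rewrite -closure_setK1; apply: definable_closure. Qed.

Lemma definable_interiorK (X : set K) :
  definable M (setK1 X) -> definable M (setK1 X°).
Proof. by rewrite -interior_setK1; apply: definable_interior. Qed.

Hypothesis Kcomplete : definably_complete M.

Lemma definable_sup (X : set K) b : definable M (setK1 X) -> X !=set0 ->
  (forall x, X x -> x <= b) ->
  exists s, (forall x, X x -> x <= s) /\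
    forall e, 0 < e -> exists2 x, X x & s - e < x.
Proof.
move=> /Kcomplete[s [ubs lubs]] [x0 Xx0] Xb.
have sb : (s <= b%:E)%E by apply: lubs => _ [x Xx <-]; rewrite lee_fin Xb.
have xs : (x0%:E <= s)%E by apply: ubs; exists x0.
case: s ubs lubs sb xs => // s ubs lubs _ _; exists s.
have H x : X x -> x <= s by move=> Xx; have := ubs x%:E; rewrite lee_fin; apply; exists x.
split=> // e e0; apply: contrapT => /forall2NP nX.
suff : (s%:E <= (s - e)%:E)%E by rewrite lee_fin; lra.
apply: lubs => _ [x Xx <-]; rewrite lee_fin.
by have [//|/negP] := nX x; rewrite -leNgt.
Qed.

Lemma definable_inf (X : set K) b : definable M (setK1 X) -> X !=set0 ->
  (forall x, X x -> b <= x) ->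
  exists s, (forall x, X x -> s <= x) /\
    forall e, 0 < e -> exists2 x, X x & x < s + e.
Proof.
move=> dX [x0 Xx0] Xb.
have := @definable_sup (fun x => X (- x)) (- b); case.
- definability.
- by exists (- x0); rewrite opprK.
- by move=> x /Xb; lra.
- move=> s [H1 H2]; exists (- s); split.
    by move=> x Xx; have := H1 (- x); rewrite opprK => /(_ Xx); lra.
  by move=> e /H2[x Xx sx]; exists (- x) => //; lra.
Qed.

(** If [T] were bounded, it would contain [s - d] for its supremum [s], and then [s + d]. The length
    [d] may depend on [s], so local information at each point is enough. *)
Lemma definable_induction (T : set K) : definable M (setK1 T) -> T !=set0 ->
  (forall x y, y <= x -> T x -> T y) ->
  (forall s, exists2 d, 0 < d & T (s - d) -> T (s + d)) ->
  forall x, T x.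
Proof.
move=> dT T0 dn step b; apply: contrapT => nTb.
have [|s [ub lub]] := definable_sup (b := b) dT T0.
  move=> x Tx; rewrite leNgt; apply/negP => bx; apply: nTb.
  exact: dn (ltW bx) Tx.
have [d d0 H] := step s; have [x Tx sx] := lub _ d0.
have /ub : T (s + d) by apply: H; apply: dn Tx; exact: ltW.
lra.
Qed.

End Completeness.

Ltac definability_leaf ::=
  match goal with
  | |- definable _ (closure _) => apply definable_closure; definability
  | |- definable _ (interior _) => apply definable_interior; definability
  | |- definable _ (setK1 (closure _)) => apply definable_closureK; definability
  | |- definable _ (setK1 (interior _)) => apply definable_interiorK; definability
  | |- definable _ (fun z => cube (@?x z) (@?e z) (@?y z)) =>
      apply (@definable_cube _ _ _ _ x y e); definability
  | H : forall _, _ |- definable _ _ => solve [apply H; definability]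
  end.


(** * Discrete definable sets *)

Section PseudoFinite.
Variables (K : realFieldType) (M : expansion K).
Hypothesis Kcomplete : definably_complete M.

(** As [x] ranges over all of [K] and not only over [N], this expresses closedness and discreteness
    at once. *)
Definition closed_discrete (N : set K) :=
  forall x, exists2 d, 0 < d & forall n, N n -> `|n - x| < d -> n = x.

(** Near the infimum of [S] no element of [N] other than the infimum exists, but [S] has points
    there. *)
Lemma closed_discrete_min (N S : set K) b : closed_discrete N ->
  definable M (setK1 S) -> S `<=` N -> S !=set0 -> (forall x, S x -> b <= x) ->
  exists2 m, S m & forall n, S n -> m <= n.
Proof.
move=> dN dS SN S0 Sb; have [s [lb glb]] := definable_inf Kcomplete dS S0 Sb.
have [d d0 Hd] := dN s; have [x Sx xs] := glb d d0.
have E : x = s.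
  by apply: Hd; [exact: SN|]; have := lb x Sx; rewrite ltr_norml; lra.
by exists s => //; rewrite -E.
Qed.

Lemma closed_discrete_max (N S : set K) b : closed_discrete N ->
  definable M (setK1 S) -> S `<=` N -> S !=set0 -> (forall x, S x -> x <= b) ->
  exists2 m, S m & forall n, S n -> n <= m.
Proof.
move=> dN dS SN S0 Sb; have [s [ub lub]] := definable_sup Kcomplete dS S0 Sb.
have [d d0 Hd] := dN s; have [x Sx xs] := lub d d0.
have E : x = s.
  by apply: Hd; [exact: SN|]; have := ub x Sx; rewrite ltr_norml; lra.
by exists s => //; rewrite -E.
Qed.

Definition consecutive (N : set K) (m n : K) :=
  [/\ N m, N n, m < n & forall k, N k -> ~ (m < k < n)].

(** A least counterexample has an immediate predecessor, because the elements of [N] between [n0]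
    and it have a maximum. *)
Lemma closed_discrete_ind (N Q : set K) n0 : definable M (setK1 N) ->
  closed_discrete N -> N n0 -> definable M (setK1 Q) -> Q n0 ->
  (forall m n, n0 <= m -> consecutive N m n -> Q m -> Q n) ->
  forall n, N n -> n0 <= n -> Q n.
Proof.
move=> dN cN Nn0 dQ Q0 step n Nn n0n; apply: contrapT => nQn.
have [|x [[]]||x [[]]|m [[Nm n0m] nQm] Hm] :=
  @closed_discrete_min N (fun x => (N x /\ n0 <= x) /\ ~ Q x) n0 cN => //.
- by definability.
- by exists n.
have n0m' : n0 < m by rewrite lt_neqAle n0m andbT; apply/eqP => E; rewrite -E in nQm.
have [|x [[]]||x [[_ _] /ltW]|k [[Nk n0k] km] Hk] :=
  @closed_discrete_max N (fun x => (N x /\ n0 <= x) /\ x < m) m cN => //.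
- by definability.
- by exists n0; split=> //; split.
apply: nQm; apply: (step k) => //.
  split=> // j Nj /andP[kj jm].
  suff : j <= k by rewrite leNgt kj.
  by apply: Hk; do 2?split => //; apply: le_trans (ltW kj).
apply: contrapT => nQk; suff : m <= k by rewrite leNgt km.
by apply: Hm.
Qed.

(* Induction along a bounded separated set: only one of its points lies
   within a third of the separation of a given s. *)
Lemma separated_uniform (D : set K) (R : K -> K -> Prop) (c u v : K) :
  definable M (setK1 D) ->
  definable M (fun z : 'rV_(1 + 1) =>
    R (lsubmx z ord0 ord0) (rsubmx z ord0 ord0)) ->
  0 < c -> (forall x y, D x -> D y -> x < y -> x + c <= y) ->
  (forall x, D x -> u <= x <= v) ->
  (forall x d e, d <= e -> R x e -> R x d) ->
  (forall x, D x -> exists2 e, 0 < e & R x e) ->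
  exists2 e, 0 < e & forall x, D x -> R x e.
Proof.
move=> dD dR c0 sepD Duv monoR HR.
pose T s := exists e, 0 < e /\ forall x, D x -> x <= s -> R x e.
suff /(_ v)[e [e0 H]] : forall s, T s.
  by exists e => // x Dx; apply: H => //; case/andP: (Duv x Dx).
apply: (definable_induction Kcomplete).
- by rewrite /T; definability.
- by exists (u - 1), 1; split=> // x /Duv; lra.
- by move=> x y yx [e [e0 H]]; exists e; split=> // z Dz zy; apply: H => //; lra.
move=> s; exists (c / 3); first by lra.
case=> e [e0 H]; case: (pselect (exists x, D x /\ s - c / 3 < x <= s + c / 3)).
  case=> x [Dx xs]; have [d d0 Hd] := HR x Dx.
  exists (Num.min d e); split; first by rewrite lt_min d0.
  move=> y Dy ys; case: (ltgtP x y) => xy.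
  - by have := sepD _ _ Dx Dy xy; lra.
  - apply: (@monoR _ _ e); first by rewrite ge_min lexx orbT.
    by apply: H => //; have := sepD _ _ Dy Dx xy; lra.
  - by rewrite -xy; apply: (@monoR _ _ d) => //; rewrite ge_min lexx.
move=> nD; exists e; split=> // y Dy ys; apply: H => //.
by rewrite leNgt; apply/negP => sy; apply: nD; exists y; rewrite sy ys.
Qed.

End PseudoFinite.


(** * The Baire category theorem *)

Section Baire.
Variables (K : realFieldType) (M : expansion K).
Hypothesis Kcomplete : definably_complete M.

Variables (C : K -> K -> Prop) (u v : K).
Hypothesis dC : definable M (fun z : 'rV[K]_(1 + 1) =>
  C (lsubmx z ord0 ord0) (rsubmx z ord0 ord0)).
Hypothesis uv : u < v.
Hypothesis C_mono : forall s t x, s <= t -> C s x -> C t x.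
Hypothesis C_closed : forall t x, ~ C t x ->
  exists2 e, 0 < e & forall y, `|x - y| < e -> ~ C t y.
Hypothesis C_thin : forall t a b, a < b -> exists2 x, a < x < b & ~ C t x.
Hypothesis C_range : forall t x, C t x -> u <= x <= v.
Hypothesis C_l : forall t, C t u.
Hypothesis C_r : forall t, C t v.
Hypothesis C_cover : forall x, u <= x <= v -> exists t, C t x.

Definition gap t a b := [/\ a < b, C t a, C t b & forall x, a < x < b -> ~ C t x].

Lemma gap_around t x : u <= x <= v -> ~ C t x ->
  exists a b, gap t a b /\ a < x < b.
Proof.
move=> /andP[ux xv] nCx; have [e e0 He] := C_closed nCx.
have {ux}ux : u < x.
  by rewrite lt_neqAle ux andbT; apply/eqP => E; apply: nCx; rewrite -E.
have {xv}xv : x < v.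
  by rewrite lt_neqAle xv andbT; apply/eqP => E; apply: nCx; rewrite E.
have [|||a [uba luba]] := definable_sup Kcomplete (X := fun y => C t y /\ y < x) (b := x).
- by definability.
- by exists u.
- by move=> y [_ /ltW].
have [|||b [lbb glbb]] := definable_inf Kcomplete (X := fun y => C t y /\ x < y) (b := x).
- by definability.
- by exists v.
- by move=> y [_ /ltW].
have Ca : C t a.
  apply: contrapT => /C_closed[d d0 Hd]; have [y [Cy yx] ay] := luba d d0.
  by apply: (Hd y) => //; have := uba y (conj Cy yx); rewrite ltr_norml; lra.
have Cb : C t b.
  apply: contrapT => /C_closed[d d0 Hd]; have [y [Cy yx] yb] := glbb d d0.
  by apply: (Hd y) => //; have := lbb y (conj Cy yx); rewrite ltr_norml; lra.
have ax : a < x.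
  have [y [Cy yx] ay] := luba _ e0; have := uba y (conj Cy yx).
  case: (ltgtP a x) => // [xa ya|E _]; last by case: nCx; rewrite -E.
  by case: (He y) => //; rewrite ltr_norml; lra.
have xb : x < b.
  have [y [Cy yx] yb] := glbb _ e0; have := lbb y (conj Cy yx).
  case: (ltgtP x b) => // [bx ya|E _]; last by case: nCx; rewrite E.
  by case: (He y) => //; rewrite ltr_norml; lra.
exists a, b; split; last by rewrite ax xb.
split=> // [|y /andP[ay yb] Cy]; first exact: lt_trans xb.
case: (ltgtP y x) => [yx|xy|E]; last by apply: nCx; rewrite -E.
  by have := uba y (conj Cy yx); rewrite leNgt ay.
by have := lbb y (conj Cy xy); rewrite leNgt yb.
Qed.

Lemma gap_inside t a b : a < b -> C t a -> C t b ->
  exists a' b', [/\ gap t a' b', a <= a' & b' <= b].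
Proof.
move=> ab Ca Cb; have [x /andP[ax xb] nCx] := C_thin t ab.
have /andP[ua _] := C_range Ca; have /andP[_ bv] := C_range Cb.
have [|a' [b' [g /andP[a'x xb']]]] := @gap_around t x _ nCx.
  by rewrite (ltW (le_lt_trans ua ax)) (ltW (lt_le_trans xb bv)).
exists a', b'; have [_ _ _ nC] := g; split=> //.
  by rewrite leNgt; apply/negP => aa; apply: (nC a) => //; rewrite aa (lt_trans ax).
by rewrite leNgt; apply/negP => bb; apply: (nC b) => //; rewrite bb (lt_trans _ xb).
Qed.

(** The family increases, so the endpoints of the earlier gap still belong to it at time [t] and
    cannot lie inside the later gap. *)
Lemma gap_nested s t a b a' b' x : s <= t -> gap s a b -> gap t a' b' ->
  a < x < b -> a' < x < b' -> a <= a' /\ b' <= b.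
Proof.
move=> st [_ Ca Cb _] [_ _ _ nC] /andP[ax xb] /andP[ax' xb']; split.
  rewrite leNgt; apply/negP => aa; apply: (nC a); last exact: C_mono Ca.
  by rewrite aa (lt_trans ax).
rewrite leNgt; apply/negP => bb; apply: (nC b); last exact: C_mono Cb.
by rewrite bb (lt_trans _ xb).
Qed.

Lemma gap_uniq t a b a' b' x : gap t a b -> gap t a' b' ->
  a < x < b -> a' < x < b' -> a = a' /\ b = b'.
Proof.
move=> g g' ax ax'; have [? ?] := gap_nested (lexx t) g g' ax ax'.
have [? ?] := gap_nested (lexx t) g' g ax' ax.
by split; apply/le_anti/andP.
Qed.

Lemma gap_uniql t a b b' : gap t a b -> gap t a b' -> b = b'.
Proof.
move=> g g'; have [ab _ _ _] := g; have [ab' _ _ _] := g'.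
have [b0 b'0] : (a < (a + Num.min b b') / 2 < b) /\
                (a < (a + Num.min b b') / 2 < b').
  by case: (ltP b b') => ?; split; apply/andP; split; lra.
by have [] := gap_uniq g g' b0 b'0.
Qed.

Lemma definable_gap n (t a b : 'rV[K]_n -> K) : dfun M t -> dfun M a ->
  dfun M b -> definable M (fun z => gap (t z) (a z) (b z)).
Proof.
move=> dt da db.
suff : definable M (fun z => (a z < b z /\ C (t z) (a z)) /\
    (C (t z) (b z) /\ forall x, a z < x < b z -> ~ C (t z) x)).
  by apply: definable_ext => z; split=> [[[? ?] [? ?]]|[]].
by definability.
Qed.

(* If some C t has arbitrarily short gaps, the inverses of their lengths form
   N; otherwise every C t is finite-like and N is the set of entrance times. *)
Lemma unbounded_closed_discrete : exists N : set K,
  [/\ definable M (setK1 N), closed_discrete N & forall x, exists2 n, N n & x < n].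
Proof.
have dgap := definable_gap.
case: (pselect (exists t, forall e, 0 < e -> exists a b, gap t a b /\ b - a < e)).
  case=> t Ht; exists (fun n => exists a b, gap t a b /\ n * (b - a) = 1).
  have npos n a b : gap t a b -> n * (b - a) = 1 -> 0 < n.
    by case=> ab _ _ _ E; rewrite -(@pmulr_lgt0 _ (b - a)) ?E // subr_gt0.
  split; first by definability.
    (* An inverse length within 1 of [x] is less than [|x| + 1], so its gap is longer than [c]. Gaps
       of length at least [c] have left endpoints at least [c] apart. *)
    move=> x; pose c := (`|x| + 1)^-1.
    have c1 : 0 < `|x| + 1 by rewrite ltr_wpDl.
    have c0 : 0 < c by rewrite invr_gt0.
    have [||x1 y1 [b1 [g1 l1]] [b2 [g2 l2]] xy|y [b [[ab Ca _ _] _]]|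
        a d e de H b n g E ne|a [b0 [g0 l0]]|e e0 He] :=
      @separated_uniform _ _ Kcomplete (fun a => exists b, gap t a b /\ c <= b - a)
      (fun a e => forall b n, gap t a b -> n * (b - a) = 1 -> `|n - x| < e -> n = x)
      c u v _ _ c0.
    - by definability.
    - by definability.
    - case: (leP (x1 + c) y1) => // yx.
      have [_ _ _ nC] := g1; have [_ Cy _ _] := g2.
      by case: (nC y1) => //; lra.
    - exact: C_range Ca.
    - by apply: H g E _; lra.
    - case: (pselect (exists n, n * (b0 - a) = 1 /\ n <> x)) => [[n [En nx]]|nH].
        exists `|n - x|; first by rewrite normr_gt0 subr_eq0; apply/eqP.
        move=> b n' g' En' lt; case: nx; move: lt.
        rewrite (gap_uniql g' g0) in En'.
        suff -> : n' = n by rewrite ltxx.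
        have ab0 : b0 - a != 0 by have [? _ _ _] := g0; rewrite gt_eqF // subr_gt0.
        by apply: (mulIf ab0); rewrite En En'.
      exists 1 => // b n g' En _; apply: contrapT => nx; apply: nH; exists n.
      by rewrite -(gap_uniql g' g0).
    exists (Num.min e 1); first by rewrite lt_min e0 ltr01.
    move=> n [a [b [g En]]]; rewrite lt_min => /andP[ne n1].
    apply: (He a _ _ _ g En ne); exists b; split => //.
    rewrite /c -[(_)^-1]mul1r ler_pdivrMr //.
    have ba : 0 <= b - a by have [? _ _ _] := g; rewrite subr_ge0 ltW.
    rewrite -En mulrC ler_wpM2l //.
    by have := ler_norm x; move: n1; rewrite ltr_norml; lra.
  move=> x; have c1 : 0 < `|x| + 1 by rewrite ltr_wpDl.
  have [|a [b [g l]]] := Ht (`|x| + 1)^-1; first by rewrite invr_gt0.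
  have ba : 0 < b - a by have [? _ _ _] := g; rewrite subr_gt0.
  exists (b - a)^-1; first by exists a, b; split=> //; rewrite mulVf // gt_eqF.
  apply: (@lt_trans _ _ (`|x| + 1)); first by have := ler_norm x; lra.
  by rewrite -ltf_pV2 ?posrE ?invr_gt0 // invrK.
move=> nH.
have sep t : exists2 c, 0 < c & forall x y, C t x -> C t y -> x < y -> x + c <= y.
  move: nH => /forallNP/(_ t)/existsNP[c /not_implyP[c0 Hc]]; exists c => //.
  move=> x y Cx Cy xy; have [a [b [g xa yb]]] := gap_inside xy Cx Cy.
  case: (leP (x + c) y) => // yc; case: Hc; exists a, b; split=> //; lra.
(* [n] is the entrance time of [x], an infimum that need not be attained. Only times from 0 on
   count, since a point such as [u] belongs to the family at all times. *)
pose rk x n := ((forall t, 0 <= t -> C t x -> n <= t) /\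
  (forall e, 0 < e -> exists t, 0 <= t /\ (C t x /\ t < n + e))) /\ u <= x <= v.
have drk : definable M (fun z : 'rV[K]_(1 + 1) =>
  rk (lsubmx z ord0 ord0) (rsubmx z ord0 ord0)) by rewrite /rk; definability.
have rk_ex x : u <= x <= v -> exists n, rk x n.
  move=> ux; have [t Ct] := C_cover ux.
  have [|||n [lb glb]] :=
    definable_inf Kcomplete (X := fun t => 0 <= t /\ C t x) (b := 0).
  - by definability.
  - by exists (Num.max t 0); rewrite le_max lexx orbT; split=> //;
      apply: C_mono Ct; rewrite le_max lexx.
  - by move=> y [].
  exists n; split=> //; split=> [s s0 Cs|e /glb[s [s0 Cs] sn]]; first exact: lb.
  by exists s.
have rk_uniq x m n : rk x m -> rk x n -> m = n.
  suff H a b : rk x a -> rk x b -> a <= b.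
    by move=> rm rn; apply/le_anti; rewrite !H.
  move=> [[Ha _] _] [[_ Hb] _]; rewrite leNgt; apply/negP => ba.
  have [|t [t0 [Ct tb]]] := Hb (a - b); first by rewrite subr_gt0.
  by have := Ha t t0 Ct; lra.
exists (fun n => exists x, rk x n); split; first by definability.
  (* Points with entrance time below [y + 1] all lie in [C t0], which is separated. *)
  move=> y; pose t0 := Num.max y 0 + 1.
  have yt : y + 1 <= t0 by rewrite lerD2r le_max lexx.
  have [c c0 sepc] := sep t0.
  have [||x /C_range //|x d e de H n rn ny|x Cx|e e0 He] :=
    @separated_uniform _ _ Kcomplete (C t0)
    (fun x e => forall n, rk x n -> `|n - y| < e -> n = y) c u v _ _ c0 sepc.
  - by definability.
  - by definability.
  - by apply: H rn _; lra.
  - have [n rn] := rk_ex _ (C_range Cx); case: (eqVneq n y) => [<-|ny].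
      by exists 1 => // m rm _; apply: rk_uniq rm rn.
    exists `|n - y|; first by rewrite normr_gt0 subr_eq0.
    by move=> m rm; rewrite (rk_uniq _ _ _ rm rn) ltxx.
  exists (Num.min e 1); first by rewrite lt_min e0 ltr01.
  move=> n [x rn]; rewrite lt_min => /andP[ne n1]; apply: (He x _ _ rn ne).
  have [[_ Hn] _] := rn.
  have [|t [_ [Ct tn]]] := Hn (t0 - n); first by move: n1; rewrite ltr_norml; lra.
  by apply: C_mono Ct; lra.
move=> x0; pose t0 := Num.max x0 0 + 1.
have [x /andP[ux xv] nC] := C_thin t0 uv.
have [|n rn] := rk_ex x; first by rewrite !ltW.
exists n; first by exists x.
have [[_ Hn] _] := rn.
have [//|t [_ [Ct tn]]] := Hn 1.
have tt : t0 < t by rewrite ltNge; apply/negP => tt; apply: nC; apply: C_mono Ct.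
have : x0 <= Num.max x0 0 by rewrite le_max lexx.
by rewrite /t0 in tt; lra.
Qed.


(** [a] enters the family no later than [b]. Entrance times are infima that may not be attained, so
    the sets of times are compared instead. For endpoints of equal age the relation holds both ways,
    and the rule moves the left one. *)
Definition older a b := forall t, C t b -> C t a.

Lemma olderVlt s a b : C s a -> ~ C s b -> older a b.
Proof.
move=> Ca nCb t Ct; apply: C_mono Ca; rewrite leNgt; apply/negP => /ltW ts.
by apply: nCb; apply: C_mono Ct.
Qed.

(* Replacing the older endpoint makes sure that no endpoint survives forever. *)
Definition admissible t a b a' b' :=
  [/\ gap t a' b', a <= a', b' <= b, older a b -> a < a' & ~ older a b -> b' < b].

(** The supremum of the lengths need not be known to be attained, so length is optimal only up to a
    factor 2. Among the large gaps a leftmost one exists, which makes the rule single-valued. *)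
Definition large t a b a' b' := admissible t a b a' b' /\
  forall c d, admissible t a b c d -> d - c <= 2 * (b' - a').

Definition choice t a b a' b' := large t a b a' b' /\
  forall c d, large t a b c d -> a' <= c.

Definition hit t a b := exists x, a < x < b /\ C t x.

Definition step t a b a' b' :=
  (hit t a b /\ choice t a b a' b') \/ (~ hit t a b /\ (a' = a /\ b' = b)).

(** A point [x] of [C t] splits the gap; the new gap is sought on the side of [x] away from the
    older endpoint. *)
Lemma admissible_ex s t a b : s < t -> gap s a b -> hit t a b ->
  exists c d, admissible t a b c d.
Proof.
move=> st [ab Ca Cb nC] [x [/andP[ax xb] Cx]].
have Cta := C_mono (ltW st) Ca; have Ctb := C_mono (ltW st) Cb.
case: (pselect (older a b)) => o.
  have [c [d [g xc db]]] := gap_inside xb Cx Ctb; exists c, d.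
  by split=> // [|_]; [exact: le_trans (ltW ax) xc|exact: lt_le_trans xc].
have [c [d [g ac dx]]] := gap_inside ax Cta Cx; exists c, d.
by split=> // [|_]; [exact: le_trans dx (ltW xb)|exact: le_lt_trans xb].
Qed.

Lemma definable_older n (a b : 'rV[K]_n -> K) : dfun M a -> dfun M b ->
  definable M (fun z => older (a z) (b z)).
Proof. by move=> da db; rewrite /older; definability. Qed.

Lemma definable_admissible n (t a b c d : 'rV[K]_n -> K) :
  dfun M t -> dfun M a -> dfun M b -> dfun M c -> dfun M d ->
  definable M (fun z => admissible (t z) (a z) (b z) (c z) (d z)).
Proof.
have dgap := definable_gap; have dold := definable_older; move=> dt da db dc dd.
suff : definable M (fun z => ((gap (t z) (c z) (d z) /\ a z <= c z) /\ d z <= b z) /\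
    ((older (a z) (b z) -> a z < c z) /\ (~ older (a z) (b z) -> d z < b z))).
  by apply: definable_ext => z; split=> [[[[? ?] ?] [? ?]]|[]].
by definability.
Qed.

Lemma definable_large n (t a b c d : 'rV[K]_n -> K) :
  dfun M t -> dfun M a -> dfun M b -> dfun M c -> dfun M d ->
  definable M (fun z => large (t z) (a z) (b z) (c z) (d z)).
Proof.
have dadm := definable_admissible; move=> dt da db dc dd.
by rewrite /large; definability.
Qed.

Lemma definable_step n (t a b c d : 'rV[K]_n -> K) :
  dfun M t -> dfun M a -> dfun M b -> dfun M c -> dfun M d ->
  definable M (fun z => step (t z) (a z) (b z) (c z) (d z)).
Proof.
have dlarge := definable_large; move=> dt da db dc dd.
by rewrite /step /hit /choice; definability.
Qed.

Lemma choice_ex s t a b : s < t -> gap s a b -> hit t a b ->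
  exists c d, choice t a b c d.
Proof.
have dadm := definable_admissible; have dlarge := definable_large.
move=> st g h; have [c0 [d0 adm0]] := admissible_ex st g h.
have len_gt0 c d : admissible t a b c d -> 0 < d - c.
  by case=> -[? _ _ _] _ _ _ _; rewrite subr_gt0.
have [|||L [ub lub]] := definable_sup Kcomplete
  (X := fun l => exists c d, admissible t a b c d /\ l = d - c) (b := b - a).
- by definability.
- by exists (d0 - c0), c0, d0.
- by move=> _ [c [d [[_ ? ? _ _] ->]]]; lra.
have L0 : 0 < L by apply: lt_le_trans (len_gt0 _ _ adm0) _; apply: ub; exists c0, d0.
have L2 : 0 < L / 2 by lra.
have [_ [c1 [d1 [adm1 ->]]] l1] := lub (L / 2) L2.
have large1 : large t a b c1 d1.
  split=> // c d adm; have : d - c <= L by apply: ub; exists c, d.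
  lra.
have [|||i [lb glb]] := definable_inf Kcomplete
  (X := fun c => exists d, large t a b c d) (b := a).
- by definability.
- by exists c1, d1.
- by move=> c [d [[_ ? _ _ _] _]].
(* Large gaps are longer than [L / 4], because some admissible gap is longer than [L / 2]. A large
   gap starting to the left of [c], hence at distance less than [L / 4], would contain [c], a point
   of [C t]. *)
have L4 : 0 < L / 4 by lra.
have [c [d lcd] ci] := glb (L / 4) L4.
exists c, d; split=> // c' d' lcd'.
rewrite leNgt; apply/negP => c'c.
have ic' : i <= c' by apply: lb; exists d'.
have [[[_ _ _ nC] _ _ _ _] Hl] := lcd'; have [[[_ Cc _ _] _ _ _ _] _] := lcd.
apply: (nC c) => //.
have := Hl _ _ adm1; lra.
Qed.

Lemma step_ex s t a b : s < t -> gap s a b ->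
  exists c d, [/\ step t a b c d, gap t c d, a <= c & d <= b].
Proof.
move=> st g; case: (pselect (hit t a b)) => h.
  have [c [d ch]] := choice_ex st g h; exists c, d.
  by have [[[? ? ? _ _] _] _] := ch; split=> //; left.
exists a, b; split=> //; first by right.
have [ab Ca Cb _] := g.
split=> //; [exact: C_mono (ltW st) Ca|exact: C_mono (ltW st) Cb|].
by move=> x xab Cx; apply: h; exists x.
Qed.

Lemma step_uniq t a b c d c' d' : step t a b c d -> step t a b c' d' ->
  c = c' /\ d = d'.
Proof.
case=> [[h [l m]]|[h [-> ->]]]; case=> [[h' [l' m']]|[h' [-> ->]]] //.
have E : c = c' by apply/le_anti; rewrite (m _ _ l') (m' _ _ l).
split=> //; rewrite E in l.
by have [[g _ _ _ _] _] := l; have [[g' _ _ _ _] _] := l'; apply: gap_uniql g g'.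
Qed.

(** * The path of gaps along an unbounded closed discrete set *)

Section Path.
Variable N : set K.
Hypothesis dN : definable M (setK1 N).
Hypothesis cN : closed_discrete N.
Hypothesis uN : forall x, exists2 n, N n & x < n.
Variables n0 a0 b0 : K.
Hypothesis Nn0 : N n0.
Hypothesis g0 : gap n0 a0 b0.

(* The gaps around x remember the whole path that led to x. *)
Definition history n x := forall m m', n0 <= m -> consecutive N m m' -> m' <= n ->
  forall a b c d, gap m a b -> a < x < b -> gap m' c d -> c < x < d ->
  step m' a b c d.

Definition path n a b :=
  [/\ gap n a b, a0 <= a, b <= b0 & forall x, a < x < b -> history n x].

Lemma definable_path n (t a b : 'rV[K]_n -> K) : dfun M t -> dfun M a ->
  dfun M b -> definable M (fun z => path (t z) (a z) (b z)).
Proof.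
have dgap := definable_gap; have dstep := definable_step; move=> dt da db.
have dcons k (x y : 'rV[K]_k -> K) : dfun M x -> dfun M y ->
    definable M (fun z => consecutive N (x z) (y z)).
  move=> dx dy.
  suff : definable M (fun z => (N (x z) /\ N (y z)) /\
      (x z < y z /\ forall k, N k -> ~ (x z < k < y z))).
    by apply: definable_ext => z; split=> [[[? ?] [? ?]]|[]].
  by definability.
have dhist k (x y : 'rV[K]_k -> K) : dfun M x -> dfun M y ->
    definable M (fun z => history (x z) (y z)).
  by move=> dx dy; rewrite /history; definability.
suff : definable M (fun z => (gap (t z) (a z) (b z) /\ a0 <= a z) /\
      (b z <= b0 /\ forall x, a z < x < b z -> history (t z) x)).
  by apply: definable_ext => z; split=> [[[? ?] [? ?]]|[]].
by definability.
Qed.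

Lemma midpoint_between (a b : K) : a < b -> a < (a + b) / 2 < b.
Proof. lra. Qed.

(** An earlier gap around one point of a gap contains the whole gap, so all its points share their
    history. *)
Lemma history_gap n a b x y : gap n a b -> a < x < b -> a < y < b ->
  history n x -> history n y.
Proof.
move=> g ax ay H m m' n0m mm' m'n p q r s gpq py grs ry.
have [_ _ /ltW lt _] := mm'.
have [pa bq] := gap_nested (le_trans lt m'n) gpq g py ay.
have [ra bs] := gap_nested m'n grs g ry ay.
by apply: (H m m') => //; lra.
Qed.

Lemma path_down m n a b : n0 <= m -> m <= n -> path n a b ->
  exists c d, [/\ path m c d, c <= a & b <= d].
Proof.
move=> n0m mn [g a0a bb0 H].
have [ab Ca Cb nC] := g; have xm := midpoint_between ab; set x := (a + b) / 2 in xm.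
have [||c [d [gc xc]]] := @gap_around m x.
- by have /andP[? _] := C_range Ca; have /andP[_ ?] := C_range Cb; lra.
- by move=> Cx; apply: (nC x) => //; apply: C_mono Cx.
have [ca bd] := gap_nested mn gc g xc xm.
exists c, d; split=> //.
have [||? ?] := gap_nested n0m g0 gc (x := x) => //; first lra.
split=> // y yc; apply: (history_gap gc xc yc).
move=> k k' nk kk' k'm p q r s *; apply: (H x xm k k') => //; lra.
Qed.

(** Uniqueness at stage [n] is a hypothesis because the lemma serves in the induction that proves
    uniqueness. The history is read at the midpoint of the new gap. *)
Lemma path_step_unique n n' a b c d : n0 <= n -> consecutive N n n' ->
  path n' c d -> path n a b ->
  (forall p q, path n p q -> p = a /\ q = b) -> step n' a b c d.
Proof.
move=> n0n nn' pcd pab U; have [_ _ lt _] := nn'.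
have [p [q [ppq pc dq]]] := path_down n0n (ltW lt) pcd.
have [E1 E2] := U _ _ ppq; rewrite {}E1 {}E2 in ppq pc dq.
have [gab _ _ _] := pab; have [gcd _ _ H] := pcd; have [cd _ _ _] := gcd.
have xm := midpoint_between cd; apply: (H _ xm n n') => //; lra.
Qed.

Lemma path_uniq n : N n -> n0 <= n ->
  forall a b c d, path n a b -> path n c d -> a = c /\ b = d.
Proof.
have dpath := definable_path.
move: n; refine (closed_discrete_ind Kcomplete dN cN Nn0 _ _ _); first by definability.
  have base a b : path n0 a b -> a = a0 /\ b = b0.
    move=> [g a0a bb0 _]; have [ab _ _ _] := g; have xm := midpoint_between ab.
    by apply: (gap_uniq g g0 xm); lra.
  by move=> a b c d /base[-> ->] /base[-> ->].
move=> n n' n0n nn' IH a b c d pab pcd; have [_ _ /ltW lt _] := nn'.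
have [p [q [ppq _ _]]] := path_down n0n lt pab.
have U p' q' (h : path n p' q') : p' = p /\ q' = q by apply: IH.
apply: (@step_uniq n' p q).
  exact: (path_step_unique n0n nn').
exact: (path_step_unique n0n nn').
Qed.

Lemma path_step n n' a b c d : n0 <= n -> consecutive N n n' ->
  path n a b -> path n' c d -> step n' a b c d.
Proof.
move=> n0n nn' pab pcd; apply: (path_step_unique n0n nn') => // p q ppq.
by have [Nn _ _ _] := nn'; apply: path_uniq ppq pab.
Qed.

Lemma path_ex n : N n -> n0 <= n -> exists a b, path n a b.
Proof.
have dpath := definable_path.
move: n; refine (closed_discrete_ind Kcomplete dN cN Nn0 _ _ _); first by definability.
  exists a0, b0; split=> // x _ m m' n0m [_ _ mm' _] m'n; lra.
move=> n n' n0n nn' [a [b [g a0a bb0 H]]].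
have [Nn Nn' lt nb] := nn'.
have [c [d [st gcd ac db]]] := step_ex lt g; exists c, d; split=> //; try lra.
move=> x xcd m m' n0m mm' m'n p q r s gpq px grs rx.
have [Nm Nm' ltm nbm] := mm'.
have [m'n'|] := leP m' n; first by apply: (H x) gpq px grs rx => //; lra.
(* The only step not recorded in the old history is the last one; consecutiveness forces it to be
   the step from [n] to [n']. *)
move=> nm'; have E' : m' = n'.
  by apply/le_anti; rewrite m'n leNgt; apply/negP => ?; apply: (nb m') => //; rewrite nm'.
have E : m = n.
  apply/le_anti/andP; split.
    by rewrite leNgt; apply/negP => nm; apply: (nb m) => //; rewrite nm -E'.
  by rewrite leNgt; apply/negP => nm; apply: (nbm n) => //; rewrite nm.
rewrite E in gpq; rewrite E' in grs *.
have xab : a < x < b by lra.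
have [-> ->] := gap_uniq gpq g px xab.
by have [-> ->] := gap_uniq grs gcd rx xcd.
Qed.

Lemma path_nested m n a b c d : N m -> n0 <= m -> m <= n ->
  path m a b -> path n c d -> a <= c /\ d <= b.
Proof.
move=> Nm n0m mn pab pcd; have [p [q [ppq pc dq]]] := path_down n0m mn pcd.
by have [-> ->] := path_uniq Nm n0m pab ppq.
Qed.

(* The path cannot become constant, as the C t cover everything. *)
Lemma path_not_stable k a b : N k -> n0 <= k -> path k a b ->
  exists n c d, [/\ N n, k <= n, path n c d & ~ (c = a /\ d = b)].
Proof.
move=> Nk n0k pab; have [g _ _ _] := pab; have [ab Ca Cb _] := g.
have xm := midpoint_between ab.
have [|t Ct] := C_cover (x := (a + b) / 2).
  by have /andP[? _] := C_range Ca; have /andP[_ ?] := C_range Cb; lra.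
have [n Nn] := uN (Num.max k t); rewrite gt_max => /andP[kn tn].
have n0n := le_trans n0k (ltW kn).
have [c [d pcd]] := path_ex Nn n0n.
exists n, c, d; split=> //; first exact: ltW.
case=> E1 E2; have [[_ _ _ nC] _ _ _] := pcd; apply: (nC ((a + b) / 2)).
  by rewrite E1 E2.
exact: C_mono (ltW tn) Ct.
Qed.

Lemma path_limit : exists x, u <= x <= v /\
  forall n a b, N n -> n0 <= n -> path n a b -> a <= x <= b.
Proof.
have dpath := definable_path.
have ltp n a b : path n a b -> a < b by case=> -[].
have [|||x [ub lub]] := definable_sup Kcomplete
  (X := fun a => exists n, (N n /\ n0 <= n) /\ exists b, path n a b) (b := b0).
- by definability.
- by have [a [b p]] := path_ex Nn0 (lexx _); exists a, n0; split=> //; exists b.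
- move=> a [n [_ [b p]]]; have := ltp _ _ _ p; have [_ _ ? _] := p; lra.
have xP n a b : N n -> n0 <= n -> path n a b -> a <= x <= b.
  move=> Nn n0n p; apply/andP; split; first by apply: ub; exists n; split=> //; exists b.
  rewrite leNgt; apply/negP => bx.
  have [|c [m [[Nm n0m] [d q]]] xc] := lub (x - b); first by rewrite subr_gt0.
  have ltc := ltp _ _ _ q; have lta := ltp _ _ _ p.
  case: (leP m n) => [mn|/ltW nm].
    by have [] := path_nested Nm n0m mn q p; lra.
  by have [] := path_nested Nn n0n nm p q; lra.
exists x; split=> //; have [a [b p]] := path_ex Nn0 (lexx _).
have := xP _ _ _ Nn0 (lexx _) p; have [[_ Ca Cb _] _ _ _] := p.
by have /andP[? _] := C_range Ca; have /andP[_ ?] := C_range Cb; lra.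
Qed.

(** From stage [k] on, the limit [x] belongs to the family, so it is an endpoint of every gap,
    always on the same side. A change of the gap cannot move [x]; so the other endpoint was the one
    due to leave, and its successor is younger than [x]. A second change would have to move [x].
    Hence the path becomes constant, which [path_not_stable] excludes. *)
Lemma path_contradiction : False.
Proof.
have dpath := definable_path; have dold := definable_older.
have [x [uxv xP]] := path_limit; have [t0 Ct0] := C_cover uxv.
have [k Nk] := uN (Num.max n0 t0); rewrite gt_max => /andP[/ltW n0k /ltW tk].
have {t0 Ct0 tk} Ckx : C k x by apply: C_mono Ct0.
have [a [b pab]] := path_ex Nk n0k.
have Cnx n : k <= n -> C n x by move=> kn; apply: C_mono Ckx.
have ends n c d : N n -> k <= n -> path n c d -> x = c \/ x = d.
  move=> Nn kn p; have [[_ _ _ nC] _ _ _] := p.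
  have := xP _ _ _ Nn (le_trans n0k kn) p; rewrite !le_eqVlt.
  case/andP=> /orP[/eqP->|cx]; first by left.
  case/orP=> [/eqP ->|xd]; first by right.
  by case: (nC x); [rewrite cx xd|exact: Cnx].
have new n n' c d y : consecutive N n n' -> k <= n -> path n c d -> C n' y ->
    c < y < d -> older x y.
  move=> nn' kn [[_ _ _ nC] _ _ _] Cy ycd.
  exact: olderVlt (Cnx n kn) (nC y ycd).
have ltp n c d : path n c d -> c < d by case=> -[].
have [Ex|Ex] := ends _ _ _ Nk (lexx k) pab.
- have leftE n c d : N n -> k <= n -> path n c d -> c = x.
    move=> Nn kn p; have [ac _] := path_nested Nk n0k kn pab p.
    have /andP[cx _] := xP _ _ _ Nn (le_trans n0k kn) p.
    by apply/le_anti; rewrite cx Ex ac.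
  have chg n n' d d' : consecutive N n n' -> k <= n -> path n x d ->
      path n' x d' -> d' = d \/ (~ older x d /\ older x d').
    move=> nn' kn p p'; have := path_step (le_trans n0k kn) nn' p p'.
    case=> [[_ [[[g _ d'd oc no] _] _]]|[_ [_ ->]]]; last by left.
    right; have nold : ~ older x d by move=> /oc; rewrite ltxx.
    split=> //; apply: (new n n' x d) => //; first by have [] := g.
    by rewrite (ltp _ _ _ p') no.
  (* Once [x] is the older endpoint, any change would move it, so the gap stays the same forever. *)
  have stable n d : N n -> k <= n -> path n x d -> older x d -> False.
    move=> Nn kn p o; have n0n := le_trans n0k kn.
    have [m [c' [d' [Nm nm p' []]]]] := path_not_stable Nn n0n p.
    split; first exact: leftE Nm (le_trans kn nm) p'.
    move: m Nm nm c' d' p'; refine (closed_discrete_ind Kcomplete dN cN Nn _ _ _).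
    - by definability.
    - by move=> c' d' p'; have [_ ->] := path_uniq Nn n0n p p'.
    - move=> m m' nm mm' IH c' d' p'; have [Nm Nm' lt _] := mm'.
      have km := le_trans kn nm.
      have [c [e q]] := path_ex Nm (le_trans n0k km).
      have Ed := IH _ _ q; have Ec := leftE _ _ _ Nm km q.
      rewrite Ed Ec in q.
      have Ep := leftE _ _ _ Nm' (le_trans km (ltW lt)) p'; rewrite Ep in p'.
      by have [//|[]] := chg _ _ _ _ mm' km q p'.
  rewrite -Ex in pab.
  have [m [c' [d' [Nm nm p' []]]]] := path_not_stable Nk n0k pab.
  split; first exact: leftE Nm nm p'.
  move: m Nm nm c' d' p'; refine (closed_discrete_ind Kcomplete dN cN Nk _ _ _).
  - by definability.
  - by move=> c' d' p'; have [_ ->] := path_uniq Nk n0k pab p'.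
  - move=> m m' km mm' IH c' d' p'; have [Nm Nm' lt _] := mm'.
    have [c [e q]] := path_ex Nm (le_trans n0k km).
    have Ed := IH _ _ q; have Ec := leftE _ _ _ Nm km q.
      rewrite Ed Ec in q.
    have km' := le_trans km (ltW lt); have Ep := leftE _ _ _ Nm' km' p'; rewrite Ep in p'.
    have [//|[_ o]] := chg _ _ _ _ mm' km q p'.
    by case: (stable _ _ Nm' km' p' o).
- have rightE n c d : N n -> k <= n -> path n c d -> d = x.
    move=> Nn kn p; have [_ db] := path_nested Nk n0k kn pab p.
    have /andP[_ xd] := xP _ _ _ Nn (le_trans n0k kn) p.
    by apply/le_anti; rewrite xd {1}Ex db.
  have chg n n' c c' : consecutive N n n' -> k <= n -> path n c x ->
      path n' c' x -> c' = c \/ (older c x /\ ~ older c' x).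
    move=> nn' kn p p'; have := path_step (le_trans n0k kn) nn' p p'.
    case=> [[_ [[[g cc' _ oc no] _] _]]|[_ [-> _]]]; last by left.
    right; have old : older c x.
      by apply: contrapT => /no; rewrite ltxx.
    split=> // o'; have [[_ _ _ nC] _ _ _] := p; apply: (nC c').
      by rewrite oc // (ltp _ _ _ p').
    exact: o' (Cnx n kn).
  have stable n c : N n -> k <= n -> path n c x -> ~ older c x -> False.
    move=> Nn kn p o; have n0n := le_trans n0k kn.
    have [m [c' [d' [Nm nm p' []]]]] := path_not_stable Nn n0n p.
    split; last exact: rightE Nm (le_trans kn nm) p'.
    move: m Nm nm c' d' p'; refine (closed_discrete_ind Kcomplete dN cN Nn _ _ _).
    - by definability.
    - by move=> c' d' p'; have [-> _] := path_uniq Nn n0n p p'.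
    - move=> m m' nm mm' IH c' d' p'; have [Nm Nm' lt _] := mm'.
      have km := le_trans kn nm.
      have [e [d q]] := path_ex Nm (le_trans n0k km).
      have Ed := IH _ _ q; have Ec := rightE _ _ _ Nm km q.
      rewrite Ed Ec in q.
      have Ep := rightE _ _ _ Nm' (le_trans km (ltW lt)) p'; rewrite Ep in p'.
      by have [//|[]] := chg _ _ _ _ mm' km q p'.
  rewrite -Ex in pab.
  have [m [c' [d' [Nm nm p' []]]]] := path_not_stable Nk n0k pab.
  split; last exact: rightE Nm nm p'.
  move: m Nm nm c' d' p'; refine (closed_discrete_ind Kcomplete dN cN Nk _ _ _).
  - by definability.
  - by move=> c' d' p'; have [-> _] := path_uniq Nk n0k pab p'.
  - move=> m m' km mm' IH c' d' p'; have [Nm Nm' lt _] := mm'.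
    have [e [d q]] := path_ex Nm (le_trans n0k km).
    have Ed := IH _ _ q; have Ec := rightE _ _ _ Nm km q.
      rewrite Ed Ec in q.
    have km' := le_trans km (ltW lt); have Ep := rightE _ _ _ Nm' km' p'; rewrite Ep in p'.
    have [//|[_ o]] := chg _ _ _ _ mm' km q p'.
    by case: (stable _ _ Nm' km' p' o).
Qed.

End Path.

Lemma closed_cover_contradiction : False.
Proof.
have [N [dN cN uN]] := unbounded_closed_discrete.
have [n0 Nn0 _] := uN 0.
have [a [b [g _ _]]] := gap_inside uv (C_l n0) (C_r n0).
exact: (path_contradiction dN cN uN Nn0 g).
Qed.

End Baire.

Section BaireCategory.
Variables (K : realFieldType) (M : expansion K).
Hypothesis Kcomplete : definably_complete M.

(** The family is first normalized: closures are taken within [[u, v]], and both endpoints are added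
    at all times, so that every gap has its two ends in the family. *)
Lemma baire_line (C : K -> set K) (u v : K) :
  definable M (fun z : 'rV[K]_(1 + 1) =>
    C (lsubmx z ord0 ord0) (rsubmx z ord0 ord0)) ->
  (forall s t, s <= t -> C s `<=` C t) -> (forall t, nowhere_dense (C t)) ->
  u < v -> exists2 x, u < x < v & forall t, ~ C t x.
Proof.
move=> dC mono nd uv; apply: contrapT => H.
pose D t x := (u <= x <= v) /\ ((x = u \/ x = v) \/
  forall e, 0 < e -> exists y, C t y /\ `|x - y| < e).
have cl t x : closure (C t) x <-> forall e, 0 < e -> exists y, C t y /\ `|x - y| < e.
  by rewrite closure_KP; split=> h e /h => [[y]|[y []]]; exists y.
apply: (@closed_cover_contradiction _ M Kcomplete D u v _ uv).
- by rewrite /D; definability.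
- move=> s t x st [xuv [?|h]]; split=> //; [by left|right => e /h[y [Cy xy]]].
  by exists y; split=> //; apply: mono Cy.
- move=> t x nD; case: (boolP (u <= x <= v)) => [xuv|].
    have [xu|xu] := eqVneq x u; first by case: nD; split=> //; left; left.
    have [xv|xv] := eqVneq x v; first by case: nD; split=> //; left; right.
    case: (pselect (closure (C t) x)) => [/cl h|nC]; first by case: nD; split=> //; right.
    have : open (~` closure (C t)) by apply: closed_openC; apply: closed_closure.
    rewrite openE => /(_ x nC)/nbhs_KP[e e0 He].
    exists (Num.min e (Num.min (x - u) (v - x))).
      move: xuv xu xv => /andP[]; rewrite !le_eqVlt !lt_min !subr_gt0 e0.
      by case/orP=> [/eqP->|->]; rewrite ?eqxx// => /orP[/eqP->|->]; rewrite ?eqxx.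
    move=> y; rewrite !lt_min => /and3P[xe yu yv].
    case=> _ [[E|E]|/cl]; last exact: He.
      by move: yu; rewrite E => yu; have := ler_norm (x - u); lra.
    by move: yv; rewrite E distrC => yv; have := ler_norm (v - x); lra.
  rewrite negb_and -!ltNge => /orP[xu|vx].
    exists (u - x) => [|y yx [/andP[uy _] _]]; first by rewrite subr_gt0.
    by move: yx; rewrite ltr_norml; lra.
  exists (x - v) => [|y yx [/andP[_ yv] _]]; first by rewrite subr_gt0.
  by move: yx; rewrite ltr_norml; lra.
- move=> t a b ab.
  have [c [d [ac cd db nC]]] := nowhere_dense_gap (nd t) ab.
  have [x /andP[cx xd] /andP[xu xv]] : exists2 x, c < x < d & (x != u) && (x != v).
    (* Of three points, at least one avoids both [u] and [v]. *)
    pose y i := c + (d - c) * i / 4.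
    have yP i : 0 < i < 4 -> c < y i < d by move=> i04; rewrite /y; nra.
    have y12 : y 1 < y 2 by rewrite /y; lra.
    have y23 : y 2 < y 3 by rewrite /y; lra.
    have [E1|n1] := boolP ((y 1 != u) && (y 1 != v)).
      by exists (y 1) => //; apply: yP; lra.
    have [E2|n2] := boolP ((y 2 != u) && (y 2 != v)).
      by exists (y 2) => //; apply: yP; lra.
    exists (y 3); first by apply: yP; lra.
    move: n1 n2; rewrite !negb_and !negbK.
    by case/orP=> /eqP E1 /orP[/eqP E2|/eqP E2]; rewrite -?E1 -?E2; lra.
  exists x; first by rewrite (le_lt_trans ac cx) (lt_le_trans xd db).
  case=> _ [[/eqP|/eqP]|/cl]; rewrite ?(negPf xu) ?(negPf xv) //.
  by apply: nC; rewrite cx xd.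
- by move=> t x [].
- by move=> t; split; [rewrite lexx ltW|left; left].
- by move=> t; split; [rewrite lexx ltW|left; right].
- move=> x xuv; case: (eqVneq x u) => [->|xu].
    by exists 0; split; [rewrite lexx ltW|left; left].
  case: (eqVneq x v) => [->|xv].
    by exists 0; split; [rewrite lexx ltW|left; right].
  have [t Ct] : exists t, C t x.
    apply/not_existsP => nC; apply: H; exists x => //.
    by move: xuv xu xv => /andP[]; rewrite !le_eqVlt;
      case/orP=> [/eqP->|->]; rewrite ?eqxx// => /orP[/eqP->|->]; rewrite ?eqxx.
  by exists t; split=> //; right=> e e0; exists x; split=> //; rewrite subrr normr0.
Qed.

End BaireCategory.


(** * Uniform selection *)

Section Selection.
Variables (K : realFieldType) (M : expansion K).
Hypothesis Kcomplete : definably_complete M.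

(** [R] is the graph of a partial function. The default value 0 elsewhere makes [f] total without
    losing definability. *)
Lemma definable_choice n (R : 'rV[K]_n -> K -> Prop) :
  definable M (fun z : 'rV_(n + 1) => R (lsubmx z) (rsubmx z ord0 ord0)) ->
  (forall x a b, R x a -> R x b -> a = b) ->
  exists2 f, dfun M f & forall x, (exists a, R x a) -> R x (f x).
Proof.
move=> dR Runiq.
pose f x := if pselect (exists a, R x a) is left h then projT1 (cid h) else 0.
have fR x : (exists a, R x a) -> R x (f x).
  by rewrite /f; case: pselect => // h _; apply: (projT2 (cid h)).
exists f => //.
suff : definable M (fun z : 'rV_(n + 1) => R (lsubmx z) (rsubmx z ord0 ord0) \/
    ((~ exists a, R (lsubmx z) a) /\ rsubmx z ord0 ord0 = 0)).
  apply: definable_ext => z; split=> [[Rz|[nR ->]]|->].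
  - have h : exists a, R (lsubmx z) a by exists (rsubmx z ord0 ord0).
    exact: Runiq Rz (fR _ h).
  - by rewrite /f; case: pselect.
  - case: (pselect (exists a, R (lsubmx z) a)) => h; first by left; apply: fR.
    by right; split=> //; rewrite /f; case: pselect.
by definability.
Qed.

Definition empty_interior_nowhere_dense n :=
  forall X : set 'rV[K]_n, definable M X -> X° = set0 -> nowhere_dense X.

Definition baire n := forall C : K -> set 'rV[K]_n,
  definable M (fun z : 'rV_(1 + n) => C (lsubmx z ord0 ord0) (rsubmx z)) ->
  (forall s t, s <= t -> C s `<=` C t) -> (forall t, nowhere_dense (C t)) ->
  forall x e, 0 < e -> exists2 y, cube x e y & forall t, ~ C t y.

(** Let [Y] be the set of points of the cube where [f] is minimal up to [d] among nearby values. If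
    [Y] had empty interior, a smaller cube would miss it; but a point where [f] is within [d] of its
    infimum over that cube belongs to [Y]. *)
Lemma locally_almost_minimal n (f : 'rV[K]_n -> K) (b d : K) x e :
  empty_interior_nowhere_dense n -> dfun M f -> 0 < d -> 0 < e ->
  (forall y, cube x e y -> b <= f y) ->
  exists x' e', [/\ 0 < e', cube x' e' `<=` cube x e & forall y, cube x' e' y ->
    exists2 r, 0 < r & forall z, cube y r z -> f y <= f z + d].
Proof.
move=> eind df d0 e0 fb.
pose Y y := cube x e y /\ exists r, 0 < r /\ forall z, cube y r z -> f y <= f z + d.
have dY : definable M Y by rewrite /Y; definability.
have [/(eind _ dY)/nowhere_denseP H|/not_empty_interior[x' [e' e'0 H]]] :=
  pselect (Y° = set0); last first.
  exists x', e'; split=> // y /H[]// _ [r [r0 Hr]]; by exists r.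
have [x' [e' [e'0 H1 H2]]] := H x e e0.
have [|||m [lb glb]] := definable_inf Kcomplete (b := b)
  (X := fun a => exists y, cube x' e' y /\ a = f y).
- by definability.
- by exists (f x'), x'; split=> //; apply: cube_center.
- by move=> _ [y [xy ->]]; apply: fb; apply: H1.
have [_ [y [xy ->]] fy] := glb d d0; case: (H2 y) => //; split; first exact: H1.
have [r r0 Hr] := cube_open xy; exists r; split=> // z /Hr xz.
have : m <= f z by apply: lb; exists z.
lra.
Qed.

(** Almost minimality of [f] and of [- f], each with [d / 2], bounds [f] near a point from both
    sides by its value there. *)
Lemma locally_almost_constant n (f : 'rV[K]_n -> K) (b d : K) x e :
  empty_interior_nowhere_dense n -> dfun M f -> 0 < d -> 0 < e ->
  (forall y, cube x e y -> `|f y| <= b) ->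
  exists x' e' c, [/\ 0 < e', cube x' e' `<=` cube x e &
    forall y, cube x' e' y -> `|f y - c| < d].
Proof.
move=> eind df d0 e0 fb; have d2 : 0 < d / 2 by lra.
have [|x1 [e1 [e10 s1 H1]]] :=
    @locally_almost_minimal _ f (- b) _ x e eind df d2 e0.
  by move=> y /fb; rewrite ler_norml => /andP[].
have [||x2 [e2 [e20 s2 H2]]] :=
    @locally_almost_minimal _ (fun y => - f y) (- b) _ x1 e1 eind _ d2 e10.
- by definability.
- by move=> y /s1 /fb; rewrite ler_norml lerN2 => /andP[].
have c2 := cube_center x2 e20; have [r1 r10 Hr1] := H1 _ (s2 _ c2).
have [r2 r20 Hr2] := H2 _ c2.
exists x2, (Num.min e2 (Num.min r1 r2)), (f x2); split.
- by rewrite !lt_min e20 r10.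
- by apply: subset_trans s1; apply: subset_trans s2; apply: cubeW; rewrite ge_min lexx.
- move=> y xy; have : cube x2 r1 y by apply: cubeW xy; rewrite !ge_min lexx orbT.
  move/Hr1 => ?; have : cube x2 r2 y by apply: cubeW xy; rewrite !ge_min lexx !orbT.
  by move/Hr2 => ?; rewrite ltr_norml; lra.
Qed.

(* The tuples y cannot be chosen definably, but their coordinates can be
   confined one after another, using infima. *)
Lemma uniform_selection n m (S : 'rV[K]_n -> 'rV[K]_m -> K -> Prop) x e :
  empty_interior_nowhere_dense n -> baire n ->
  definable M (fun w : 'rV[K]_(n + m + 1) =>
    S (lsubmx (lsubmx w)) (rsubmx (lsubmx w)) (rsubmx w ord0 ord0)) ->
  (forall z y d d', d' <= d -> S z y d -> S z y d') -> 0 < e ->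
  (forall z, cube x e z -> exists y d, 0 < d /\ S z y d) ->
  exists x' e' c d, [/\ 0 < e', cube x' e' `<=` cube x e, 0 < d &
    forall z, cube x' e' z -> exists2 y, S z y d & cube c d y].
Proof.
move=> eind bn dS monoS e0 HS.
(* [C t] asks for a witness bounded by [t] with [d] at least the inverse of [t]. These sets increase
   and cover the cube, so by Baire one of them contains a cube, on which [d] is uniform and the
   witnesses are bounded. *)
pose C t z := cube x e z /\ exists d, (0 < d /\ 1 <= t * d) /\
  exists y, S z y d /\ forall i : 'I_m, `|y ord0 i| <= t.
have dC : definable M (fun z : 'rV_(1 + n) => C (lsubmx z ord0 ord0) (rsubmx z)).
  by rewrite /C; definability.
have monoC s t : s <= t -> C s `<=` C t.
  move=> st z [xz [d [[d0 sd] [y [Sy ys]]]]]; split=> //.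
  exists d; split; first by split=> //; nra.
  by exists y; split=> // i; apply: le_trans st.
have coverC z : cube x e z -> exists t, C t z.
  move=> xz; have [y [d [d0 Sy]]] := HS z xz.
  pose t := d^-1 + \sum_i `|y ord0 i|; exists t; split=> //.
  have s0 : 0 <= \sum_i `|y ord0 i| by apply: sumr_ge0 => i _.
  exists d; split; first split=> //.
    by rewrite /t mulrDl mulVf ?gt_eqF // lerDl mulr_ge0 // ltW.
  exists y; split=> // i; rewrite /t (bigD1 i) //= addrCA lerDl addr_ge0 //.
    by rewrite invr_ge0 ltW.
  by apply: sumr_ge0 => j _.
have [t [x1 [e1 e10 H1]]] : exists t x1, exists2 e1, 0 < e1 & cube x1 e1 `<=` C t.
  apply: contrapT => H.
  have [|y xy nC] := bn C dC monoC _ x e e0; last first.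
    by have [t Ct] := coverC _ xy; apply: nC Ct.
  move=> t; apply: eind; first by definability.
  apply: contrapT => /not_empty_interior[x1 [e1 e10 H1]].
  by apply: H; exists t, x1, e1.
have t0 : 0 < t.
  have [_ [d [[d0 td] _]]] := H1 _ (cube_center x1 e10).
  by rewrite -(pmulr_lgt0 _ d0); lra.
pose d := t^-1; have d0 : 0 < d by rewrite invr_gt0.
have {}H1 z : cube x1 e1 z -> cube x e z /\ exists y, S z y d /\ forall i, `|y ord0 i| <= t.
  move=> /H1[xz [d' [[d'0 td] [y [Sy yt]]]]]; split=> //; exists y; split=> //.
  by apply: monoS Sy; rewrite /d -[t^-1]mul1r ler_pdivrMr // mulrC.
suff main k : (k <= m)%N -> exists x' e' (c : 'rV[K]_m), [/\ 0 < e',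
    cube x' e' `<=` cube x1 e1 & forall z, cube x' e' z ->
    exists y, (S z y d /\ (forall i, `|y ord0 i| <= t)) /\
      forall i : 'I_m, (i < k)%N -> `|c ord0 i - y ord0 i| < d].
  have [x' [e' [c [e'0 s H]]]] := main m (leqnn m).
  exists x', e', c, d; split=> //; first by move=> z /s /H1[].
  by move=> z /H[y [[Sy _] Hy]]; exists y => // i; apply: Hy.
elim: k => [_|k IH km].
  by exists x1, e1, 0; split=> // z /H1[_ [y [Sy yt]]]; exists y.
have {IH}[x2 [e2 [c [e20 s2 H2]]]] := IH (ltnW km).
pose i0 := Ordinal km.
pose P z y := (S z y d /\ (forall i, `|y ord0 i| <= t)) /\
      forall i : 'I_m, (i < k)%N -> `|c ord0 i - y ord0 i| < d.
have dP : definable M (fun z : 'rV_(n + m) => P (lsubmx z) (rsubmx z)).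
  by rewrite /P; definability.
(* [a] is the infimum of the coordinate [i0] over the admissible [y]. As a function of [z] it is
   almost constant on a smaller cube, and some [y] comes within [d / 2] of it. *)
pose R z a := (forall y, P z y -> a <= y ord0 i0) /\
  forall r, 0 < r -> exists y, P z y /\ y ord0 i0 < a + r.
have [||f df fR] := @definable_choice n R.
- by rewrite /R; definability.
- suff H z a b : R z a -> R z b -> a <= b.
    by move=> z a b Ra Rb; apply/le_anti; rewrite !(H z).
  move=> [Ha _] [_ Hb]; rewrite leNgt; apply/negP => ba.
  have [|y [Py yb]] := Hb (a - b); first by rewrite subr_gt0.
  by have := Ha _ Py; lra.
have {}fR z : cube x2 e2 z -> R z (f z).
  move=> xz; apply: fR.
  have [|||a [lb glb]] := definable_inf Kcomplete (b := - t)
    (X := fun a => exists y, P z y /\ a = y ord0 i0).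
  - by definability.
  - by have [y Py] := H2 z xz; exists (y ord0 i0), y.
  - by move=> _ [y [[[_ yt] _] ->]]; have := yt i0; rewrite ler_norml => /andP[].
  exists a; split; first by move=> y Py; apply: lb; exists y.
  by move=> r /glb[_ [y [Py ->]] yr]; exists y.
have d2 : 0 < d / 2 by lra.
have [|x3 [e3 [c3 [e30 s3 H3]]]] :=
  @locally_almost_constant n f (t + 1) _ x2 e2 eind df d2 e20.
  move=> y /fR[f1 f2]; have [z [Pz zf]] := f2 1 ltr01.
  have := f1 _ Pz; have [[_ zt] _] := Pz; have := zt i0; rewrite !ler_norml; lra.
exists x3, e3, (\row_i if i == i0 then c3 else c ord0 i); split=> //.
  exact: subset_trans s2.
move=> z xz; have [f1 f2] := fR _ (s3 _ xz); have [y [Py yf]] := f2 _ d2.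
have fy := f1 _ Py; have [PS Pc] := Py.
exists y; split=> // i ik; rewrite mxE; case: eqVneq => [->|ni].
  by have := H3 _ xz; rewrite !ltr_norml; lra.
by apply: Pc; rewrite ltn_neqAle -ltnS ik andbT -(inj_eq val_inj) in ni *.
Qed.

(** Each fiber contains a cube of radius [2 * d] centred within [d] of [c], hence the cube of radius
    [d] around [c]. Since [c] and [d] do not depend on the fiber, a product cube results. *)
Lemma interior_of_fibers n m (A : set 'rV[K]_(n + m)) x e :
  empty_interior_nowhere_dense n -> baire n -> definable M A -> 0 < e ->
  (forall z, cube x e z -> (fiber A z)° !=set0) -> A° !=set0.
Proof.
move=> eind bn dA e0 HA.
have [||z /HA[y /interior_cubeP[d d0 Hd]]|x' [e' [c [d [e'0 _ d0 H]]]]] :=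
    @uniform_selection n m (fun z y d => forall w, cube y (2 * d) w -> A (row_mx z w))
      x e eind bn _ _ e0.
- by definability.
- by move=> z y d d' d'd H w yw; apply: H; apply: cubeW yw; lra.
- exists y, (d / 2); split; first lra.
  by move=> w yw; apply: Hd; apply: cubeW yw; lra.
exists (row_mx x' c); apply/interior_cubeP; exists (Num.min e' d).
  by rewrite lt_min e'0.
move=> z; rewrite -[z]hsubmxK => /cube_row_mx[zl zr].
have [|y Hy cy] := H (lsubmx z); first by apply: cubeW zl; rewrite ge_min lexx.
apply: Hy; apply: (cube_trans (cube_sym cy) (e := d)); last lra.
by apply: cubeW zr; rewrite ge_min lexx orbT.
Qed.

End Selection.


(** * Nowhere dense and meager sets in i-minimal structures *)

Section Iminimal.
Variables (K : realFieldType) (M : expansion K).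
Hypothesis Kcomplete : definably_complete M.
Hypothesis imin : i_minimal M.

Lemma empty_interior_nowhere_dense1 : empty_interior_nowhere_dense M 1.
Proof.
move=> X dX X0; rewrite -[X]setK1_scalar; apply/nowhere_dense_setK1.
by apply: imin; rewrite ?setK1_scalar //; apply/setK1_eq0; rewrite -interior_setK1 setK1_scalar.
Qed.

Lemma baire1 : baire M 1.
Proof.
move=> C dC mono nd x e e0.
have [||t||a ax nCa] := baire_line Kcomplete (C := fun t a => C t a%:M)
  (u := x ord0 ord0 - e) (v := x ord0 ord0 + e).
- by definability.
- by move=> s t st a; apply: mono.
- by apply/nowhere_dense_setK1; rewrite setK1_scalar.
- by lra.
exists a%:M => //; apply/cube1; rewrite mxE eqxx mulr1n ltr_norml; lra.
Qed.

Lemma empty_interior_nowhere_dense0 : empty_interior_nowhere_dense M 0.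
Proof.
move=> X _ X0; suff -> : X = set0 by rewrite /nowhere_dense closure0 interior0.
apply/seteqP; split => // x Xx; rewrite -X0; apply/interior_cubeP; exists 1 => // y _.
by rewrite [y](_ : _ = x) //; apply/rowP => -[].
Qed.

Lemma baire0 : baire M 0.
Proof.
move=> C _ _ nd x e e0; exists x; first exact: cube_center.
move=> t Cx; have /interior_eq0P/(_ x 1 ltr01)[y _] := nowhere_dense_interior (nd t).
by rewrite [y](_ : _ = x) //; apply/rowP => -[].
Qed.

(** Let [A] be the set of first coordinates over which the fiber of [X] has interior. If [A] had
    interior, so would [X]; hence some cube misses [A], and over it the fibers are nowhere dense by
    the case [m]. So the fibers of the complement of [X] have interior, and the complement contains
    a cube inside the given one. *)
Lemma empty_interior_nowhere_denseS m :
  empty_interior_nowhere_dense M m -> empty_interior_nowhere_dense M (1 + m).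
Proof.
move=> eind X dX X0; apply/nowhere_denseP => x e e0.
have [xl xr] : exists y z, x = row_mx y z by exists (lsubmx x), (rsubmx x); rewrite hsubmxK.
case: xr => z Ex; rewrite {x}Ex.
set B := cube (row_mx xl z) e.
pose A := [set a : 'rV_1 | exists y d, 0 < d /\ forall w, cube y d w -> X (row_mx a w)].
have dA : definable M A by rewrite /A; definability.
have [A0|/not_empty_interior[a [d d0 aA]]] := pselect (A° = set0); last first.
  suff : X° !=set0 by rewrite X0 => -[].
  apply: (interior_of_fibers Kcomplete empty_interior_nowhere_dense1 baire1 dX d0).
  by move=> w /aA[y [f [f0 Hf]]]; exists y; apply/interior_cubeP; exists f.
have /nowhere_denseP/(_ xl e e0)[a [d [d0 ad nA]]] := empty_interior_nowhere_dense1 dA A0.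
pose Y w := B w /\ ~ X w.
have dY : definable M Y by rewrite /Y /B; definability.
have [|w /interior_cubeP[f f0 wY]] :=
    @interior_of_fibers _ M Kcomplete _ _ Y a d empty_interior_nowhere_dense1 baire1 dY d0.
  move=> b ab; pose F y := cube z e y /\ X (row_mx b y).
  have dF : definable M F by rewrite /F; definability.
  have F0 : F° = set0.
    apply: contrapT => /not_empty_interior[y [r r0 Hr]]; apply: (nA b ab).
    by exists y, r; split=> // w /Hr[].
  have /nowhere_denseP/(_ z e e0)[y [r [r0 yr Hr]]] := eind _ dF F0.
  exists y; apply/interior_cubeP; exists r => // w yw; split.
    by apply/cube_row_mx; split; [apply: ad|apply: yr].
  by move=> Xw; apply: (Hr w yw); split=> //; apply: yr.
by exists w, f; split=> // [t /wY[]|t /wY[]].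
Qed.

(** The argument of Kuratowski and Ulam: the first coordinates over which the fiber of [C t] has
    interior form a nowhere dense set, increasing with [t]. Baire on the line gives [a] outside all
    of them, and Baire in dimension [m] applies to the fibers over [a]. *)
Lemma baireS m : empty_interior_nowhere_dense M m -> baire M m -> baire M (1 + m).
Proof.
move=> eind bm C dC mono nd x e e0.
pose E t := [set a : 'rV_1 | exists y d, 0 < d /\ forall w, cube y d w -> C t (row_mx a w)].
have dE : definable M (fun w : 'rV_(1 + 1) => E (lsubmx w ord0 ord0) (rsubmx w)).
  by rewrite /E; definability.
have [||a xa nE] := baire1 dE _ _ (lsubmx x) e0.
- move=> s t st a [y [d [d0 H]]]; exists y, d; split=> // w /H; exact: mono.
- move=> t; apply: empty_interior_nowhere_dense1; first by definability.
  apply: contrapT => /not_empty_interior[a [d d0 Ha]].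
  have dCt : definable M (C t) by definability.
  have : (C t)° !=set0.
    apply: (interior_of_fibers Kcomplete empty_interior_nowhere_dense1 baire1 dCt d0).
    by move=> w /Ha[y [f [f0 Hf]]]; exists y; apply/interior_cubeP; exists f.
  by rewrite (nowhere_dense_interior (nd t)) => -[].
pose D t y := C t (row_mx a y).
have dD : definable M (fun w : 'rV_(1 + m) => D (lsubmx w ord0 ord0) (rsubmx w)).
  by rewrite /D; definability.
have [||y xy nD] := bm D dD _ _ (rsubmx x) e e0.
- by move=> s t st y; apply: mono.
- move=> t; apply: eind; first by definability.
  apply: contrapT => /not_empty_interior[y [d d0 Hy]].
  by apply: (nE t); exists y, d.
by exists (row_mx a y) => //; rewrite -[x]hsubmxK; apply/cube_row_mx.
Qed.

Lemma iminimal_induction n : empty_interior_nowhere_dense M n /\ baire M n.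
Proof.
elim: n => [|n [eind bn]].
  by split; [apply: empty_interior_nowhere_dense0|apply: baire0].
by split; [apply: empty_interior_nowhere_denseS|apply: baireS].
Qed.

Lemma iminimal_nowhere_dense n (X : set 'rV[K]_n) :
  definable M X -> X° = set0 -> nowhere_dense X.
Proof. exact: (iminimal_induction n).1. Qed.

Lemma iminimal_interiorU n (X Y : set 'rV[K]_n) :
  definable M X -> definable M Y -> X° = set0 -> Y° = set0 -> (X `|` Y)° = set0.
Proof.
move=> dX dY X0 Y0; apply: nowhere_dense_interior.
by apply: nowhere_denseU; apply: iminimal_nowhere_dense.
Qed.

Lemma iminimal_interior_fibers n m (A : set 'rV[K]_(n + m)) x e :
  definable M A -> 0 < e ->
  (forall z, cube x e z -> (fiber A z)° !=set0) -> A° !=set0.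
Proof. by have [? ?] := iminimal_induction n; apply: interior_of_fibers. Qed.

Lemma iminimal_selection n m (S : 'rV[K]_n -> 'rV[K]_m -> K -> Prop) x e :
  definable M (fun w : 'rV[K]_(n + m + 1) =>
    S (lsubmx (lsubmx w)) (rsubmx (lsubmx w)) (rsubmx w ord0 ord0)) ->
  (forall z y d d', d' <= d -> S z y d -> S z y d') -> 0 < e ->
  (forall z, cube x e z -> exists y d, 0 < d /\ S z y d) ->
  exists x' e' c d, [/\ 0 < e', cube x' e' `<=` cube x e, 0 < d &
    forall z, cube x' e' z -> exists2 y, S z y d & cube c d y].
Proof. by have [? ?] := iminimal_induction n; apply: uniform_selection. Qed.

Lemma meager_nowhere_dense n (X : set 'rV[K]_n) : meager M X -> nowhere_dense X.
Proof.
move=> [dX [C [[dC mono] nd XC]]]; apply: iminimal_nowhere_dense => //.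
apply: contrapT => /not_empty_interior[x [e e0 xX]].
have [|y xy nC] := (iminimal_induction n).2 C _ mono nd x e e0.
  by apply: definable_ext dC => z; split=> [[]|].
by have [t _ Ct] := XC _ (xX _ xy); apply: nC Ct.
Qed.

Lemma nowhere_dense_meager n (X : set 'rV[K]_n) :
  definable M X -> nowhere_dense X -> meager M X.
Proof.
move=> dX nd; split=> //; exists (fun _ => X); split=> // [|x Xx]; last by exists 0.
by split=> [|s t _ //]; rewrite /definable_family; definability.
Qed.

End Iminimal.


(** * Dimension *)

Section Dimension.
Variable K : realFieldType.

Lemma topdim_leP n (X : set 'rV[K]_n) (d : \bar int) : (topdim X <= d)%E <->
  forall I : {set 'I_n}, (coord_proj I @` X)° !=set0 -> (#|I|%:Z%:E <= d)%E.
Proof.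
split=> [/bigmax_leP[_ H] I XI|H]; first by apply: H; apply/asboolP.
by apply/bigmax_leP; split=> [|I /asboolP/H//]; apply: leNye.
Qed.

Lemma topdim_geP n (X : set 'rV[K]_n) (d : nat) : (d%:Z%:E <= topdim X)%E <->
  exists2 I : {set 'I_n}, (coord_proj I @` X)° !=set0 & (d <= #|I|)%N.
Proof.
split=> [/bigmax_geP[|[I /asboolP XI dI]]|[I XI dI]].
- by rewrite leeNy_eq.
- by exists I.
- by apply/bigmax_geP; right; exists I => //; apply/asboolP.
Qed.

Lemma interior_nonempty_reindex p q n (s : 'I_p -> 'I_n) (t : 'I_q -> 'I_n)
    (g : 'I_p -> 'I_q) (h : 'I_q -> 'I_p) (X : set 'rV[K]_n) :
  (forall k, t k = s (h k)) -> cancel g h -> cancel h g ->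
  (colsub s @` X)° !=set0 -> (colsub t @` X)° !=set0.
Proof.
move=> ts gh hg [y /interior_cubeP[e e0 H]].
exists (colsub h y); apply/interior_cubeP; exists e => // w yw.
have [|x Xx E] := H (colsub g w).
  by move=> i; have := yw (g i); rewrite !mxE gh.
exists x => //; apply/rowP => k; have /rowP/(_ (h k)) := E.
by rewrite !mxE hg ts.
Qed.

(** [topdim] lists the chosen coordinates in the order of [enum_val]. Another injective listing only
    permutes them, so later arguments are free to use the listing that suits them. *)
Lemma topdim_ge_colsub p n (s : 'I_p -> 'I_n) (X : set 'rV[K]_n) :
  injective s -> (colsub s @` X)° !=set0 -> (p%:Z%:E <= topdim X)%E.
Proof.
move=> sI XI; apply/topdim_geP; pose I := [set s j | j : 'I_p].
exists I; last by rewrite card_imset // card_ord.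
have Is j : s j \in I by apply: imset_f.
have hP (k : 'I_#|I|) : {j | enum_val k = s j}.
  apply: cid; have /imsetP[j _ E] := enum_valP k; by exists j.
pose h k := projT1 (hP k); pose g j := enum_rank_in (Is j) (s j).
have hE k : enum_val k = s (h k) by rewrite /h; case: (hP k).
have gE j : enum_val (g j) = s j by rewrite enum_rankK_in.
apply: (@interior_nonempty_reindex _ _ _ s _ g h) => // [j|k].
  by apply: sI; rewrite -hE gE.
by apply: enum_val_inj; rewrite gE hE.
Qed.

Lemma topdim_lt_colsub p n (s : 'I_p -> 'I_n) (X : set 'rV[K]_n) (d : nat) :
  injective s -> (topdim X <= d%:Z%:E)%E -> (d < p)%N -> (colsub s @` X)° = set0.
Proof.
move=> sI Xd dp; apply: contrapT => /eqP/set0P/(topdim_ge_colsub sI) H.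
by have := le_trans H Xd; rewrite lee_fin lez_nat leqNgt dp.
Qed.

End Dimension.

(** * Definable unions *)

Section PseudoEnumerable.
Variables (K : realFieldType) (M : expansion K).
Hypothesis Kcomplete : definably_complete M.

Lemma definable_colsub p n (s : 'I_p -> 'I_n) (X : set 'rV[K]_n) :
  definable M X -> definable M (colsub s @` X).
Proof.
move=> dX; suff : definable M (fun y => exists x, X x /\ colsub s x = y).
  by apply: definable_ext => y; split=> [[x []]|[x]]; exists x.
by definability.
Qed.

(** Induction on the number [k] of coordinates in which points of [E] may be [c] or more apart; for
    [k = 0] at most one point is left. In the step, a slab of width [2 * c / 3] in the new
    coordinate falls under the induction hypothesis, and definable induction along that coordinate
    adds up the slabs. *)
Lemma nowhere_dense_pseudofinite_union p n (D : set 'rV[K]_p)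
    (X : 'rV[K]_p -> set 'rV[K]_n) (b c : K) :
  definable M D -> definable M (fun w : 'rV_(p + n) => X (lsubmx w) (rsubmx w)) ->
  0 < c -> (forall x i, D x -> `|x ord0 i| <= b) ->
  (forall x y, D x -> D y -> cube x c y -> x = y) ->
  (forall x, D x -> nowhere_dense (X x)) ->
  nowhere_dense (fun y => exists x, D x /\ X x y).
Proof.
move=> dD dX c0 Db Dc ndX.
suff main k : (k <= p)%N -> forall E, definable M E -> E `<=` D ->
    (forall x y (i : 'I_p), E x -> E y -> (k <= i)%N -> `|x ord0 i - y ord0 i| < c) ->
    nowhere_dense (fun y => exists x, E x /\ X x y).
  by apply: (main p (leqnn p) D) => // x y i _ _; rewrite leqNgt ltn_ord.
elim: k => [_|k IH kp] E dE ED Ec.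
  have [[x Ex]|nE] := pselect (exists x, E x).
    apply: nowhere_denseS (ndX _ (ED _ Ex)) => y [z [Ez Xz]].
    by rewrite (Dc x z) //; [exact: ED|exact: ED|move=> i; apply: Ec].
  apply: (@nowhere_denseS _ _ _ set0); first by move=> y [x [Ex _]]; case: nE; exists x.
  by rewrite /nowhere_dense closure0 interior0.
pose i0 := Ordinal kp.
pose U s y := exists x, (E x /\ x ord0 i0 <= s) /\ X x y.
have dU : definable M (fun w : 'rV_(1 + n) => U (lsubmx w ord0 ord0) (rsubmx w)).
  by rewrite /U; definability.
suff /(_ b) H : forall s, nowhere_dense (U s).
  apply: nowhere_denseS H => y [x [Ex Xx]]; exists x; split=> //; split=> //.
  by apply: le_trans (ler_norm _) (Db _ _ (ED _ Ex)).
apply: (definable_induction Kcomplete).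
- suff : definable M (fun s : 'rV_1 => forall x e, 0 < e -> exists y d,
      0 < d /\ (forall z, cube y d z -> cube x e z /\ ~ U (s ord0 ord0) z)).
    apply: definable_ext => s; rewrite /setK1 /mkset nowhere_denseP.
    split=> H x e e0; have [y [d]] := H x e e0.
      by case=> d0 Hd; exists y, d; split=> // z /Hd[].
    by case=> d0 H1 H2; exists y, d; split=> // z yz; split; [apply: H1|apply: H2].
  by definability.
- exists (- b - 1); apply: (@nowhere_denseS _ _ _ set0).
    move=> y [x [[Ex xb] _]]; have := Db _ i0 (ED _ Ex); rewrite ler_norml; lra.
  by rewrite /nowhere_dense closure0 interior0.
- move=> s t ts; apply: nowhere_denseS => y [x [[Ex xt] Xx]].
  by exists x; split=> //; split=> //; apply: le_trans ts.
move=> s; exists (c / 3) => [|H]; first lra.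
pose F x := E x /\ s - c / 3 < x ord0 i0 <= s + c / 3.
have ndF : nowhere_dense (fun y => exists x, F x /\ X x y).
  apply: IH; first exact: ltnW.
  - by rewrite /F; definability.
  - by move=> x [/ED].
  - move=> x y i [Ex xs] [Ey ys]; rewrite leq_eqVlt => /predU1P[ki|].
      by have -> : i = i0 by [apply: val_inj]; rewrite ltr_norml; lra.
    exact: Ec.
apply: nowhere_denseS (nowhere_denseU H ndF) => y [x [[Ex xs] Xx]].
have [xl|xl] := leP (x ord0 i0) (s - c / 3); first by left; exists x.
by right; exists x; split=> //; split=> //; rewrite xl.
Qed.

Hypothesis imin : i_minimal M.

Lemma interior_increasing_union n (C : K -> set 'rV[K]_n) :
  definable M (fun z : 'rV_(1 + n) => C (lsubmx z ord0 ord0) (rsubmx z)) ->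
  (forall s t, s <= t -> C s `<=` C t) -> (forall t, (C t)° = set0) ->
  (\bigcup_(t in [set: K]) C t)° = set0.
Proof.
move=> dC mono C0; apply: contrapT => /not_empty_interior[x [e e0 H]].
have [|y xy nC] := (iminimal_induction Kcomplete imin n).2 C dC mono _ x e e0.
  by move=> t; apply: (iminimal_nowhere_dense Kcomplete imin) => //; definability.
by have [t _ Ct] := H _ xy; apply: nC Ct.
Qed.

(** The family is pulled back to the discrete set [D]. For positive [s], [E s] keeps the points of
    [D] bounded by [s] and isolated at the scale of the inverse of [s]. The union over [E s] is
    nowhere dense, and these unions increase to the whole one. *)
Lemma interior_pseudo_enumerable_union p n (N : set 'rV[K]_p)
    (X : 'rV[K]_p -> set 'rV[K]_n) :
  at_most_pseudo_enumerable M N -> definable_family M N X ->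
  (forall t, N t -> (X t)° = set0) -> (\bigcup_(t in N) X t)° = set0.
Proof.
move=> [m [D [f [dD discD dF ->]]]] dX X0.
pose F d t := D d /\ t = f d.
pose G t y := (f @` D) t /\ X t y.
have {}dF : definable M (fun w : 'rV_(m + p) => F (lsubmx w) (rsubmx w)) := dF.
have {}dX : definable M (fun w : 'rV_(p + n) => G (lsubmx w) (rsubmx w)) := dX.
pose Y d y := exists t, F d t /\ G t y.
have dY : definable M (fun w : 'rV_(m + n) => Y (lsubmx w) (rsubmx w)).
  by rewrite /Y; definability.
have YE d : D d -> Y d = X (f d).
  move=> Dd; apply/predeqP => y; split=> [[t [[_ ->] []]]//|Xy].
  by exists (f d); split=> //; split=> //; exists d.
pose E s d := D d /\ ((forall i, `|d ord0 i| <= s) /\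
  forall d', D d' -> (forall i, s * `|d ord0 i - d' ord0 i| < 1) -> d = d').
have dE : definable M (fun w : 'rV_(1 + m) => E (lsubmx w ord0 ord0) (rsubmx w)).
  by rewrite /E; definability.
pose C s y := exists d, E s d /\ Y d y.
have C0 s : (C s)° = set0.
  apply: nowhere_dense_interior.
  have s1 : 0 < `|s| + 1 by rewrite ltr_wpDl.
  (* The separation is not the inverse of [s] itself, as [s] may be zero or negative; [|s| + 1] is
     positive and bounds [s]. *)
  apply: (@nowhere_dense_pseudofinite_union m n (E s) Y s (`|s| + 1)^-1) => //.
  - by definability.
  - by move=> d i [_ [H _]].
  - move=> d d' [Dd [_ Hd]] [Dd' _] dd'; apply: Hd => // i.
    have := dd' i; rewrite -[_^-1]mul1r ltr_pdivlMr //; apply: le_lt_trans.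
    by rewrite mulrC ler_wpM2l //; have := ler_norm s; lra.
  - move=> d [Dd _]; rewrite YE //; apply: (iminimal_nowhere_dense Kcomplete imin).
      by rewrite -YE //; definability.
    by apply: X0; exists d.
have U0 : (\bigcup_(s in [set: K]) C s)° = set0.
  apply: interior_increasing_union => //; first by rewrite /C; definability.
  move=> s t st y [d [[Dd [ds Hd]] Yd]]; exists d; split=> //; split=> //; split.
    by move=> i; apply: le_trans st.
  move=> d' Dd' H; apply: Hd => // i; apply: le_lt_trans (H i).
  by rewrite ler_wpM2r.
apply/seteqP; split=> //; rewrite -U0; apply: interiorS => y [_ [d Dd <-] Xy].
have [_ [V Vd VD]] := discD d Dd; move/nbhs_cubeP: Vd => [e e0 eV].
(* The first summand accounts for the isolation of [d], the second for its size. *)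
pose s := e^-1 + \sum_i `|d ord0 i|.
have s0 : 0 <= \sum_i `|d ord0 i| by apply: sumr_ge0 => i _.
exists s => //; exists d; split; last by rewrite YE.
split=> //; split=> [i|d' Dd' Hd'].
  rewrite /s (bigD1 i) //= addrCA lerDl addr_ge0 //.
    by rewrite invr_ge0 ltW.
  by apply: sumr_ge0 => j _.
suff : (V `&` D) d' by rewrite VD => ->.
split=> //; apply: eV => i; have := Hd' i.
rewrite -[ltRHS](mulVf (lt0r_neq0 e0)) => H.
have : e^-1 * `|d ord0 i - d' ord0 i| < e^-1 * e.
  by apply: le_lt_trans H; rewrite ler_wpM2r // /s lerDl.
by rewrite ltr_pM2l // invr_gt0.
Qed.

Lemma interior_finite_union (T : finType) n (X : T -> set 'rV[K]_n) :
  (forall t, definable M (X t)) -> (forall t, (X t)° = set0) ->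
  (fun x => exists t, X t x)° = set0.
Proof.
move=> dX X0; apply: nowhere_dense_interior.
suff H (s : seq T) : nowhere_dense (fun x => exists2 t, t \in s & X t x).
  by apply: nowhere_denseS (H (enum T)) => x [t Xt]; exists t; rewrite ?mem_enum.
elim: s => [|t s IH].
  apply: (@nowhere_denseS _ _ _ set0); first by move=> x [].
  by rewrite /nowhere_dense closure0 interior0.
have ndt := iminimal_nowhere_dense Kcomplete imin (dX t) (X0 t).
apply: nowhere_denseS (nowhere_denseU ndt IH) => x [u].
by rewrite in_cons => /predU1P[->|us]; [left|right; exists u].
Qed.

(** Project [A] to the coordinates listed by [s] and [t] together: over a cube in the former, the
    fibers of the projection have interior, so the projection has interior. *)
Lemma topdim_fibers n m p q (s : 'I_p -> 'I_n) (t : 'I_q -> 'I_m)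
    (A : set 'rV[K]_(n + m)) :
  injective s -> injective t -> definable M A ->
  (colsub s @` [set x | (colsub t @` fiber A x)° !=set0])° !=set0 ->
  ((p + q)%N%:Z%:E <= topdim A)%E.
Proof.
move=> sI tI dA [u /interior_cubeP[e e0 H]].
pose r k := match fintype.split k with
            | inl j => lshift m (s j) | inr j => rshift n (t j) end.
apply: (@topdim_ge_colsub _ _ _ r).
  move=> k l; rewrite /r; have [k' ->|k' ->] := split_ordP k;
    have [l' ->|l' ->] := split_ordP l; rewrite ?(unsplitK (inl _)) ?(unsplitK (inr _)).
  - by move/lshift_inj/sI ->.
  - by move/eqP; rewrite eq_lrshift.
  - by move/eqP; rewrite eq_rlshift.
  - by move/rshift_inj/tI ->.
apply: (iminimal_interior_fibers Kcomplete imin (definable_colsub r dA) e0).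
move=> z /H[x [y Hy] xz]; exists y; apply: interiorS Hy => w [v Av vw].
exists (row_mx x v) => //; apply/rowP => k; rewrite [LHS]mxE [RHS]mxE /r.
case: (fintype.split k) => j; rewrite ?row_mxEl ?row_mxEr.
  by rewrite -xz mxE.
by rewrite -vw mxE.
Qed.

Lemma definable_fiber_projection n m (J : {set 'I_m}) (A : set 'rV[K]_(n + m)) :
  definable M A -> definable M [set x | (coord_proj J @` fiber A x)° !=set0].
Proof.
move=> dA; pose P x y := exists v, A (row_mx x v) /\ coord_proj J v = y.
have dP : definable M (fun w : 'rV_(n + #|J|) => P (lsubmx w) (rsubmx w)).
  by rewrite /P; definability.
suff : definable M (fun x => exists y e, 0 < e /\ forall w, cube y e w -> P x w).
  apply: definable_ext => x; split=> [[y [e [e0 He]]]|[y /interior_cubeP[e e0 He]]].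
    exists y; apply/interior_cubeP; exists e => // w /He[v [Av <-]]; by exists v.
  by exists y, e; split=> // w /He[v Av <-]; exists v.
by definability.
Qed.

Lemma definable_topdim_fiber n m (d : nat) (A : set 'rV[K]_(n + m)) :
  definable M A -> definable M [set x | d%:Z%:E <= topdim (fiber A x)]%E.
Proof.
move=> dA; have dP := fun J => @definable_fiber_projection n m J A dA.
apply: definable_ext (definable_exists_fin (P := fun x (J : {set 'I_m}) =>
  (coord_proj J @` fiber A x)° !=set0 /\ (d <= #|J|)%N) _) => [x|J].
  by rewrite /mkset topdim_geP; split=> [[J []]|[J]]; exists J.
apply: definable_and; [exact: dP|exact: definable_Prop].
Qed.

(** The coordinates [J] on which a fiber projects with interior depend on [x]. There are finitely
    many [J], and a finite union of definable sets with empty interior has empty interior, so one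
    [J] serves for enough [x]. *)
Lemma topdim_fibers_union n m p (s : 'I_p -> 'I_n) (d : nat) (A : set 'rV[K]_(n + m)) :
  injective s -> definable M A ->
  (colsub s @` [set x | d%:Z%:E <= topdim (fiber A x)]%E)° !=set0 ->
  ((p + d)%N%:Z%:E <= topdim A)%E.
Proof.
move=> sI dA H.
pose C (J : {set 'I_m}) x := (d <= #|J|)%N /\ (coord_proj J @` fiber A x)° !=set0.
have dC J : definable M (C J).
  apply: definable_and; [exact: definable_Prop|exact: definable_fiber_projection].
have [J [dJ HJ]] : exists J : {set 'I_m}, (d <= #|J|)%N /\ (colsub s @` C J)° !=set0.
  apply: contrapT => nH; move: H; rewrite (_ : _° = set0); last first.
    have E0 J : (colsub s @` C J)° = set0.
      apply/eqP/negPn/negP => /set0P[y Hy]; apply: nH; exists J; split; last by exists y.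
      by have [_ [x [dJ _] _]] := interior_subset Hy.
    have := @interior_finite_union {set 'I_m} p (fun J => colsub s @` C J)
      (fun J => definable_colsub s (dC J)) E0.
    move=> E; apply/predeqP => y; rewrite -E; split; last by rewrite E.
    apply: interiorS => {}y [x /topdim_geP[J HJ dJ] <-].
    by exists J; exists x.
  by case.
apply: (@le_trans _ _ (p + #|J|)%N%:Z%:E); first by rewrite lee_fin lez_nat leq_add2l.
apply: (topdim_fibers sI (@enum_val_inj _ (mem J)) dA).
by case: HJ => y Hy; exists y; apply: interiorS Hy => w [x [_ ?] <-]; exists x.
Qed.

End PseudoEnumerable.


(** * Fibers and discontinuities *)

Section Fibers.
Variables (K : realFieldType) (M : expansion K).
Hypothesis Kcomplete : definably_complete M.
Hypothesis imin : i_minimal M.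

(** If bad points filled a cube, selection would give holes of radius [2 * d] in the fibers, centred
    within [d] of a constant [c]; over a smaller cube all fibers would miss the [d]-cube around [c].
    But a hole centre over [x'] lies in that cube and in the closure of [A], so [A] enters it over
    nearby points. *)
Lemma nowhere_dense_bad_fibers n m (A : set 'rV[K]_(n + m)) :
  definable M A -> nowhere_dense (bad_fibers A).
Proof.
move=> dA.
pose S x y d := closure A (row_mx x y) /\ forall w, cube y (2 * d) w -> ~ A (row_mx x w).
have dS : definable M (fun w : 'rV_(n + m + 1) =>
    S (lsubmx (lsubmx w)) (rsubmx (lsubmx w)) (rsubmx w ord0 ord0)).
  by rewrite /S; definability.
pose B x := exists y d, 0 < d /\ S x y d.
apply: (@nowhere_denseS _ _ _ B).
  move=> x [y [cy]]; rewrite closure_cubeP => /existsNP[e /not_implyP[e0 He]].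
  exists y, (e / 2); split; first lra; split=> // w yw Aw; apply: He.
  by exists w => //; apply: cubeW yw; lra.
apply: (iminimal_nowhere_dense Kcomplete imin); first by rewrite /B; definability.
apply: contrapT => /not_empty_interior[x [e e0 H]].
have [|x' [e' [c [d [e'0 _ d0 Hs]]]]] := iminimal_selection Kcomplete imin dS _ e0 H.
  move=> z y d d' d'd [cA Hd]; split=> // w yw; apply: Hd; apply: cubeW yw; lra.
have [y [cA _] cy] := Hs _ (cube_center x' e'0).
have [r r0 Hr] := cube_open cy.
have [|w Aw] := (closure_cubeP _ _).1 cA (Num.min e' r); first by rewrite lt_min e'0.
move: Aw; rewrite -[w]hsubmxK => Aw /cube_row_mx[xw yw].
have [|y' [_ Hy'] cy'] := Hs (lsubmx w); first by apply: cubeW xw; rewrite ge_min lexx.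
apply: (Hy' _ _ Aw); apply: (cube_trans (cube_sym cy') (e := d)); last lra.
by apply: Hr; apply: cubeW yw; rewrite ge_min lexx orbT.
Qed.

Lemma nowhere_dense_fiber_frontier n m (A : set 'rV[K]_(n + m)) : definable M A ->
  nowhere_dense [set x | fiber (frontier A) x <> frontier (fiber A x)].
Proof.
move=> /nowhere_dense_bad_fibers; apply: nowhere_denseS => x nE.
apply: contrapT => nB; apply: nE; apply/predeqP => y; split=> -[cA nA].
  by split=> //; apply: contrapT => nc; apply: nB; exists y.
split=> //; apply/closure_cubeP => e e0.
have [w Aw yw] := (closure_cubeP _ _).1 cA e e0.
by exists (row_mx x w) => //; apply/cube_row_mx; split=> //; apply: cube_center.
Qed.

(** Selection is applied to the value of [f] as a point of dimension one, together with an
    oscillation of at least [2 * d]. On some cube [f] is then within [d] of a constant, which leaves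
    less oscillation than that. *)
Lemma nowhere_dense_discontinuity n (f : 'rV[K]_n -> K) : dfun M f ->
  nowhere_dense [set x | exists d, 0 < d /\ forall r, 0 < r ->
    exists w, cube x r w /\ d <= `|f x - f w|].
Proof.
move=> df.
pose S x (y : 'rV[K]_1) d := y = (f x)%:M /\ forall r, 0 < r ->
    exists w, cube x r w /\ 2 * d <= `|f x - f w|.
have dS : definable M (fun w : 'rV_(n + 1 + 1) =>
    S (lsubmx (lsubmx w)) (rsubmx (lsubmx w)) (rsubmx w ord0 ord0)).
  by rewrite /S; definability.
apply: (iminimal_nowhere_dense Kcomplete imin); first by definability.
apply: contrapT => /not_empty_interior[x [e e0 H]].
have [||x' [e' [c [d [e'0 _ d0 Hs]]]]] :=
    @iminimal_selection _ _ Kcomplete imin n 1 S x e dS _ e0.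
- move=> z y d d' d'd [Ey Hd]; split=> // r /Hd[w [zw dw]]; exists w; split=> //.
  by apply: le_trans dw; rewrite ler_pM2l.
- move=> z /H[d [d0 Hd]]; exists (f z)%:M, (d / 2); split; first lra.
  by split=> // r /Hd[w [zw dw]]; exists w; split=> //; lra.
have [_ [-> Hx] /cube1 cx] := Hs _ (cube_center x' e'0).
have [w [xw dw]] := Hx e' e'0; have [_ [-> _] /cube1 cw] := Hs _ xw.
move: cx cw dw; rewrite !mxE !eqxx !mulr1n => cx cw; apply/negP; rewrite -ltNge.
have := ler_distD (c ord0 ord0) (f x') (f w); rewrite [`|f x' - c _ _|]distrC; lra.
Qed.

Lemma definable_fun_extend n (U : set 'rV[K]_n) (f : 'rV[K]_n -> K) :
  definable_fun M U (fun x => (f x)%:M : 'rV[K]_1) ->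
  exists2 g, dfun M g & forall x, U x -> g x = f x.
Proof.
move=> dUf; have [||g dg gP] := @definable_choice _ M n (fun x a => U x /\ a = f x).
- apply: definable_ext dUf => z; split=> -[Uz].
    by move/rowP/(_ ord0) => E; split=> //; rewrite E mxE eqxx mulr1n.
  by move=> E; split=> //; apply/rowP => i; rewrite (ord1 i) E mxE eqxx mulr1n.
- by move=> x a b [_ ->] [_ ->].
by exists g => // x Ux; have [] := gP x (ex_intro _ (f x) (conj Ux erefl)).
Qed.

Lemma nowhere_dense_discont n (U : set 'rV[K]_n) (f : 'rV[K]_n -> K) :
  definable_fun M U (fun x => (f x)%:M : 'rV[K]_1) -> nowhere_dense (discont U f).
Proof.
move=> /definable_fun_extend[g dg gf].
apply: nowhere_denseS (nowhere_dense_discontinuity dg) => x [Ux nf].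
apply: contrapT => H; apply: nf; apply/cvgrPdist_lt => d d0.
move/forallNP: H => /(_ d)/not_andP[//|/existsNP[r /not_implyP[r0 Hr]]].
rewrite near_withinE; apply/nbhs_cubeP; exists r => // w xw Uw.
rewrite ltNge; apply/negP => dw; apply: Hr; exists w; split=> //.
by rewrite !gf.
Qed.

End Fibers.

(** * Monotonicity *)

Section Monotonicity.
Variables (K : realFieldType) (M : expansion K).
Hypothesis Kcomplete : definably_complete M.

Definition continuous_point (f : K -> K) x := forall d, 0 < d ->
  exists r, 0 < r /\ forall y, `|x - y| < r -> `|f x - f y| < d.

(** Without a maximum, definable induction produces a value of [f] exceeding all values up to any
    given [x]; at [x = q] it would exceed itself. Past [s], the larger of the previous value and one
    exceeding [f s] serves. *)
Lemma continuous_max (f : K -> K) p q :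
  dfun M (fun x : 'rV_1 => f (x ord0 ord0)) -> p <= q ->
  (forall x, p <= x <= q -> continuous_point f x) ->
  exists2 m, p <= m <= q & forall y, p <= y <= q -> f y <= f m.
Proof.
move=> df pq cf; apply: contrapT => nmax.
have big y : p <= y <= q -> exists z, p <= z <= q /\ f y < f z.
  move=> pyq; apply: contrapT => H; apply: nmax; exists y => // z pzq.
  by rewrite leNgt; apply/negP => yz; apply: H; exists z.
pose T x := exists z, p <= z <= q /\ forall y, p <= y <= q -> y <= x -> f y < f z.
suff /(_ q)[z [pzq /(_ z pzq)]] : forall x, T x by case/andP: pzq => _ ->; rewrite ltxx => /(_ isT).
apply: (definable_induction Kcomplete).
- by rewrite /T; definability.
- by exists (p - 1), p; rewrite lexx pq; split=> // y; lra.
- move=> x y yx [z [pzq Hz]]; exists z; split=> // w pwq wy; apply: Hz => //.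
  exact: le_trans yx.
move=> s; have [psq|npsq] := boolP (p <= s <= q); last first.
  move: npsq; rewrite negb_and -!ltNge => /orP[sp|qs].
    exists ((p - s) / 2) => [|_]; first lra.
    by exists p; rewrite lexx pq; split=> // y; lra.
  exists (s - q) => [|[z [pzq Hz]]]; first lra.
  by exists z; split=> // y pyq _; apply: Hz => //; lra.
have [z [pzq sz]] := big s psq.
have [|r [r0 Hr]] := cf s psq (f z - f s); first by rewrite subr_gt0.
exists (r / 2) => [|[z' [pz'q Hz']]]; first lra.
have near y : s - r / 2 < y -> y <= s + r / 2 -> f y < f z.
  by move=> sy ys; have := Hr y; rewrite !ltr_norml; lra.
have [zz|/ltW zz] := leP (f z) (f z').
  exists z'; split=> // y pyq ys; have [ys'|ys'] := leP y (s - r / 2).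
    exact: Hz'.
  exact: lt_le_trans (near _ ys' ys) zz.
exists z; split=> // y pyq ys; have [ys'|ys'] := leP y (s - r / 2).
  exact: lt_le_trans (Hz' y pyq ys') zz.
exact: near.
Qed.

(** If [f s <= f x], the local maximum at [s] carries the bound past [s]. If [f s > f x], continuity
    already violates the bound shortly before [s], and the premise of the induction step is
    false. *)
Lemma local_max_le (f : K -> K) a b :
  dfun M (fun x : 'rV_1 => f (x ord0 ord0)) ->
  (forall x, a < x < b -> continuous_point f x) ->
  (forall x, a < x < b -> exists r, 0 < r /\ forall y, `|x - y| < r -> f y <= f x) ->
  forall x y, a < x -> x < y -> y < b -> f y <= f x.
Proof.
move=> df cf lm x y ax xy yb.
pose T s := forall z, x <= z -> z <= s -> z <= y -> f z <= f x.
suff /(_ y) : forall s, T s by apply=> //; exact: ltW.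
apply: (definable_induction Kcomplete).
- by rewrite /T; definability.
- by exists (x - 1) => z; lra.
- by move=> s t ts H z xz zt; apply: H => //; apply: le_trans ts.
move=> s; have [xsy|nxsy] := boolP (x <= s <= y); last first.
  move: nxsy; rewrite negb_and -!ltNge => /orP[sx|ys].
    by exists ((x - s) / 2) => [|_ z]; lra.
  by exists (s - y) => [|H z xz zs zy]; [lra|apply: H => //; lra].
have sab : a < s < b by lra.
have [fsx|fxs] := leP (f s) (f x).
  have [r [r0 Hr]] := lm s sab.
  exists (r / 2) => [|H z xz zs zy]; first lra.
  have [zs'|zs'] := leP z (s - r / 2); first exact: H.
  by apply: le_trans (Hr z _) fsx; rewrite ltr_norml; lra.
have xs : x < s.
  rewrite lt_neqAle; apply/andP; split; last lra.
  by apply/eqP => E; rewrite E ltxx in fxs.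
have [|q [q0 Hq]] := cf s sab (f s - f x); first by rewrite subr_gt0.
have m0 : 0 < Num.min q (s - x) by rewrite lt_min q0 subr_gt0.
have [mq mx] : Num.min q (s - x) <= q /\ Num.min q (s - x) <= s - x.
  by split; rewrite ge_min lexx ?orbT.
set m := Num.min _ _ in m0 mq mx.
exists (m / 2) => [|H]; first lra.
have : f (s - m / 2) <= f x by apply: H; lra.
have : `|f s - f (s - m / 2)| < f s - f x by apply: Hq; rewrite ltr_norml; lra.
by rewrite ltr_norml; lra.
Qed.

Lemma continuous_opp (f : K -> K) x :
  continuous_point f x -> continuous_point (fun y => - f y) x.
Proof.
move=> cf d /cf[r [r0 Hr]]; exists r; split=> // y /Hr.
by rewrite -opprD normrN.
Qed.

(** One inequality is [local_max_le]; the other is its instance for the reflected function. *)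
Lemma local_max_constant (f : K -> K) a b :
  dfun M (fun x : 'rV_1 => f (x ord0 ord0)) ->
  (forall x, a < x < b -> continuous_point f x) ->
  (forall x, a < x < b -> exists r, 0 < r /\ forall y, `|x - y| < r -> f y <= f x) ->
  forall x y, a < x < b -> a < y < b -> f x = f y.
Proof.
move=> df cf lm.
have lt x y : a < x -> x < y -> y < b -> f x = f y.
  move=> ax xy yb; apply/le_anti/andP; split; last exact: (local_max_le df cf lm).
  have := @local_max_le (fun x => f (- x)) (- b) (- a) _ _ _ (- y) (- x).
  rewrite !opprK; apply; rewrite ?ltrN2 //.
  - by definability.
  - move=> z zab d d0; have [|r [r0 Hr]] := cf (- z) _ d d0; first lra.
    exists r; split=> // w zw; apply: Hr.
    by rewrite -opprD normrN.
  - move=> z zab; have [|r [r0 Hr]] := lm (- z); first lra.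
    exists r; split=> // w zw; apply: Hr.
    by rewrite -opprD normrN.
move=> x y /andP[ax xb] /andP[ay yb].
by case: (ltgtP x y) => [xy|yx|->//]; [apply: lt|rewrite (lt y x)].
Qed.

(** If the middle value were at least both outer ones, the maximum over [[p, r]] would be attained
    at an interior point, at [q] if nowhere else, and would be a local maximum. *)
Lemma no_local_max_lt (f : K -> K) a b p q r :
  dfun M (fun x : 'rV_1 => f (x ord0 ord0)) ->
  (forall x, a < x < b -> continuous_point f x) ->
  (forall x, a < x < b -> ~ exists r, 0 < r /\ forall y, `|x - y| < r -> f y <= f x) ->
  a < p -> p < q -> q < r -> r < b -> f q < f p \/ f q < f r.
Proof.
move=> df cf nlm ap pq qr rb; apply: contrapT => /not_orP[/negP]; rewrite -leNgt => fpq.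
move=> /negP; rewrite -leNgt => frq.
have [||m pmr Hm] := @continuous_max f p r df; first lra.
  by move=> x pxr; apply: cf; lra.
have max m' : p < m' -> m' < r -> (forall y, p <= y <= r -> f y <= f m') -> False.
  move=> pm mr H; apply: (nlm m'); first lra.
  exists (Num.min (m' - p) (r - m')); split; first by rewrite lt_min !subr_gt0 pm mr.
  move=> y; rewrite lt_min !ltr_norml => my; apply: H.
  by case/andP: my => /andP[? ?] /andP[? ?]; lra.
have fqm : f m <= f q.
  have [pm|] := ltP p m; last by move=> mp; have -> : m = p by lra.
  have [mr|rm] := ltP m r; last by have -> : m = r by lra.
  by case: (max m pm mr).
by apply: (max q pq qr) => y /Hm fy; apply: le_trans fy fqm.
Qed.

Definition locally_at (R : K -> K -> Prop) x := exists r, 0 < r /\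
  forall y z, `|x - y| < r -> `|x - z| < r -> y < z -> R y z.

Hypothesis imin : i_minimal M.

Lemma iminimal_nowhere_denseK (X : K -> Prop) :
  definable M (setK1 X) -> (forall a b, a < b -> exists2 x, a < x < b & ~ X x) ->
  nowhere_dense (X : set K).
Proof.
move=> dX HX; apply: imin => //; apply/seteqP; split=> // x /nbhs_KP[e e0 H].
have [|y xy []] := HX (x - e) (x + e); first lra.
by apply: H; rewrite ltr_norml; lra.
Qed.

(** By i-minimality the points of local maximum either fill an interval, where [f] is constant, or
    leave out an interval; likewise for minima. Without local extrema the middle one of three values
    lies strictly between the others, so [f] is strictly monotone. *)
Lemma monotone_somewhere (f : K -> K) a b :
  dfun M (fun x : 'rV_1 => f (x ord0 ord0)) ->
  (forall x, a < x < b -> continuous_point f x) -> a < b ->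
  exists2 x, a < x < b & (locally_at (fun y z => f y = f z) x \/
    locally_at (fun y z => f y < f z) x) \/ locally_at (fun y z => f z < f y) x.
Proof.
move=> df cf ab.
pose Mx (g : K -> K) (x : K) := exists r : K, 0 < r /\
    forall y, `|x - y| < r -> g y <= g x.
have dMx g : dfun M (fun x : 'rV_1 => g (x ord0 ord0)) -> definable M (setK1 (Mx g)).
  by move=> dg; rewrite /Mx; definability.
have dfN : dfun M (fun x : 'rV_1 => - f (x ord0 ord0)) by definability.
have cN c d x : (a <= c /\ d <= b) -> c < x < d -> continuous_point (fun y => - f y) x.
  by move=> cd cxd; apply: continuous_opp; apply: cf; lra.
have lcst (g : K -> K) (c d : K) : dfun M (fun x : 'rV_1 => g (x ord0 ord0)) ->
    (forall x, c < x < d -> continuous_point g x) -> c < d ->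
    (forall x, c < x < d -> Mx g x) -> locally_at (fun y z => g y = g z) ((c + d) / 2).
  move=> dg cg cd H; exists ((d - c) / 2); split; first lra.
  move=> y z; rewrite !ltr_norml => yr zr _.
  by apply: (local_max_constant dg cg H); lra.
have shrink (g : K -> K) (c d : K) : dfun M (fun x : 'rV_1 => g (x ord0 ord0)) ->
    (forall x, c < x < d -> continuous_point g x) -> c < d ->
    (exists2 x, c < x < d & locally_at (fun y z => g y = g z) x) \/
    exists c' d', [/\ c <= c', c' < d', d' <= d & forall x, c' < x < d' -> ~ Mx g x].
  move=> dg cg cd; have [H|] := pselect (exists2 x, c < x < d & locally_at (fun y z => g y = g z) x).
    by left.
  move=> nH; right.
  have ndM : nowhere_dense (fun x => (c < x < d) /\ Mx g x).
    apply: iminimal_nowhere_denseK; first by definability.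
    move=> p q pq; apply: contrapT => H.
    have HM x : p < x < q -> (c < x < d) /\ Mx g x.
      by move=> pxq; apply: contrapT => nM; apply: H; exists x.
    have H1 : p < (p + q) / 2 < q by lra.
    apply: nH; exists ((p + q) / 2); first by case: (HM _ H1).
    by apply: lcst => // x /HM[cxd Mxx] //; apply: cg.
  have [c' [d' [cc' c'd' dd' H]]] := nowhere_dense_gap ndM cd.
  exists c', d'; split=> // x cxd Mxx; apply: (H x cxd); apply: subset_closure.
  by split=> //; lra.
have [[x abx H]|[c [d [ac cd db nMx]]]] := shrink f a b df cf ab.
  by exists x => //; left; left.
have [|[x cdx H]|[c' [d' [cc' cd' dd' nMn]]]] := shrink (fun y => - f y) c d dfN _ cd.
- by move=> x; apply: cN.
- exists x; first lra.
  left; left; case: H => r [r0 Hr]; exists r; split=> // y z yr zr yz.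
  by apply: oppr_inj; apply: Hr.
have between p q r : c' < p -> p < q -> q < r -> r < d' ->
    (f p < f q /\ f q < f r) \/ (f q < f p /\ f r < f q).
  move=> cp pq qr rd.
  have [||H1|H1] := @no_local_max_lt f c' d' p q r df _ _ cp pq qr rd.
  - by move=> x cx; apply: cf; lra.
  - by move=> x cx; apply: nMx; lra.
  - have [|H2|H2] := @no_local_max_lt (fun y => - f y) c' d' p q r dfN _ nMn cp pq qr rd.
    + by move=> x cx; apply: (cN c' d'); lra.
    + lra.
    + lra.
  - have [|H2|H2] := @no_local_max_lt (fun y => - f y) c' d' p q r dfN _ nMn cp pq qr rd.
    + by move=> x cx; apply: (cN c' d'); lra.
    + lra.
    + lra.
(* These points bound the ball around the midpoint on which monotonicity is claimed; comparing [f p]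
   with [f q] decides its direction. *)
pose p := c' + (d' - c') / 4; pose q := d' - (d' - c') / 4.
have [cp pq qd] : [/\ c' < p, p < q & q < d'] by rewrite /p /q; split; lra.
have mono (g : K -> K) : (forall u v w, c' < u -> u < v -> v < w -> w < d' ->
      (g u < g v /\ g v < g w) \/ (g v < g u /\ g w < g v)) ->
    g p < g q -> locally_at (fun y z => g y < g z) ((c' + d') / 2).
  move=> gb gpq; exists ((d' - c') / 4); split; first lra.
  move=> y z; rewrite !ltr_norml => yr zr yz.
  have py : p < y by rewrite /p; lra.
  have yq : y < q by rewrite /q; lra.
  have zq : z < q by rewrite /q; lra.
  have [[gpy _]|] := gb p y q cp py yq qd; last by lra.
  by have [[]//|[]] := gb p y z cp py yz (lt_trans zq qd); lra.
exists ((c' + d') / 2); first lra.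
have fpq : f p != f q.
  have pm : p < (p + q) / 2 by lra.
  have mq : (p + q) / 2 < q by lra.
  by apply/eqP => E; have := between _ _ _ cp pm mq qd; rewrite E; lra.
case: (ltgtP (f p) (f q)) fpq => // [lt|gt] _.
  by left; right; apply: mono.
right; suff [r [r0 Hr]] : locally_at (fun y z => - f y < - f z) ((c' + d') / 2).
  by exists r; split=> // y z yr zr yz; rewrite -ltrN2; apply: Hr.
apply: (mono (fun y => - f y)); last by rewrite ltrN2.
move=> u v w cu uv vw wd; have := between u v w cu uv vw wd; rewrite !ltrN2; tauto.
Qed.

Lemma open_KP (A : set K) : (forall x, A x ->
  exists2 r, 0 < r & forall y, `|x - y| < r -> A y) -> open A.
Proof. by move=> H; rewrite openE => x /H Ax; apply/nbhs_KP. Qed.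

Lemma open_setK1 (A : set K) : open A -> open (setK1 A).
Proof.
by rewrite !openE => oA; rewrite /= interior_setK1 => x; apply: oA.
Qed.

Lemma open_locally_at (R : K -> K -> Prop) : open (locally_at R : set K).
Proof.
apply: open_KP => x [r [r0 Hr]]; exists (r / 2) => [|y xy]; first lra.
exists (r / 2); split=> [|z w yz yw zw]; first lra.
by apply: Hr => //; move: xy yz yw; rewrite !ltr_norml; lra.
Qed.

Lemma locally_at_disjoint (R R' : K -> K -> Prop) x :
  (forall y z, R y z -> ~ R' y z) -> locally_at R x -> ~ locally_at R' x.
Proof.
move=> RR' [r [r0 Hr]] [r' [r'0 Hr']].
have m0 : 0 < Num.min r r' by rewrite lt_min r0.
have [mr mr'] : Num.min r r' <= r /\ Num.min r r' <= r'.
  by rewrite !ge_min !lexx orbT.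
set m := Num.min _ _ in m0 mr mr'.
apply: (RR' x (x + m / 2)).
  by apply: Hr; rewrite ?ltr_norml; lra.
by apply: Hr'; rewrite ?ltr_norml; lra.
Qed.

(** Transitivity glues the relation known up to [s - r / 2] to the local relation around [s]. *)
Lemma locally_at_convex (R : K -> K -> Prop) (I : set K) x y :
  definable M (fun w : 'rV[K]_(1 + 1) => R (lsubmx w ord0 ord0) (rsubmx w ord0 ord0)) ->
  (forall u v w, R u v -> R v w -> R u w) ->
  (forall u v w, I u -> I v -> u <= w <= v -> I w) ->
  (forall u, I u -> locally_at R u) -> I x -> I y -> x < y -> R x y.
Proof.
move=> dR tR cI lR Ix Iy xy.
pose T s := forall z, x < z -> z <= s -> z <= y -> R x z.
suff /(_ y) : forall s, T s by apply.
apply: (definable_induction Kcomplete).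
- by rewrite /T; definability.
- by exists (x - 1) => z; lra.
- by move=> s t ts H z xz zt; apply: H => //; apply: le_trans ts.
move=> s; have [xsy|] := boolP (x <= s <= y); last first.
  rewrite negb_and -!ltNge => /orP[sx|ys].
    by exists ((x - s) / 2) => [|_ z]; lra.
  by exists (s - y) => [|H z xz zs zy]; [lra|apply: H => //; lra].
have [r [r0 Hr]] := lR s (cI _ _ _ Ix Iy xsy).
exists (r / 2) => [|H z xz zs zy]; first lra.
have [zs'|zs'] := leP z (s - r / 2); first exact: H.
have [sx|xs] := leP (s - r / 2) x.
  by apply: Hr => //; rewrite ltr_norml; lra.
apply: (tR _ (s - r / 2)); first by apply: H; lra.
by apply: Hr => //; rewrite ltr_norml; lra.
Qed.

Lemma definably_connected_subset (I A B : set K) :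
  definably_connected M (setK1 I) -> definable M (setK1 A) -> open A -> open B ->
  (forall x, A x -> ~ B x) -> (forall x, I x -> A x \/ B x) ->
  (exists x, I x /\ A x) -> forall x, I x -> A x.
Proof.
move=> [dI cI] dA oA oB AB IAB [x0 [Ix0 Ax0]] x Ix.
suff E : setK1 (I `&` A) = setK1 I.
  have : setK1 I x%:M by rewrite /setK1 /mkset mxE.
  by rewrite -E /setK1 /mkset mxE => -[].
apply: cI.
- by definability.
- by exists x0%:M; rewrite /setK1 /mkset mxE.
- by exists (setK1 A) => //; apply: open_setK1.
- exists (~` setK1 B); first by apply: open_closedC; apply: open_setK1.
  apply/predeqP => z; split=> -[Iz Hz]; split=> //; first exact: AB.
  by case: (IAB _ Iz).
Qed.

Lemma definably_connected_convex (I : set K) : definably_connected M (setK1 I) ->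
  forall u v w, I u -> I v -> u <= w <= v -> I w.
Proof.
move=> cI u v w Iu Iv uwv; apply: contrapT => nIw.
have /(_ v Iv) /= : forall x, I x -> x < w.
  apply: (@definably_connected_subset I [set x | x < w] [set x | w < x]) => //.
  - by definability.
  - by move=> x /= xw; apply/negP; rewrite -leNgt ltW.
  - move=> x Ix /=; case: (ltgtP x w) => [||E]; [by left|by right|].
    by rewrite E in Ix.
  - exists u; split=> //=; rewrite lt_neqAle; apply/andP; split; last by case/andP: uwv.
    by apply/eqP => E; rewrite E in Iu.
by case/andP: uwv => _ wv vw; move: (lt_le_trans vw wv); rewrite ltxx.
Qed.

(** [G] collects the points near which the function is continuous and of one of the three monotone
    types; [D] is the rest of the closure of [U]. The types form disjoint open sets, so a definably
    connected part of [G] has a single type, which extends from local to global by convexity. *)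
Lemma piecewise_monotone (U : set K) (f : K -> K) :
  open U -> definable M (setK1 U) ->
  definable_fun M (setK1 U) (fun x : 'rV[K]_1 => (f (x ord0 ord0))%:M : 'rV[K]_1) ->
  exists D : set K, [/\ definable M (setK1 D), closed D, D° = set0
    & forall I : set K,
      definably_connected_component M (setK1 (U `\` D)) (setK1 I) ->
      {within I, continuous f} /\
      ((exists c : K, forall x, I x -> f x = c) \/ strictly_monotone_on I f)].
Proof.
move=> oU dU /(@definable_fun_extend _ M 1 (setK1 U) (fun x => f (x ord0 ord0)))[g dg gf].
pose h a := g (a%:M).
have dh : dfun M (fun x : 'rV_1 => h (x ord0 ord0)).
  by apply: definable_ext dg => z; rewrite /h -mx11_scalar.
have hf a : U a -> h a = f a.
  by move=> Ua; rewrite /h gf /setK1 /mkset mxE.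
pose Ct : set K := continuous_point h.
have dCt : definable M (setK1 Ct) by rewrite /Ct /continuous_point; definability.
have ndC : nowhere_dense (~` Ct).
  apply/nowhere_dense_setK1.
  apply: nowhere_denseS (nowhere_dense_discontinuity Kcomplete imin dh) => x nC.
  apply: contrapT => H; apply: nC => d d0.
  move/forallNP: H => /(_ d)/not_andP[//|/existsNP[r /not_implyP[r0 Hr]]].
  exists r; split=> // y xy; rewrite ltNge; apply/negP => dy; apply: Hr.
  by exists y%:M; split; [apply/cube1; rewrite mxE|rewrite mxE].
pose R1 y z := h y = h z; pose R2 y z := h y < h z; pose R3 y z := h z < h y.
pose L R : set K := locally_at R.
have dL R : definable M (fun w : 'rV[K]_(1 + 1) =>
    R (lsubmx w ord0 ord0) (rsubmx w ord0 ord0)) -> definable M (setK1 (L R)).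
  by move=> dR; rewrite /L /locally_at; definability.
have dR1 : definable M (fun w : 'rV[K]_(1 + 1) =>
  R1 (lsubmx w ord0 ord0) (rsubmx w ord0 ord0)) by rewrite /R1; definability.
have dR2 : definable M (fun w : 'rV[K]_(1 + 1) =>
  R2 (lsubmx w ord0 ord0) (rsubmx w ord0 ord0)) by rewrite /R2; definability.
have dR3 : definable M (fun w : 'rV[K]_(1 + 1) =>
  R3 (lsubmx w ord0 ord0) (rsubmx w ord0 ord0)) by rewrite /R3; definability.
pose G : set K := U `&` Ct° `&` ((L R1 `|` L R2) `|` L R3).
have dL1 := dL R1 dR1; have dL2 := dL R2 dR2; have dL3 := dL R3 dR3.
have dG : definable M (setK1 G) by rewrite /G; definability.
have oL R : open (L R) by apply: open_locally_at.
have oG : open G.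
  apply: openI; first by apply: openI => //; apply: open_interior.
  by apply: openU => //; apply: openU.
pose D := closure U `\` G.
have GE : U `\` D = G.
  apply/predeqP => x; split=> [[Ux nD]|Gx]; last by split=> [|[]//]; case: Gx => -[].
  by apply: contrapT => nG; apply: nD; split=> //; apply: subset_closure.
exists D; split.
- by rewrite /D; definability.
- by apply: closedI; [apply: closed_closure|apply: open_closedC].
- apply/seteqP; split=> // x /nbhs_KP[e e0 H].
  have [Ux _] : D x by apply: H; rewrite subrr normr0.
  have [y Uy xy] := (closure_KP _ _).1 Ux e e0.
  have : nbhs y U by apply: open_nbhs_nbhs; split.
  move/nbhs_KP => [r r0 Hr].
  pose m := Num.min r (e - `|x - y|).
  have m0 : 0 < m by rewrite lt_min r0 subr_gt0.
  have mr : m <= r by rewrite ge_min lexx.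
  have mx : m <= e - `|x - y| by rewrite ge_min lexx orbT.
  (* Discontinuities are nowhere dense, so an interval of continuity points lies near [y]; a point
     of local monotonicity in it belongs to [G] and yet to [D]. *)
  have [|a [b [ya ab by_ nC]]] := @nowhere_dense_gap _ _ (y - m) (y + m) ndC; first lra.
  have Cab z : a < z < b -> Ct z.
    by move=> /nC nz; apply: contrapT => nCz; apply: nz; apply: subset_closure.
  have [z azb Lz] := monotone_somewhere dh Cab ab.
  have yz : `|y - z| < m by rewrite ltr_norml; lra.
  have [_ []] : D z.
    by apply: H; apply: le_lt_trans (ler_distD y _ _) _; lra.
  split; last exact: Lz.
  split; first by apply: Hr; apply: lt_le_trans mr.
  apply/nbhs_KP; exists (Num.min (z - a) (b - z)).
    by rewrite lt_min !subr_gt0.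
  move=> w; rewrite lt_min !ltr_norml => /andP[/andP[? ?] /andP[? ?]].
  by apply: Cab; lra.
- move=> I [[x0 Ix0] IG cI _].
  have {}IG x : I x -> G x.
    by move=> Ix; have := IG x%:M; rewrite GE /setK1 /mkset mxE; apply.
  have IU x : I x -> U x by move=> /IG[[]].
  have conv := definably_connected_convex cI.
  split.
    apply: continuous_in_subspaceT => x /set_mem Ix.
    have [[Ux /nbhs_singleton cx] _] := IG x Ix.
    apply/cvgrPdist_lt => d /cx[r [r0 Hr]].
    have : nbhs x U by apply: open_nbhs_nbhs; split.
    move/nbhs_KP => [q q0 Hq]; apply/nbhs_KP; exists (Num.min r q).
      by rewrite lt_min r0.
    move=> y; rewrite lt_min => /andP[xr xq].
    by rewrite -!hf //; [apply: Hr|apply: Hq].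
  have d12 y z : R1 y z -> ~ R2 y z by rewrite /R1 /R2 => ->; rewrite ltxx.
  have d13 y z : R1 y z -> ~ R3 y z by rewrite /R1 /R3 => ->; rewrite ltxx.
  have d23 y z : R2 y z -> ~ R3 y z.
    by rewrite /R2 /R3 => yz; apply/negP; rewrite -leNgt ltW.
  pose x1 : K := (x0 ord0 ord0).
  have [[_ _] [[L1|L2]|L3]] := IG x1 Ix0.
  + have IL : forall x, I x -> L R1 x.
      apply: (definably_connected_subset (B := L R2 `|` L R3) cI) => //.
      * exact: openU.
      * by move=> x L1x []; apply: locally_at_disjoint L1x.
      * by move=> x /IG[_ [[?|?]|?]]; [left|right; left|right; right].
      * by exists x1.
    have R1I x y : I x -> I y -> x < y -> R1 x y.
      by apply: (@locally_at_convex R1 I _ _ dR1 _ conv IL) => u v w; rewrite /R1 => ->.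
    left; exists (h x1) => x Ix; rewrite -hf; last exact: IU.
    case: (ltgtP x x1) => [lt|gt|-> //]; first exact: R1I.
    by apply/esym; apply: R1I.
  + have IL : forall x, I x -> L R2 x.
      apply: (definably_connected_subset (B := L R1 `|` L R3) cI) => //.
      * exact: openU.
      * move=> x L2x [L1x|]; last exact: locally_at_disjoint L2x.
        exact: (locally_at_disjoint d12 L1x L2x).
      * by move=> x /IG[_ [[?|?]|?]]; [right; left|left|right; right].
      * by exists x1.
    right; left=> x y Ix Iy; rewrite -!hf; [|exact: IU|exact: IU].
    by apply: (@locally_at_convex R2 I _ _ dR2 _ conv IL) => // u v w; apply: lt_trans.
  + have IL : forall x, I x -> L R3 x.
      apply: (definably_connected_subset (B := L R1 `|` L R2) cI) => //.
      * exact: openU.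
      * move=> x L3x [L1x|L2x].
          exact: (locally_at_disjoint d13 L1x L3x).
        exact: (locally_at_disjoint d23 L2x L3x).
      * by move=> x /IG[_ [[?|?]|?]]; [right; left|right; right|left].
      * by exists x1.
    right; right=> x y Ix Iy; rewrite -!hf; [|exact: IU|exact: IU].
    apply: (@locally_at_convex R3 I _ _ dR3 _ conv IL) => // u v w vu wv.
    exact: lt_trans wv vu.
Qed.

End Monotonicity.


(** * Conditions implying i-minimality *)

Section LineDimension.
Variable K : realFieldType.

Lemma colsub_id n (X : set 'rV[K]_n) : colsub (@id 'I_n) @` X = X.
Proof.
have E (x : 'rV[K]_n) : colsub id x = x by apply/rowP => i; rewrite mxE.
by apply/predeqP => x; split=> [[y Xy <-]|Xx]; [rewrite E|exists x].
Qed.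

Lemma topdim_setK1_ge1 (X : set K) :
  (1%N%:Z%:E <= topdim (setK1 X))%E <-> X° !=set0.
Proof.
split=> [/topdim_geP[I [y /interior_cubeP[e e0 H]] I1]|[x Xx]]; last first.
  apply: (@topdim_ge_colsub _ _ _ (@id 'I_1)) => //; rewrite colsub_id interior_setK1.
  by exists x%:M; rewrite /setK1 /mkset mxE.
pose j0 : 'I_#|I| := Ordinal I1.
have jE j : j = j0.
  by apply: enum_val_inj; rewrite (ord1 (enum_val j)) (ord1 (enum_val j0)).
exists (y ord0 j0); apply/nbhs_KP; exists e => // t yt.
have [|x Xx E] := H (const_mx t); first by move=> j; rewrite (jE j) mxE.
have /rowP/(_ j0) := E; rewrite !mxE (ord1 (enum_val j0)) => <-.
exact: Xx.
Qed.

Lemma topdim_setK1_le0 (X : set K) : (topdim (setK1 X) <= 0%N%:Z%:E)%E <-> X° = set0.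
Proof.
split=> [X0|X0].
  by apply: contrapT => /eqP/set0P/topdim_setK1_ge1 H; have := le_trans H X0; rewrite lee_fin.
apply/topdim_leP => I XI; rewrite lee_fin lez_nat leqNgt; apply/negP => I0.
by have : X° !=set0; [apply/topdim_setK1_ge1/topdim_geP; exists I|rewrite X0 => -[]].
Qed.

End LineDimension.

Section Sufficiency.
Variables (K : realFieldType) (M : expansion K).

Lemma i_minimal_of_intervals :
  (forall (X : set K) a b, definable M (setK1 X) -> X° = set0 -> a < b ->
    (forall x, a < x < b -> closure X x) -> False) -> i_minimal M.
Proof.
move=> H X dX X0; apply/seteqP; split=> // x /nbhs_KP[e e0 He].
apply: (H X (x - e) (x + e) dX X0); first lra.
by move=> y xy; apply: He; rewrite ltr_norml; lra.
Qed.

Lemma codense_complement (X : set K) a b : a < b -> (forall x, a < x < b -> closure X x) ->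
  [set x | a < x < b /\ ~ X x]° = set0.
Proof.
move=> ab cX; apply/seteqP; split=> // x /nbhs_KP[e e0 He].
have [axb _] : a < x < b /\ ~ X x by apply: He; rewrite subrr normr0.
have [y Xy xy] := (closure_KP _ _).1 (cX x axb) e e0.
by case: (He y xy).
Qed.

Lemma interval_interior (X : set K) a b : a < b -> (forall x, a < x < b -> X x) ->
  X° !=set0.
Proof.
move=> ab H; exists ((a + b) / 2); apply/nbhs_KP; exists ((b - a) / 2); first lra.
by move=> y; rewrite ltr_norml => xy; apply: H; lra.
Qed.

(** On an interval contained in the closure of [X], a gap of the frontier consists of points of
    [X]. *)
Lemma i_minimal_of_frontier :
  (forall X : set K, definable M (setK1 X) -> X° = set0 -> nowhere_dense (frontier X)) ->
  i_minimal M.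
Proof.
move=> H; apply: i_minimal_of_intervals => X a b dX X0 ab cX.
have [c [d [ac cd db nF]]] := nowhere_dense_gap (H X dX X0) ab.
suff : X° !=set0 by rewrite X0 => -[].
apply: (interval_interior cd) => x cxd; apply: contrapT => nX; apply: (nF x cxd).
by apply: subset_closure; split=> //; apply: cX; lra.
Qed.

Lemma i_minimal_of_topdim_setU :
  (forall A B : set K, definable M (setK1 A) -> definable M (setK1 B) ->
    topdim (setK1 (A `|` B)) = maxe (topdim (setK1 A)) (topdim (setK1 B))) ->
  i_minimal M.
Proof.
move=> H; apply: i_minimal_of_intervals => X a b dX X0 ab cX.
pose Y := [set x | a < x < b /\ ~ X x].
have dY : definable M (setK1 Y) by rewrite /Y; definability.
have /topdim_setK1_ge1 : (X `|` Y)° !=set0.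
  by apply: (interval_interior ab) => x axb; case: (pselect (X x)); [left|right].
rewrite H // => H1.
have : (maxe (topdim (setK1 X)) (topdim (setK1 Y)) <= 0%N%:Z%:E)%E.
  rewrite ge_max; apply/andP; split; apply/topdim_setK1_le0 => //.
  exact: codense_complement.
by move/(le_trans H1); rewrite lee_fin.
Qed.

(** The characteristic function of a set with empty interior is discontinuous at every point of the
    set. *)
Lemma i_minimal_of_discont :
  (forall f : 'rV[K]_1 -> K,
    definable_fun M setT (fun x => (f x)%:M : 'rV[K]_1) ->
    nowhere_dense (discont setT f)) -> i_minimal M.
Proof.
move=> H X dX X0; apply/nowhere_dense_setK1.
pose f (x : 'rV[K]_1) : K := if pselect (X (x ord0 ord0)) then 1 else 0.
apply: nowhere_denseS (H f _); last first.
  suff : definable M (fun z : 'rV_(1 + 1) =>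
      (X (lsubmx z ord0 ord0) /\ rsubmx z = 1%:M) \/
      (~ X (lsubmx z ord0 ord0) /\ rsubmx z = 0%:M)).
    apply: definable_ext => z; rewrite /f /mkset; case: pselect => h /=; split.
    - by case=> [[_ ->]|[]].
    - by case=> _ ->; left.
    - by case=> [[]|[_ ->]].
    - by case=> _ ->; right.
  by definability.
move=> x Xx; split=> // cf; have h : 0 < 1 / 2 :> K by lra.
have [e e0 He] : exists2 e, 0 < e & cube x e `<=` [set t | `|f x - f t| < 1 / 2].
  apply/nbhs_cubeP; move: cf; rewrite cvgrPdist_lt => /(_ _ h).
  by rewrite near_withinE; apply: filterS => t; apply.
have /interior_eq0P/(_ x e e0)[y xy nXy] : (setK1 X)° = set0.
  by rewrite interior_setK1 X0.
have f1 : f x = 1 by rewrite /f; case: pselect.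
have f0 : f y = 0 by rewrite /f; case: pselect.
by have := He y xy; rewrite /mkset f1 f0 subr0 normr1; lra.
Qed.

(** * Planar sets over a subset of the line *)

Section Axis.
Variable X : set K.
Hypothesis dX : definable M (setK1 X).

(** Over a frontier point of [X] the fiber of this set is empty, whereas the fiber of its closure
    contains 0. *)
Definition axis_copy : set 'rV[K]_(1 + 1) :=
  [set z | X (lsubmx z ord0 ord0) /\ rsubmx z ord0 ord0 = 0].

Lemma definable_axis_copy : definable M axis_copy.
Proof. by rewrite /axis_copy; definability. Qed.

Lemma axis_copy_fiber (x : 'rV[K]_1) : ~ X (x ord0 ord0) -> fiber axis_copy x = set0.
Proof.
move=> nX; apply/seteqP; split=> // y; rewrite /fiber /axis_copy /mkset row_mxKl.
by case.
Qed.

Lemma axis_copy_closure (x : 'rV[K]_1) : closure X (x ord0 ord0) ->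
  closure axis_copy (row_mx x 0).
Proof.
move=> cX; apply/closure_cubeP => e e0; have [y Xy xy] := (closure_KP _ _).1 cX e e0.
exists (row_mx y%:M 0); first by rewrite /axis_copy /mkset row_mxKl row_mxKr !mxE.
by apply/cube_row_mx; split; [apply/cube1; rewrite mxE|apply: cube_center].
Qed.

Lemma bad_fibers_axis_copy : setK1 (frontier X) `<=` bad_fibers axis_copy.
Proof.
move=> x [cX nX]; exists 0; split; first exact: axis_copy_closure.
by rewrite axis_copy_fiber // closure0.
Qed.

Lemma fiber_frontier_axis_copy (x : 'rV[K]_1) : setK1 (frontier X) x ->
  fiber (frontier axis_copy) x <> frontier (fiber axis_copy x).
Proof.
move=> [cX nX] /predeqP/(_ 0).
rewrite axis_copy_fiber // /frontier closure0 => -[H _].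
suff [] : (set0 `\` set0) (0 : 'rV[K]_1) by [].
apply: H; split; first exact: axis_copy_closure.
by rewrite /axis_copy /mkset row_mxKl => -[].
Qed.

End Axis.


Lemma topdim_row1_ge1 (F : set 'rV[K]_1) p q : p < q ->
  (forall y : 'rV[K]_1, p < y ord0 ord0 < q -> F y) -> (1%N%:Z%:E <= topdim F)%E.
Proof.
move=> pq HF; rewrite -[F]setK1_scalar; apply/topdim_setK1_ge1.
by apply: (interval_interior pq) => x pxq; apply: HF; rewrite mxE eqxx.
Qed.

(** [A] is the product of [X] and an interval. It has dimension exactly 1, since no projection with
    interior can use the first coordinate, and all its fibers over [X] have dimension 1. *)
Lemma i_minimal_of_strip :
  (forall A : set 'rV[K]_(1 + 1), definable M A -> topdim A = 1%N%:Z%:E ->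
    nowhere_dense [set x : 'rV[K]_1 | (0%:E < topdim (fiber A x))%E]) ->
  i_minimal M.
Proof.
(* The empty set is treated apart: for it [A] would have dimension -oo instead of 1. *)
move=> H X dX X0; have [->|/set0P[a Xa]] := eqVneq X set0.
  by rewrite /nowhere_dense closure0 interior0.
pose A : set 'rV[K]_(1 + 1) :=
  [set z | X (lsubmx z ord0 ord0) /\ 0 < rsubmx z ord0 ord0 < 1].
have dA : definable M A by rewrite /A; definability.
have A1 : topdim A = 1%N%:Z%:E.
  apply/le_anti/andP; split.
    apply/topdim_leP => I [y /interior_cubeP[e e0 Hy]].
    have nI : lshift 1 ord0 \notin I.
      apply/negP => lI; pose k := enum_rank_in lI (lshift 1 ord0).
      have kE : enum_val k = lshift 1 ord0 by rewrite enum_rankK_in.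
      suff : X° !=set0 by rewrite X0 => -[].
      exists (y ord0 k); apply/nbhs_KP; exists e => // t yt.
      have [|x [Xx _] /rowP/(_ k)] := Hy (\row_j if j == k then t else y ord0 j).
        by move=> j; rewrite mxE; case: eqVneq => [->//|_]; rewrite subrr normr0.
      by rewrite !mxE eqxx kE => <-; move: Xx; rewrite mxE.
    have : I \subset [set rshift 1 ord0]%SET.
      apply/fintype.subsetP => i iI; rewrite inE; have [k E|k E] := split_ordP i.
        have Ei : i = lshift 1 ord0 by rewrite E (ord1 k).
        by rewrite -Ei iI in nI.
      by rewrite E (ord1 k).
    by move/subset_leq_card; rewrite cards1 lee_fin lez_nat.
  apply: (@topdim_ge_colsub _ _ _ (@rshift 1 1)); first exact: rshift_inj.
  exists (1 / 2)%:M; apply/interior_cubeP; exists (1 / 2) => [|y /cube1]; first lra.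
  rewrite mxE eqxx mulr1n ltr_norml => hy; exists (row_mx a%:M y).
    by rewrite /A /mkset row_mxKl row_mxKr mxE eqxx mulr1n; split=> //; lra.
  by apply/rowP => i; rewrite mxE row_mxEr.
apply/nowhere_dense_setK1; apply: nowhere_denseS (H A dA A1) => x Xx.
apply: (@lt_le_trans _ _ 1%N%:Z%:E); first by rewrite lte_fin.
apply: (@topdim_row1_ge1 _ 0 1) => // y y01.
by rewrite /fiber /A /mkset row_mxKl row_mxKr.
Qed.

(** The conclusion of the premise only denies interior, which [X] lacks anyway; so a second strip
    over the complement is added, and the fibers have dimension 1 over a whole interval. The heights
    have opposite signs, so a horizontal line meets at most one strip, over a set with empty
    interior, and [A] has no interior. *)
Lemma i_minimal_of_two_strips :
  (forall A : set 'rV[K]_(1 + 1), definable M A -> (topdim A <= 1%N%:Z%:E)%E ->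
    (topdim [set x : 'rV[K]_1 | 1%N%:Z%:E <= topdim (fiber A x)]%E <= 0%N%:Z%:E)%E) ->
  i_minimal M.
Proof.
move=> H; apply: i_minimal_of_intervals => X a b dX X0 ab cX.
pose A : set 'rV[K]_(1 + 1) := [set z | a < lsubmx z ord0 ord0 < b /\
  ((X (lsubmx z ord0 ord0) /\ 0 < rsubmx z ord0 ord0 < 1) \/
   (~ X (lsubmx z ord0 ord0) /\ -1 < rsubmx z ord0 ord0 < 0))].
have dA : definable M A by rewrite /A; definability.
have A1 : (topdim A <= 1%N%:Z%:E)%E.
  apply/topdim_leP => I [y /interior_cubeP[e e0 Hy]].
  rewrite lee_fin lez_nat leqNgt; apply/negP => I2.
  have IT : I = [set: 'I_(1 + 1)]%SET.
    by apply/eqP; rewrite eqEcard finset.subsetT cardsT card_ord.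
  have lI : lshift 1 ord0 \in I by rewrite IT inE.
  have rI : rshift 1 ord0 \in I by rewrite IT inE.
  pose k := enum_rank_in lI (lshift 1 ord0); pose l := enum_rank_in rI (rshift 1 ord0).
  have kE : enum_val k = lshift 1 ord0 by rewrite enum_rankK_in.
  have lE : enum_val l = rshift 1 ord0 by rewrite enum_rankK_in.
  have lk : (l == k) = false.
    by apply/eqP => /(congr1 enum_val); rewrite kE lE => /eqP; rewrite eq_rlshift.
  have [s s0 ys] : exists2 s : K, s != 0 & `|y ord0 l - s| < e.
    have [E|] := eqVneq (y ord0 l) 0; last by exists (y ord0 l); rewrite // subrr normr0.
    by exists (e / 2); [rewrite gt_eqF //; lra|rewrite E ltr_norml; lra].
  have Hs t : `|y ord0 k - t| < e -> exists x, [/\ A x, lsubmx x ord0 ord0 = t &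
      rsubmx x ord0 ord0 = s].
    move=> yt; have [|x Ax /rowP E] :=
        Hy (\row_j if j == k then t else if j == l then s else y ord0 j).
      move=> j; rewrite mxE; case: eqVneq => [->//|_]; case: eqVneq => [->//|_].
      by rewrite subrr normr0.
    exists x; split=> //.
      by have := E k; rewrite !mxE eqxx kE.
    by have := E l; rewrite !mxE eqxx lk lE.
  case: (ltgtP s 0) s0 => // [sn|sp] _.
    have [|x [[axb _] xE _]] := Hs (y ord0 k); first by rewrite subrr normr0.
    rewrite xE in axb; have [t Xt yt] := (closure_KP _ _).1 (cX _ axb) e e0.
    have [z [[_ [[_ z1]|[nXz _]]] z0 zs]] := Hs t yt; last by rewrite z0 in nXz.
    by case/andP: z1 => z1 _; rewrite zs ltNge ltW in z1.
  suff : X° !=set0 by rewrite X0 => -[].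
  exists (y ord0 k); apply/nbhs_KP; exists e => // t yt.
  have [z [[_ [[Xz _]|[_ z1]]] z0 zs]] := Hs t yt; first by rewrite z0 in Xz.
  by case/andP: z1 => _ z1; rewrite zs ltNge ltW in z1.
have : (1%N%:Z%:E <= topdim [set x : 'rV[K]_1 | 1%N%:Z%:E <= topdim (fiber A x)]%E)%E.
  apply: (topdim_row1_ge1 ab) => x axb; rewrite /mkset.
  have [Xx|nX] := pselect (X (x ord0 ord0)).
    apply: (@topdim_row1_ge1 _ 0 1) => // y y01.
    by rewrite /fiber /A /mkset row_mxKl row_mxKr; split=> //; left.
  apply: (@topdim_row1_ge1 _ (-1) 0) => [|y y01]; first lra.
  by rewrite /fiber /A /mkset row_mxKl row_mxKr; split=> //; right.
by move=> /le_trans/(_ (H A dA A1)); rewrite lee_fin.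
Qed.

(** Two indices suffice, 0 for [X] and 1 for its complement in the interval. *)
Lemma i_minimal_of_pseudo_enumerable_union :
  (forall (N : set 'rV[K]_1) (X : 'rV[K]_1 -> set K),
    at_most_pseudo_enumerable M N ->
    definable_family M N (fun t => setK1 (X t)) ->
    (forall t, N t -> (X t)° = set0) -> (\bigcup_(t in N) X t)° = set0) ->
  i_minimal M.
Proof.
move=> H; apply: i_minimal_of_intervals => X a b dX X0 ab cX.
pose N : set 'rV[K]_1 := [set t | t ord0 ord0 = 0 \/ t ord0 ord0 = 1].
pose Y (t : 'rV[K]_1) := [set x | (t ord0 ord0 = 0 /\ X x) \/
  (t ord0 ord0 = 1 /\ (a < x < b /\ ~ X x))].
have dN : definable M N by rewrite /N; definability.
have : (\bigcup_(t in N) Y t)° !=set0.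
  apply: (interval_interior ab) => x axb; have [Xx|nX] := pselect (X x).
    by exists 0%:M; rewrite /N /Y /mkset mxE eqxx mulr1n; [left|left].
  by exists 1%:M; rewrite /N /Y /mkset mxE eqxx mulr1n; right.
rewrite H; first by case.
- exists 1%N, N, id; split=> //; last by rewrite image_id.
    move=> t Nt; split; first exact: mem_set.
    exists (cube t 1); first by apply/nbhs_cubeP; exists 1.
    apply/predeqP => z; split=> [[/cube1 tz Nz]|->]; last by split=> //; apply: cube_center.
    suff E : z ord0 ord0 = t ord0 ord0 by apply/rowP => i; rewrite (ord1 i).
    move: tz; case: Nt => ->; case: Nz => -> //.
      by rewrite sub0r normrN normr1 ltxx.
    by rewrite subr0 normr1 ltxx.
  by rewrite /definable_fun; definability.
- by rewrite /definable_family /N /Y; definability.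
- move=> t [t0|t1].
    rewrite (_ : Y t = X) //; apply/predeqP => x; rewrite /Y /mkset t0.
    split=> [[[]//|[/esym/eqP]]|]; last by left.
    by rewrite oner_eq0.
  rewrite (_ : Y t = [set x | a < x < b /\ ~ X x]); first exact: codense_complement.
  apply/predeqP => x; rewrite /Y /mkset t1.
  split=> [[[/eqP]|[]//]|]; last by right.
  by rewrite oner_eq0.
Qed.

Hypothesis Kcomplete : definably_complete M.

(** Otherwise [X] and its complement in the interval are both meager, and the union of the two
    families covers the interval, against Baire on the line. *)
Lemma i_minimal_of_meager :
  (forall X : set K, definable M (setK1 X) -> X° !=set0 \/ meager M (setK1 X)) ->
  i_minimal M.
Proof.
move=> H; apply: i_minimal_of_intervals => X a b dX X0 ab cX.
pose Y := [set x | a < x < b /\ ~ X x].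
have dY : definable M (setK1 Y) by rewrite /Y; definability.
have [|[_ [C [[dC monoC] ndC XC]]]] := H X dX; first by rewrite X0 => -[].
have [|[_ [D [[dD monoD] ndD YD]]]] := H Y dY.
  by rewrite codense_complement // => -[].
have {}dC : definable M (fun z : 'rV[K]_(1 + 1) => C (lsubmx z ord0 ord0) (rsubmx z)).
  by apply: definable_ext dC => z; split=> [[]|].
have {}dD : definable M (fun z : 'rV[K]_(1 + 1) => D (lsubmx z ord0 ord0) (rsubmx z)).
  by apply: definable_ext dD => z; split=> [[]|].
have [|||x axb nCD] := @baire_line _ _ Kcomplete
  (fun t => [set x | C t x%:M \/ D t x%:M]) a b _ _ _ ab.
- by definability.
- by move=> s t st x [Cx|Dx]; [left; apply: monoC Cx|right; apply: monoD Dx].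
- move=> t; apply/nowhere_dense_setK1; apply: nowhere_denseS (nowhere_denseU (ndC t) (ndD t)).
  by move=> x; rewrite /setK1 /mkset -mx11_scalar.
have [Xx|nX] := pselect (X x).
  have [|t _ Ct] := XC x%:M; first by rewrite /setK1 /mkset mxE.
  by apply: (nCD t); left.
have [|t _ Dt] := YD x%:M; first by rewrite /setK1 /Y /mkset mxE eqxx mulr1n.
by apply: (nCD t); right.
Qed.

End Sufficiency.


(** * Conditions implied by i-minimality *)

Section Necessity.
Variables (K : realFieldType) (M : expansion K).
Hypothesis Kcomplete : definably_complete M.
Hypothesis imin : i_minimal M.

Let nd n (X : set 'rV[K]_n) := @iminimal_nowhere_dense K M Kcomplete imin n X.

Lemma nowhere_dense_diff_interior n (X : set 'rV[K]_n) : definable M X ->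
  nowhere_dense (X `\` X°).
Proof.
move=> dX; apply: nd; first by definability.
apply/interior_eq0P => x e e0; apply: contrapT => H.
have xe : cube x e `<=` X `\` X°.
  by move=> y xy; apply: contrapT => nY; apply: H; exists y.
have [_ []] := xe _ (cube_center x e0).
by apply/interior_cubeP; exists e => // y /xe[].
Qed.

(** In a cube contained in the boundary, the points of [X] are dense and none is interior, so the
    difference of [X] and its interior would be dense there. *)
Lemma interior_boundary n (X : set 'rV[K]_n) : definable M X ->
  (boundary X)° = set0.
Proof.
move=> dX; apply/interior_eq0P => x e e0; apply: contrapT => H.
have xe : cube x e `<=` boundary X.
  by move=> y xy; apply: contrapT => nY; apply: H; exists y.
have [y [d [d0 yd Yd]]] := (nowhere_denseP _).1 (nowhere_dense_diff_interior dX) x e e0.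
have [cX _] := xe _ (yd _ (cube_center y d0)).
have [z Xz yz] := (closure_cubeP _ _).1 cX d d0.
by apply: (Yd z yz); split=> //; case: (xe _ (yd _ yz)).
Qed.

Lemma almost_open_definable n (X : set 'rV[K]_n) : definable M X -> almost_open M X.
Proof.
move=> dX; exists X°; split; [by definability|exact: open_interior|].
rewrite (_ : X `+` X° = X `\` X°).
  apply: nowhere_dense_meager; first by definability.
  exact: nowhere_dense_diff_interior.
by apply/predeqP => x; split=> [[//|[/interior_subset ? ?]]|?]; [|left].
Qed.

Lemma colsub_closure n p (s : 'I_p -> 'I_n) (X : set 'rV[K]_n) :
  colsub s @` closure X `<=` closure (colsub s @` X).
Proof.
move=> _ [x cX <-]; apply/closure_cubeP => e e0.
have [y Xy xy] := (closure_cubeP _ _).1 cX e e0.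
by exists (colsub s y); [exists y|move=> i; rewrite !mxE].
Qed.

(** The projection of the closure lies in the closure of the projection, and a definable projection
    with empty interior is nowhere dense. *)
Lemma topdim_closure n (X : set 'rV[K]_n) : definable M X ->
  topdim X = topdim (closure X).
Proof.
move=> dX; apply: eq_bigl => I; apply/asbool_equiv_eq; split=> -[y Hy].
  by exists y; apply: interiorS Hy => _ [x Xx <-]; exists x => //; apply: subset_closure.
apply/set0P/eqP => /(nd (definable_colsub _ dX)) H.
suff : (closure (coord_proj I @` X))° y by rewrite H.
by apply: interiorS Hy; apply: colsub_closure.
Qed.

Lemma topdim_setU n (A B : set 'rV[K]_n) : definable M A -> definable M B ->
  topdim (A `|` B) = maxe (topdim A) (topdim B).
Proof.
move=> dA dB; apply/le_anti/andP; split; last first.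
  by rewrite ge_max; apply/andP; split; apply/topdim_leP => I [y Hy];
    (have/topdim_leP := lexx (topdim (A `|` B))); apply; exists y;
    apply: interiorS Hy; apply: image_subset; [left|right].
apply/topdim_leP => I [y Hy]; rewrite le_max.
have [A0|/set0P HA] := eqVneq (coord_proj I @` A)° set0; last first.
  by have /topdim_leP := lexx (topdim A) => ->.
have [B0|/set0P HB] := eqVneq (coord_proj I @` B)° set0; last first.
  by have /topdim_leP := lexx (topdim B) => ->; rewrite ?orbT.
have := iminimal_interiorU Kcomplete imin (definable_colsub _ dA)
  (definable_colsub _ dB) A0 B0.
by rewrite -image_setU => E; rewrite /coord_proj E in Hy.
Qed.

(** Positive dimension means dimension at least 1; if this occurred over a set with interior, [A]
    would have dimension at least [d + 1]. *)
Lemma topdim_fibers_gt0 d m (A : set 'rV[K]_(d + m)) :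
  definable M A -> topdim A = d%:Z%:E ->
  nowhere_dense [set x : 'rV[K]_d | (0%:E < topdim (fiber A x))%E].
Proof.
move=> dA Ad.
have gt0 (X : set 'rV[K]_m) : (0%:E < topdim X)%E -> (1%N%:Z%:E <= topdim X)%E.
  rewrite ltNge => H; apply/topdim_geP; apply: contrapT => nI; move/negP: H; apply.
  apply/topdim_leP => I XI; rewrite lee_fin lez_nat leqNgt; apply/negP => I0.
  by apply: nI; exists I.
apply: (@nowhere_denseS _ _ _ [set x | 1%N%:Z%:E <= topdim (fiber A x)]%E).
  by move=> x; apply: gt0.
apply: nd; first exact: definable_topdim_fiber.
apply: contrapT => /eqP/set0P H.
have := @topdim_fibers_union _ _ Kcomplete imin d m d (@id 'I_d) 1 A (@inj_id _) dA.
by rewrite colsub_id => /(_ H); rewrite Ad lee_fin lez_nat addn1 ltnn.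
Qed.

Lemma topdim_le_fibers d k m n (A : set 'rV[K]_(n + m)) : definable M A ->
  (topdim A <= (d + k)%N%:Z%:E)%E ->
  (topdim [set x : 'rV[K]_n | d%:Z%:E <= topdim (fiber A x)]%E <= k%:Z%:E)%E.
Proof.
move=> dA Adk; apply/topdim_leP => I HI.
have := topdim_fibers_union Kcomplete imin (@enum_val_inj _ (mem I)) dA HI.
by move/le_trans/(_ Adk); rewrite !lee_fin !lez_nat addnC leq_add2l.
Qed.

Lemma topdim_pseudo_enumerable_union d n p (N : set 'rV[K]_p)
    (X : 'rV[K]_p -> set 'rV[K]_n) :
  at_most_pseudo_enumerable M N -> definable_family M N X ->
  (forall t, N t -> (topdim (X t) <= d%:Z%:E)%E) ->
  (topdim (\bigcup_(t in N) X t) <= d%:Z%:E)%E.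
Proof.
move=> peN dX Xd; apply/topdim_leP => I HI.
rewrite lee_fin lez_nat leqNgt; apply/negP => dI.
move: HI; rewrite /coord_proj image_bigcup.
rewrite (interior_pseudo_enumerable_union Kcomplete imin peN); first by case.
  pose F t x := N t /\ X t x.
  have dF : definable M (fun w : 'rV_(p + n) => F (lsubmx w) (rsubmx w)) := dX.
  suff : definable M (fun z : 'rV_(p + #|I|) => exists x, F (lsubmx z) x /\
      colsub (fun j : 'I_#|I| => enum_val j) x = rsubmx z).
    apply: definable_ext => z; split=> [[x [[Nz Xx] E]]|[Nz [x Xx E]]].
      by split=> //; exists x.
    by exists x.
  by definability.
move=> t Nt; apply: topdim_lt_colsub (Xd t Nt) dI; exact: enum_val_inj.
Qed.

Lemma topdim_increasing_union d n (X : K -> set 'rV[K]_n) :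
  increasing_definable_family M X -> (forall t, (topdim (X t) <= d%:Z%:E)%E) ->
  (topdim (\bigcup_(t in [set: K]) X t) <= d%:Z%:E)%E.
Proof.
move=> [dX monoX] Xd; apply/topdim_leP => I HI.
rewrite lee_fin lez_nat leqNgt; apply/negP => dI.
have {}dX : definable M (fun z : 'rV_(1 + n) => X (lsubmx z ord0 ord0) (rsubmx z)).
  by apply: definable_ext dX => z; split=> [[]|].
move: HI; rewrite /coord_proj image_bigcup.
rewrite (interior_increasing_union Kcomplete imin); first by case.
- suff : definable M (fun z : 'rV_(1 + #|I|) => exists x, X (lsubmx z ord0 ord0) x /\
      colsub (fun j : 'I_#|I| => enum_val j) x = rsubmx z).
    apply: definable_ext => z; split=> [[x [Xx E]]|[x Xx E]]; last by exists x.
    by exists x.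
  by definability.
- by move=> s t st; apply: image_subset; apply: monoX.
- move=> t; apply: topdim_lt_colsub (Xd t) dI; exact: enum_val_inj.
Qed.

Lemma interior_pseudo_enumerable_unionK p (N : set 'rV[K]_p) (X : 'rV[K]_p -> set K) :
  at_most_pseudo_enumerable M N -> definable_family M N (fun t => setK1 (X t)) ->
  (forall t, N t -> (X t)° = set0) -> (\bigcup_(t in N) X t)° = set0.
Proof.
move=> peN dX X0; apply/setK1_eq0; rewrite -interior_setK1.
rewrite (_ : setK1 _ = \bigcup_(t in N) setK1 (X t)) //.
apply: (interior_pseudo_enumerable_union Kcomplete imin peN dX) => t Nt.
by rewrite interior_setK1; apply/setK1_eq0/X0.
Qed.

End Necessity.

Theorem theorem3p10 (K : realFieldType) (M : expansion K)
    (Kcomplete : definably_complete M) :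
  [<->
    (* (1) *)
    i_minimal M;
    (* (2) *)
    forall (n : nat) (X : set 'rV[K]_n),
      definable M X -> X° = set0 -> nowhere_dense X;
    (* (3) *)
    forall (n : nat) (X : set 'rV[K]_n),
      definable M X -> (boundary X)° = set0;
    (* (4) *)
    forall X : set K,
      definable M (setK1 X) -> topdim (setK1 X) = topdim (setK1 (closure X));
    (* (5) *)
    forall (n : nat) (X : set 'rV[K]_n),
      definable M X -> topdim X = topdim (closure X);
    (* (6) *)
    forall (n : nat) (U : set 'rV[K]_n) (f : 'rV[K]_n -> K),
      definable M U -> open U ->
      definable_fun M U (fun x => (f x)%:M : 'rV[K]_1) ->
      nowhere_dense (discont U f);
    (* (7) *)
    forall (n m : nat) (A : set 'rV[K]_(n + m)),
      definable M A -> nowhere_dense (bad_fibers A);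
    (* (8) *)
    forall (n m : nat) (A : set 'rV[K]_(n + m)),
      definable M A ->
      nowhere_dense
        [set x : 'rV[K]_n | fiber (frontier A) x <> frontier (fiber A x)];
    (* (9) *)
    forall X : set K,
      definable M (setK1 X) -> X° !=set0 \/ meager M (setK1 X);
    (* (10) *)
    forall (n : nat) (X : set 'rV[K]_n),
      definable M X -> X° !=set0 \/ meager M X;
    (* (11) *)
    forall A B : set K,
      definable M (setK1 A) -> definable M (setK1 B) ->
      topdim (setK1 (A `|` B)) = maxe (topdim (setK1 A)) (topdim (setK1 B));
    (* (12) *)
    forall (n : nat) (A B : set 'rV[K]_n),
      definable M A -> definable M B ->
      topdim (A `|` B) = maxe (topdim A) (topdim B);
    (* (13), where n = d + m since dim A <= n *)
    forall (d m : nat) (A : set 'rV[K]_(d + m)),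
      definable M A -> topdim A = d%:Z%:E ->
      nowhere_dense [set x : 'rV[K]_d | (0%:E < topdim (fiber A x))%E];
    (* (14) *)
    forall (d k m n : nat) (A : set 'rV[K]_(n + m)),
      (k <= n)%N -> (d <= m)%N -> definable M A ->
      (topdim A <= (d + k)%N%:Z%:E)%E ->
      (topdim [set x : 'rV[K]_n | d%:Z%:E <= topdim (fiber A x)]%E <= k%:Z%:E)%E;
    (* (15) *)
    forall (p : nat) (N : set 'rV[K]_p) (X : 'rV[K]_p -> set K),
      at_most_pseudo_enumerable M N ->
      definable_family M N (fun t => setK1 (X t)) ->
      (forall t, N t -> (X t)° = set0) ->
      (\bigcup_(t in N) X t)° = set0;
    (* (16) *)
    forall (d n p : nat) (N : set 'rV[K]_p) (X : 'rV[K]_p -> set 'rV[K]_n),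
      (d <= n)%N ->
      at_most_pseudo_enumerable M N -> definable_family M N X ->
      (forall t, N t -> (topdim (X t) <= d%:Z%:E)%E) ->
      (topdim (\bigcup_(t in N) X t) <= d%:Z%:E)%E ]
  /\
  (i_minimal M ->
    [/\
      (* (I) *)
      forall (n : nat) (X : set 'rV[K]_n), meager M X -> nowhere_dense X,
      (* (II) *)
      forall (d n : nat) (X : K -> set 'rV[K]_n),
        (d <= n)%N -> increasing_definable_family M X ->
        (forall t, (topdim (X t) <= d%:Z%:E)%E) ->
        (topdim (\bigcup_(t in [set: K]) X t) <= d%:Z%:E)%E,
      (* (III) *)
      forall (U : set K) (f : K -> K),
        open U -> definable M (setK1 U) ->
        definable_fun M (setK1 U)
          (fun x : 'rV[K]_1 => (f (x ord0 ord0))%:M : 'rV[K]_1) ->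
        exists D : set K,
          [/\ definable M (setK1 D), closed D, D° = set0
            & forall I : set K,
                definably_connected_component M (setK1 (U `\` D)) (setK1 I) ->
                {within I, continuous f} /\
                ((exists c : K, forall x, I x -> f x = c) \/
                 strictly_monotone_on I f)]
      & (* (IV) *)
      forall (n : nat) (X : set 'rV[K]_n), definable M X -> almost_open M X]).
Proof.
have from4 : (forall X : set K, definable M (setK1 X) ->
    topdim (setK1 X) = topdim (setK1 (closure X))) -> i_minimal M.
  move=> H X dX X0; apply: contrapT => /eqP/set0P/topdim_setK1_ge1.
  by rewrite -H // => /topdim_setK1_ge1; rewrite X0 => -[].
have from9 := @i_minimal_of_meager K M Kcomplete.
have from11 := @i_minimal_of_topdim_setU K M.
have from15 := @i_minimal_of_pseudo_enumerable_union K M.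
have from2 : (forall (n : nat) (X : set 'rV[K]_n),
    definable M X -> X° = set0 -> nowhere_dense X) -> i_minimal M.
  move=> H X dX X0; apply/nowhere_dense_setK1; apply: H => //.
  by rewrite interior_setK1 X0.
have from16 : (forall (d n p : nat) (N : set 'rV[K]_p) (X : 'rV[K]_p -> set 'rV[K]_n),
    (d <= n)%N -> at_most_pseudo_enumerable M N -> definable_family M N X ->
    (forall t, N t -> (topdim (X t) <= d%:Z%:E)%E) ->
    (topdim (\bigcup_(t in N) X t) <= d%:Z%:E)%E) -> i_minimal M.
  move=> H; apply: from15 => N X peN dX X0; apply/topdim_setK1_le0.
  rewrite (_ : setK1 _ = \bigcup_(t in N) setK1 (X t)) //.
  by apply: H peN dX _ => // t /X0/topdim_setK1_le0.
split; last first.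
  move=> imin; split.
  - exact: meager_nowhere_dense.
  - by move=> d n X _; apply: (topdim_increasing_union Kcomplete imin).
  - exact: piecewise_monotone.
  - exact: almost_open_definable.
tfae.
- exact: iminimal_nowhere_dense.
- by move=> /from2 imin n X; apply: (interior_boundary Kcomplete imin).
(* For [X] with empty interior the boundary is the whole closure. *)
- move=> H; have imin : i_minimal M.
    move=> X dX X0; apply/nowhere_dense_setK1.
    by have := H 1%N _ dX; rewrite /boundary interior_setK1 X0 setD0.
  by move=> X dX; rewrite -closure_setK1; apply: (topdim_closure Kcomplete imin).
- by move=> /from4 imin n X; apply: (topdim_closure Kcomplete imin).
- move=> H; have imin : i_minimal M.
    by apply: from4 => X dX; rewrite -closure_setK1; apply: H.
  by move=> n U f _ _; apply: (nowhere_dense_discont Kcomplete imin).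
- move=> H; have imin : i_minimal M.
    apply: i_minimal_of_discont => f df; apply: H df; last exact: openT.
    exact: definable_Prop.
  exact: (nowhere_dense_bad_fibers Kcomplete imin).
- move=> H; have imin : i_minimal M.
    apply: i_minimal_of_frontier => X dX _; apply/nowhere_dense_setK1.
    apply: nowhere_denseS (H 1%N 1%N _ (definable_axis_copy dX)).
    exact: bad_fibers_axis_copy.
  exact: (nowhere_dense_fiber_frontier Kcomplete imin).
- move=> H; have imin : i_minimal M.
    apply: i_minimal_of_frontier => X dX _; apply/nowhere_dense_setK1.
    apply: nowhere_denseS (H 1%N 1%N _ (definable_axis_copy dX)) => x.
    exact: fiber_frontier_axis_copy.
  move=> X dX; have [X0|/set0P ?] := eqVneq X° set0; [right|by left].
  by apply: nowhere_dense_meager => //; apply/nowhere_dense_setK1/imin.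
- move=> /from9 imin n X dX; have [X0|/set0P ?] := eqVneq X° set0; [right|by left].
  by apply: nowhere_dense_meager => //; apply: (iminimal_nowhere_dense Kcomplete).
- move=> H; have imin : i_minimal M.
    apply: from9 => X /[dup] dX /H[|]; [|by right].
    by rewrite interior_setK1 => -[x Xx]; left; exists (x ord0 ord0).
  by move=> A B; apply: (topdim_setU Kcomplete imin).
- by move=> /from11 imin n A B; apply: (topdim_setU Kcomplete imin).
- move=> H; have imin : i_minimal M by apply: from11 => A B; apply: H.
  by move=> d m A; apply: (topdim_fibers_gt0 Kcomplete imin).
- move=> H; have imin : i_minimal M by apply: i_minimal_of_strip => A; apply: H.
  by move=> d k m n A _ _; apply: (topdim_le_fibers Kcomplete imin).
- move=> H; have imin : i_minimal M.
    by apply: i_minimal_of_two_strips => A dA A1; apply: H.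
  by move=> p N X; apply: (interior_pseudo_enumerable_unionK Kcomplete imin).
- move=> H; have imin : i_minimal M by apply: from15 => N X; apply: H.
  by move=> d n p N X _; apply: (topdim_pseudo_enumerable_union Kcomplete imin).
- exact: from16.
Qed.
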